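(* (Direct part) Let $\tilde f=f_1\times\cdots\times f_r\colon\tilde M=\prod_{a=1}^rM_a\to\prod_{a=1}^r\mathbb{R}^{n_a}=\mathbb{R}^N$ be a product of immersions $f_a\colon M_a\to\mathbb{R}^{n_a}$, $1\le a\le r$, such that $N_{\tilde f}\tilde M$ carries a flat parallel subbundle $E$. Let $\phi\colon\tilde M\times\mathbb{R}^s\to E$ be a parallel vector bundle isometry, let $f_0\colon M_0\to\Omega(\tilde f;\phi)\subset\mathbb{R}^s$ be an immersion, and let $f\colon M=\prod_{i=0}^rM_i=M_0\times\tilde M\to\mathbb{R}^N$, $f(p_0,\tilde p)=\tilde f(\tilde p)+\phi_{\tilde p}(f_0(p_0))$, be the partial tube determined by $(f_0,\tilde f,\phi)$. Then the metric induced on $M$ by $f$ is polar and the second fundamental form of $f$ is adapted to the product net of $M$. (Converse) Let $f\colon M=\prod_{i=0}^rM_i\to\mathbb{R}^N$ be an immersion whose induced metric is polar and whose second fundamental form is adapted to the product net of $M$. Then there exist an orthogonal decomposition $\mathbb{R}^N=\prod_{a=1}^r\mathbb{R}^{n_a}$, immersions $f_a\colon M_a\to\mathbb{R}^{n_a}$ for $1\le a\le r$ with product $\tilde f=f_1\times\cdots\times f_r$, a flat parallel subbundle $E$ of $N_{\tilde f}\tilde M$, a parallel vector bundle isometry $\phi\colon\tilde M\times\mathbb{R}^s\to E$ and an immersion $f_0\colon M_0\to\Omega(\tilde f;\phi)\subset\mathbb{R}^s$ such that $f$ is the partial tube determined by $(f_0,\tilde f,\phi)$.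
   Context: Product manifolds are connected. On $M=\prod_{i=0}^rM_i$, with projections $\pi_i\colon M\to M_i$, a Riemannian metric $g$ is polar if there are a Riemannian metric $g_0$ on $M_0$ and smooth families $g_a=(g_a(p_0))_{p_0\in M_0}$ of Riemannian metrics on $M_a$ parametrized by $M_0$, $1\le a\le r$, such that $g=\pi_0^*g_0+\sum_{a=1}^r\pi_a^*(g_a\circ\pi_0)$, i.e. $g(p)(X,Y)=g_0(\pi_{0*}X,\pi_{0*}Y)+\sum_a g_a(\pi_0(p))(\pi_{a*}X,\pi_{a*}Y)$. The product net of $M$ is $(E_i)_{i=0,\dots,r}$, with $E_i$ the subbundle of tangent spaces to the factor $M_i$; the second fundamental form $\alpha$ of $f$ is adapted to it if $\alpha(E_i,E_j)=0$ for all $i\ne j$. The product of immersions $f_a$ is $\tilde f(p_1,\dots,p_r)=(f_1(p_1),\dots,f_r(p_r))$. For an immersion $h\colon L\to\mathbb{R}^N$, $L$ carries the induced metric, $N_hL$ is its normal bundle with the normal connection and $A^h_\xi$ its shape operators, $\langle A^h_\xi X,Y\rangle=\langle\alpha_h(X,Y),\xi\rangle$. A parallel vector bundle isometry $\phi\colon L\times\mathbb{R}^s\to E$ onto a flat parallel subbundle $E\subset N_hL$ is a smooth bundle map such that each $\phi_x=\phi(x,\cdot)\colon\mathbb{R}^s\to E(x)$ is a linear isometry and, for each fixed $y\in\mathbb{R}^s$, $x\mapsto\phi_x(y)$ is parallel in the normal connection. Put $\Omega(h;\phi)=\{Y\in\mathbb{R}^s:\ I-A^h_{\phi_x(Y)}\text{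 is nonsingular on }T_xL\text{ for every }x\in L\}$. The partial tube determined by $(f_0,h,\phi)$, for an immersion $f_0\colon M_0\to\Omega(h;\phi)$, is the immersion $M_0\times L\to\mathbb{R}^N$, $(p_0,x)\mapsto h(x)+\phi_x(f_0(p_0))$. *)

(* Defs.v *)
From mathcomp Require Import all_boot all_order all_algebra.
From mathcomp Require Import all_classical all_reals all_analysis.
Import numFieldNormedType.Exports.

Set Implicit Arguments.
Unset Strict Implicit.
Unset Printing Implicit Defensive.

Import Order.TTheory GRing.Theory Num.Theory.
Local Open Scope classical_set_scope.
Local Open Scope ring_scope.

Fixpoint Ck (R : realType) (V W : normedModType R) (k : nat)
    (U : set V) (f : V -> W) : Prop :=
  match k with
  | 0 => forall x, U x -> {for x, continuous f}
  | k'.+1 => (forall x, U x -> differentiable f x) /\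
             (forall v, Ck k' U (fun x => 'D_v f x))
  end.

Definition smooth_on (R : realType) (V W : normedModType R)
    (U : set V) (f : V -> W) : Prop := forall k, Ck k U f.

Section SmoothFacts.
Context {R : realType}.

Lemma mulmxr_continuous m n p (A : 'M[R]_(n, p)) :
  continuous (mulmxr A : 'M[R]_(m, n) -> 'M[R]_(m, p)).
Proof.
pose c i j (M : 'M[R]_(m, n)) : 'M[R]_(m, p) := M i j *: (delta_mx i j *m A).
have -> : mulmxr A = \sum_i \sum_j c i j :> ('M[R]_(m, n) -> 'M[R]_(m, p)).
  apply/funext => M; rewrite fct_sumE {1}(matrix_sum_delta M) /= mulmx_suml.
  apply: eq_bigr => i _; rewrite fct_sumE mulmx_suml.
  by apply: eq_bigr => j _; rewrite -scalemxAl.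
move=> M; apply: differentiable_continuous.
apply: differentiable_sum => i; apply: differentiable_sum => j.
by apply: differentiableZl; exact: differentiable_coord.
Qed.

Lemma mulmxr_differentiable m n p (A : 'M[R]_(n, p)) (M : 'M[R]_(m, n)) :
  differentiable (mulmxr A : 'M[R]_(m, n) -> 'M[R]_(m, p)) M.
Proof. exact/linear_differentiable/mulmxr_continuous. Qed.

Variables (V W : normedModType R).

Lemma near_eq_differentiable (f g : V -> W) a :
  (\near a, f a = g a) -> differentiable f a -> differentiable g a.
Proof.
move=> fg /diff_locallyP [dfc fE].
have gE : g \o shift a = cst (g a) + 'd f a +o_ 0 id.
  apply/eqaddoP => e e0.
  have /eqaddoP /(_ e e0) fo := fE.
  have fg0 : \forall h \near (0 : V), f (h + a) = g (h + a).
    by move: fg; rewrite (near_shift 0) /= subr0.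
  near=> h; rewrite /= !fctE /= -(near fg0 h) // -(nbhs_singleton fg).
  exact: (near fo h).
by apply/diff_locallyP; rewrite (diff_unique dfc gE).
Unshelve. all: by end_near. Qed.

Lemma eq_Ck k (U : set V) (f g : V -> W) : open U ->
  (forall x, U x -> f x = g x) -> Ck k U f -> Ck k U g.
Proof.
move=> oU; elim: k f g => [|k IH] f g fg /=.
  move=> cf x Ux; rewrite /prop_for /continuous_at -(fg _ Ux).
  apply: cvg_trans (cf x Ux); apply: near_eq_cvg.
  by near=> y; apply: fg; near: y; exact: open_nbhs_nbhs.
move=> [df dkf]; split=> [x Ux|v].
  apply: near_eq_differentiable (df x Ux).
  by near=> y; apply: fg; near: y; exact: open_nbhs_nbhs.
apply: IH (dkf v) => x Ux; apply: near_eq_derive.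
by near=> y; apply: fg; near: y; exact: open_nbhs_nbhs.
Unshelve. all: by end_near. Qed.

Lemma CkD k (U : set V) (f g : V -> W) : open U ->
  Ck k U f -> Ck k U g -> Ck k U (f + g).
Proof.
move=> oU; elim: k f g => [|k IH] f g /=.
  by move=> cf cg x Ux; apply: continuousD; [exact: cf|exact: cg].
move=> [df cf] [dg cg]; split=> [x Ux|v].
  by apply: differentiableD; [exact: df|exact: dg].
apply: eq_Ck (IH _ _ (cf v) (cg v)) => // x Ux.
by rewrite deriveD //; apply: diff_derivable; [exact: df|exact: dg].
Qed.

Lemma Ck_cst0 k (U : set V) : Ck k U (0 : V -> W).
Proof.
elim: k => [|k IH] /=; first by move=> x _; exact: cvg_cst.
split=> [x _|v]; first exact: differentiable_cst.
have -> // : (fun x => 'D_v (0 : V -> W) x) = 0.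
by apply/funext => x; exact: derive_cst.
Qed.

End SmoothFacts.

Lemma Ck_mulmxr (R : realType) (V : normedModType R) m n p (A : 'M[R]_(n, p))
    k (U : set V) (f : V -> 'M[R]_(m, n)) :
  open U -> Ck k U f -> Ck k U (fun x => f x *m A).
Proof.
move=> oU; elim: k f => [|k IH] f /=.
  move=> cf x Ux; apply: (@continuous_comp _ _ _ f (mulmxr A)); first exact: cf.
  exact: mulmxr_continuous.
move=> [df cf]; split=> [x Ux|v].
  by apply: (@differentiable_comp _ _ _ _ f (mulmxr A)); [exact: df|exact: mulmxr_differentiable].
apply: eq_Ck (IH _ (cf v)) => // x Ux.
have da := @mulmxr_differentiable R m n p A (f x).
have e : 'd (mulmxr A) (f x) = mulmxr A :> ('M[R]_(m, n) -> 'M[R]_(m, p)).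
  by apply: diff_lin; exact: mulmxr_continuous.
have dfA : differentiable (mulmxr A \o f) x.
  by apply: differentiable_comp => //; exact: df.
rewrite (deriveE _ (df x Ux)) (deriveE _ dfA).
by rewrite (@diff_comp _ _ _ _ f (mulmxr A) x (df x Ux) da) /= e.
Qed.

Lemma Ck_comp_mulmxr (R : realType) (W : normedModType R) m n p
    (A : 'M[R]_(n, p)) k (U : set 'M[R]_(m, p)) (f : 'M[R]_(m, p) -> W) :
  Ck k U f -> Ck k [set x | U (x *m A)] (f \o mulmxr A).
Proof.
elim: k f => [|k IH] f.
  move=> cf x Ux; apply: (@continuous_comp _ _ _ (mulmxr A) f).
    exact: mulmxr_continuous.
  exact: cf.
move=> [df cf]; split=> [x Ux|v].
  apply: (@differentiable_comp _ _ _ _ (mulmxr A) f).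
    exact: mulmxr_differentiable.
  exact: df.
have -> : (fun x => 'D_v (f \o mulmxr A) x) =
          (fun x => 'D_(v *m A) f x) \o mulmxr A.
  apply/funext => x; rewrite /= /derive.
  have -> // : (fun h : R => h^-1 *: ((f \o mulmxr A \o shift x) (h *: v) -
                 (f \o mulmxr A) x)) =
      (fun h => h^-1 *: ((f \o shift (x *m A)) (h *: (v *m A)) - f (x *m A))).
  by apply/funext => h; rewrite /= mulmxDl scalemxAl.
exact: (IH _ (cf (v *m A))).
Qed.

Lemma mxrow_sum (R : realType) m k (q : 'I_k -> nat)
    (B : forall i, 'M[R]_(m, q i)) :
  \mxrow_i B i = \sum_i B i *m (submxrow 1%:M i)^T.
Proof.
have e : 1%:M = \mxcol_i (submxrow (1%:M : 'M[R]_(\sum_i q i)) i)^T.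
  by rewrite -tr_mxrow submxrowK trmx1.
by rewrite -[LHS]mulmx1 {1}e mul_mxrow_mxcol.
Qed.

Lemma submxrow_mul (R : realType) m k (q : 'I_k -> nat)
    (x : 'M[R]_(m, \sum_i q i)) i : submxrow x i = x *m submxrow 1%:M i.
Proof. by rewrite mul_submxrow mulmx1. Qed.

Lemma Ck_mxrow (R : realType) (V : normedModType R) k l (q : 'I_k -> nat)
    (U : set V) (f : forall i, V -> 'rV[R]_(q i)) : open U ->
  (forall i, Ck l U (f i)) -> Ck l U (fun x => \mxrow_i f i x).
Proof.
move=> oU cf.
pose E i := (submxrow (1%:M : 'M[R]_(\sum_j q j)) i)^T.
have -> : (fun x => \mxrow_i f i x) = \sum_i (fun x => f i x *m E i).
  by apply/funext => x; rewrite fct_sumE mxrow_sum.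
move: (\sum_i q i)%N E => n E.
elim/big_ind: _ => [|g h|i _]; [exact: Ck_cst0|exact: CkD|].
exact: Ck_mulmxr.
Qed.

Lemma Ck_sub (R : realType) (V W : normedModType R) k (U U' : set V)
    (f : V -> W) : U `<=` U' -> Ck k U' f -> Ck k U f.
Proof.
move=> UU; elim: k f => [|k IH] f /=; first by move=> cf x /UU; exact: cf.
by move=> [df cf]; split=> [x /UU|v]; [exact: df|exact/IH/cf].
Qed.

Section ProdTop.
Variables (k : nat) (T : 'I_k -> topologicalType).
Let P : topologicalType := prod_topology T.

Lemma prod_nbhsP (p : P) (A : set P) : nbhs p A ->
  exists2 U : forall i, set (T i), (forall i, open_nbhs (p i) (U i)) &
    [set q | forall i, U i (q i)] `<=` A.
Proof.
pose G := [set A : set P | exists2 U : forall i, set (T i),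
  (forall i, open_nbhs (p i) (U i)) & [set q | forall i, U i (q i)] `<=` A].
have FG : Filter G.
  split.
  - by exists (fun=> setT) => // i; split=> //; exact: openT.
  - move=> B C [U oU UB] [V oV VC]; exists (fun i => U i `&` V i).
      by move=> i; apply: open_nbhsI.
    by move=> q qUV; split; [apply: UB|apply: VC] => i; have [] := qUV i.
  - by move=> B C BC [U oU UB]; exists U => //; exact: subset_trans BC.
suff : cvg_to G (nbhs p) by move=> /(_ A).
apply/cvg_sup => i B [C [[D oD <-] Dp] CB].
exists (fun j => if j == i then [set q : T j | forall e : j = i, D (ecast i (T i) e q)] else setT).
  move=> j; case: eqVneq => [e|_]; last by split=> //; exact: openT.
  subst j; split.
    rewrite [X in open X](_ : _ = D) //; apply/seteqP; split => q /=.
      by move=> /(_ erefl).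
    by move=> Dq e; rewrite (eq_axiomK e).
  by move=> e; rewrite (eq_axiomK e).
move=> q /(_ i); rewrite eqxx => /(_ erefl) /= Dq; exact: CB.
Qed.

Lemma prod_continuous_proj (i : 'I_k) : continuous (fun p : P => p i).
Proof. exact: (@proj_continuous _ T i). Qed.

Lemma prod_nbhs (p : P) (U : forall i, set (T i)) :
  (forall i, nbhs (p i) (U i)) -> nbhs p [set q | forall i, U i (q i)].
Proof.
move=> nU; apply: (@filter_forall P _ (fun i q => U i (q i)) (nbhs p)) => i.
exact: (prod_continuous_proj (nU i)).
Qed.

Lemma prod_open (U : forall i, set (T i)) :
  (forall i, open (U i)) -> open [set q : P | forall i, U i (q i)].
Proof.
move=> oU; rewrite openE => p pU; apply: prod_nbhs => i.
exact: open_nbhs_nbhs.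
Qed.

Lemma prod_continuous_at (S : topologicalType) (f : S -> P) x :
  (forall i, {for x, continuous (fun s => f s i)}) -> {for x, continuous f}.
Proof.
move=> cf A /prod_nbhsP [U oU UA]; rewrite /= nbhs_simpl.
have : \forall s \near x, forall i, U i (f s i).
  by apply: (@filter_forall S _ (fun i s => U i (f s i)) (nbhs x)) => i; apply: cf; exact: open_nbhs_nbhs.
by apply: filterS => s; exact: UA.
Qed.

Lemma prod_second_countable :
  (forall i, @second_countable (T i)) -> @second_countable P.
Proof.
move=> sc; pose B i := projT1 (cid2 (sc i)).
have cB i : countable (B i) by rewrite /B; case: cid2.
have bB i : basis (B i) by rewrite /B; case: cid2.
have fB i : {f : set (T i) -> nat | {in B i &, injective f}}.
  by apply: cid; exact/countable_injP.
pose box (U : forall i, set (T i)) : set P := [set q | forall i, U i (q i)].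
exists [set A | exists2 U, (forall i, B i (U i)) & box U = A].
  apply/countable_injP.
  pose u (A : set P) : forall i, set (T i) :=
    xget (fun=> set0) [set U | (forall i, B i (U i)) /\ box U = A].
  have uP A : (exists2 U, (forall i, B i (U i)) & box U = A) ->
      (forall i, B i (u A i)) /\ box (u A) = A.
    move=> [U BU UA].
    by apply: (@xgetPex _ _ [set U | (forall i, B i (U i)) /\ box U = A]); exists U.
  exists (fun A => pickle [ffun i => sval (fB i) (u A i)]) => A A'.
  move=> /set_mem /uP [BA {2}<-] /set_mem /uP [BA' {2}<-] /(pcan_inj pickleK).
  move=> /ffunP e; congr box; apply: functional_extensionality_dep => i.
  have := e i; rewrite !ffunE; apply: (svalP (fB i)); exact/mem_set.
split=> [A [U BU <-]|p A /prod_nbhsP [U oU UA]].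
  by apply: prod_open => i; have [Bo _] := bB i; exact/Bo/BU.
have V i : {V | (B i V /\ V (p i)) & V `<=` U i}.
  have [_ /(_ (p i) (U i))] := bB i.
  by move=> /(_ (open_nbhs_nbhs (oU i))) ?; exact: cid2.
exists (box (fun i => s2val (V i))).
  split; first by exists (fun i => s2val (V i)) => // i; case: (s2valP (V i)).
  by move=> i; case: (s2valP (V i)).
by apply: subset_trans UA => q Vq i; apply: (s2valP' (V i)); exact: Vq.
Qed.

End ProdTop.
Record chart (R : realType) (T : topologicalType) (m : nat) := Chart {
  chart_dom : set T;
  chart_rng : set 'rV[R]_m;
  chart_map : T -> 'rV[R]_m;
  chart_inv : 'rV[R]_m -> T;
  chart_dom_open : open chart_dom;
  chart_rng_open : open chart_rng;
  chart_map_rng : forall p, chart_dom p -> chart_rng (chart_map p);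
  chart_inv_dom : forall x, chart_rng x -> chart_dom (chart_inv x);
  chart_mapK : forall p, chart_dom p -> chart_inv (chart_map p) = p;
  chart_invK : forall x, chart_rng x -> chart_map (chart_inv x) = x;
  chart_map_cont : forall p, chart_dom p -> {for p, continuous chart_map};
  chart_inv_cont : forall x, chart_rng x -> {for x, continuous chart_inv} }.

(* The atlas is indexed by the points: [chart_at p] is a chart around p.      *)
Record manifold (R : realType) := Manifold {
  mcarrier :> topologicalType;
  mdim : nat;
  chart_at : mcarrier -> chart R mcarrier mdim;
  chart_at_dom : forall p, chart_dom (chart_at p) p;
  chart_at_smooth : forall p q,
    smooth_on
      [set x | chart_rng (chart_at q) x /\
               chart_dom (chart_at p) (chart_inv (chart_at q) x)]
      (chart_map (chart_at p) \o chart_inv (chart_at q));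
  manifold_hausdorff : hausdorff_space mcarrier;
  manifold_second_countable : @second_countable mcarrier }.

Fact chart_overlap_open (R : realType) (T : topologicalType) m
    (c d : chart R T m) :
  open [set x | chart_rng c x /\ chart_dom d (chart_inv c x)].
Proof.
rewrite openE => x [cx dx]; apply: filterI.
  by apply: open_nbhs_nbhs; split=> //; exact: chart_rng_open.
apply: (chart_inv_cont cx); apply: open_nbhs_nbhs; split=> //.
exact: chart_dom_open.
Qed.

Definition connected_manifold (R : realType) (M : manifold R) : Prop :=
  [set: M] !=set0 /\ connected [set: M].

Section ProductChart.
Variables (R : realType) (k : nat) (T : 'I_k -> topologicalType).
Variables (m : 'I_k -> nat) (c : forall i, chart R (T i) (m i)).
Let P : topologicalType := prod_topology T.
Let V := 'rV[R]_(\sum_i m i).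

Let dom : set P := [set p | forall i, chart_dom (c i) (p i)].
Let rng : set V := [set x | forall i, chart_rng (c i) (submxrow x i)].
Let map (p : P) : V := \mxrow_i chart_map (c i) (p i).
Let inv (x : V) : P := fun i => chart_inv (c i) (submxrow x i).

Fact prod_chart_dom_open : open dom.
Proof. exact: (@prod_open k T _ (fun i => chart_dom_open (c i))). Qed.

Fact submxrow_continuous i :
  continuous (fun x : V => submxrow x i : 'rV[R]_(m i)).
Proof.
rewrite [X in continuous X](_ : _ =
  mulmxr (submxrow (1%:M : 'M[R]_(\sum_j m j)) i)); last first.
  by apply/funext => x; rewrite /= submxrow_mul.
exact: mulmxr_continuous.
Qed.

Fact prod_chart_rng_open : open rng.
Proof.
rewrite openE => x xr; suff : \forall y \near x, forall i, chart_rng (c i) (submxrow y i).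
  by [].
apply: (@filter_forall V _ (fun i y => chart_rng (c i) (submxrow y i)) (nbhs x)).
move=> i; have cx := @submxrow_continuous i x; apply: cx.
by apply: open_nbhs_nbhs; split; [exact: chart_rng_open|exact: xr].
Qed.

Fact prod_chart_map_rng p : dom p -> rng (map p).
Proof. by move=> dp i; rewrite /map mxrowK; exact/chart_map_rng/dp. Qed.

Fact prod_chart_inv_dom x : rng x -> dom (inv x).
Proof. by move=> rx i; exact/chart_inv_dom/rx. Qed.

Fact prod_chart_mapK p : dom p -> inv (map p) = p.
Proof.
move=> dp; apply: functional_extensionality_dep => i.
by rewrite /inv /map mxrowK; exact/chart_mapK/dp.
Qed.

Fact prod_chart_invK x : rng x -> map (inv x) = x.
Proof.
by move=> rx; apply/mxrowP => i; rewrite /map mxrowK; exact/chart_invK/rx.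
Qed.

Fact prod_chart_map_cont p : dom p -> {for p, continuous map}.
Proof.
move=> dp.
pose E i := (submxrow (1%:M : 'M[R]_(\sum_j m j)) i)^T.
have -> : map = \sum_i (fun p : P => chart_map (c i) (p i) *m E i).
  by apply/funext => q; rewrite fct_sumE /map mxrow_sum.
move: (\sum_j m j)%N E => n E.
elim/big_ind: _ => [|f g|i _].
- exact: (@cst_continuous P _ (0 : 'rV[R]_n)).
- move=> cf cg; exact: (@continuousD _ _ _ f g p cf cg).
apply: (@continuous_comp _ _ _ (fun p : P => chart_map (c i) (p i))
          (mulmxr (E i))); last exact: mulmxr_continuous.
apply: (@continuous_comp _ _ _ (fun p : P => p i) (chart_map (c i))).
  exact: prod_continuous_proj.
exact/chart_map_cont/dp.
Qed.

Fact prod_chart_inv_cont x : rng x -> {for x, continuous inv}.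
Proof.
move=> rx; apply: prod_continuous_at => i.
apply: (@continuous_comp _ _ _ (fun x : V => submxrow x i) (chart_inv (c i))).
  exact: submxrow_continuous.
exact/chart_inv_cont/rx.
Qed.

Definition prod_chart : chart R P (\sum_i m i) :=
  Chart prod_chart_dom_open prod_chart_rng_open prod_chart_map_rng
    prod_chart_inv_dom prod_chart_mapK prod_chart_invK prod_chart_map_cont
    prod_chart_inv_cont.

End ProductChart.

Section ProductManifold.
Variables (R : realType) (k : nat) (M : 'I_k -> manifold R).
Let P : topologicalType := prod_topology M.
Let at_ (p : P) := prod_chart (fun i => chart_at (p i)).

Fact prodM_at_dom p : chart_dom (at_ p) p.
Proof. by move=> i; exact: chart_at_dom. Qed.

Fact prodM_at_smooth p q :
  smooth_on
    [set x | chart_rng (at_ q) x /\ chart_dom (at_ p) (chart_inv (at_ q) x)]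
    (chart_map (at_ p) \o chart_inv (at_ q)).
Proof.
move=> l; pose tr i := chart_map (chart_at (p i)) \o chart_inv (chart_at (q i)).
pose J i : 'M[R]_(\sum_j mdim (M j), mdim (M i)) :=
  submxrow (1%:M : 'M[R]_(\sum_j mdim (M j))) i.
have -> : chart_map (at_ p) \o chart_inv (at_ q) =
    (fun x => \mxrow_i (tr i \o mulmxr (J i)) x).
  by apply/funext => x; apply/eq_mxrowP => i; rewrite /= -submxrow_mul.
apply: (@Ck_mxrow _ _ _ _ (fun i => mdim (M i)) _
  (fun i => tr i \o mulmxr (J i))); first exact: chart_overlap_open.
move=> i.
have := @Ck_comp_mulmxr R _ 1 _ _ (J i) l _ _ (chart_at_smooth (p i) (q i) l).
apply: Ck_sub.
by move=> x [qx px] /=; rewrite -submxrow_mul; split; [exact: qx|exact: px].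
Qed.

Fact prodM_hausdorff : hausdorff_space P.
Proof.
by apply: (@hausdorff_product _ (fun i => M i)) => i; exact: manifold_hausdorff.
Qed.

Fact prodM_second_countable : @second_countable P.
Proof.
by apply: prod_second_countable => i; exact: manifold_second_countable.
Qed.

Definition prodM : manifold R :=
  Manifold prodM_at_dom prodM_at_smooth prodM_hausdorff prodM_second_countable.

End ProductManifold.

(* The tangent space T_pM is identified with 'rV_(mdim M) by the coordinates  *)
(* of the chart [chart_at p].                                                 *)

Definition smooth_map_on (R : realType) (M : manifold R) (W : normedModType R)
    (U : set M) (f : M -> W) : Prop :=
  forall q, smooth_on
    [set x | chart_rng (chart_at q) x /\ U (chart_inv (chart_at q) x)]
    (f \o chart_inv (chart_at q)).

Definition smooth_map (R : realType) (M : manifold R) (W : normedModType R)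
    (f : M -> W) : Prop := smooth_map_on setT f.

Definition ediff (R : realType) (M : manifold R) (W : normedModType R)
    (f : M -> W) (p : M) (X : 'rV[R]_(mdim M)) : W :=
  'D_X (f \o chart_inv (chart_at p)) (chart_map (chart_at p) p).

Definition mdiff (R : realType) (M L : manifold R) (F : M -> L) (p : M)
    (X : 'rV[R]_(mdim M)) : 'rV[R]_(mdim L) :=
  ediff (chart_map (chart_at (F p)) \o F) p X.

(* The value at p of the vector field with constant coordinates v in the      *)
(* chart around q, for p in the domain of that chart.                         *)
Definition coord_field (R : realType) (M : manifold R) (q : M)
    (v : 'rV[R]_(mdim M)) (p : M) : 'rV[R]_(mdim M) :=
  'D_v (chart_map (chart_at p) \o chart_inv (chart_at q))
    (chart_map (chart_at q) p).

Definition dot (R : realType) (n : nat) (u v : 'rV[R]_n) : R := (u *m v^T) 0 0.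

Definition immersion (R : realType) (M : manifold R) (n : nat)
    (f : M -> 'rV[R]_n) : Prop :=
  smooth_map f /\ forall p, injective (ediff f p).

Definition metric (R : realType) (M : manifold R) : Type :=
  forall p : M, 'rV[R]_(mdim M) -> 'rV[R]_(mdim M) -> R.

Definition pointwise_metric (R : realType) (M : manifold R) (g : metric M)
    : Prop :=
  forall p, [/\ forall X, linear (g p X : _ -> R^o),
                forall X Y, g p X Y = g p Y X &
                forall X, X != 0 -> 0 < g p X X].

Definition riemannian_metric (R : realType) (M : manifold R) (g : metric M)
    : Prop :=
  pointwise_metric g /\
  forall (q : M) (v w : 'rV[R]_(mdim M)),
    @smooth_on R 'rV[R]_(mdim M) R^o (chart_rng (chart_at q))
      (fun x => let p := chart_inv (chart_at q) x in
                g p (coord_field q v p) (coord_field q w p)).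

(* Smoothness of the family means smoothness on the product M0 x M; the       *)
(* coordinates of a point of the product are those of the M0-factor followed  *)
(* by those of the M-factor.                                                  *)
Definition smooth_metric_family (R : realType) (M0 M : manifold R)
    (g : M0 -> metric M) : Prop :=
  (forall p0, riemannian_metric (g p0)) /\
  forall (q0 : M0) (q : M) (v w : 'rV[R]_(mdim M)),
    @smooth_on R 'rV[R]_(mdim M0 + mdim M) R^o
      [set z | chart_rng (chart_at q0) (lsubmx z) /\
               chart_rng (chart_at q) (rsubmx z)]
      (fun z => let p := chart_inv (chart_at q) (rsubmx z) in
                g (chart_inv (chart_at q0) (lsubmx z)) p
                  (coord_field q v p) (coord_field q w p)).

Definition induced_metric (R : realType) (M : manifold R) (n : nat)
    (f : M -> 'rV[R]_n) : metric M :=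
  fun p X Y => dot (ediff f p X) (ediff f p Y).

Definition jac (R : realType) (M : manifold R) (n : nat)
    (f : M -> 'rV[R]_n) (p : M) : 'M[R]_(mdim M, n) := lin1_mx (ediff f p).

(* Its row space is the normal space at p.                                    *)
Definition normal_mx (R : realType) (M : manifold R) (n : nat)
    (f : M -> 'rV[R]_n) (p : M) : 'M[R]_n := kermx (jac f p)^T.

Definition normal_part (R : realType) (M : manifold R) (n : nat)
    (f : M -> 'rV[R]_n) (p : M) (v : 'rV[R]_n) : 'rV[R]_n :=
  v *m proj_mx (normal_mx f p) <<jac f p>>%MS.

(* The normal part of the derivative in the direction X of f_* Y, where Y is  *)
(* extended with constant coordinates in the chart around p.                  *)
Definition second_form (R : realType) (M : manifold R) (n : nat)
    (f : M -> 'rV[R]_n) (p : M) (X Y : 'rV[R]_(mdim M)) : 'rV[R]_n :=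
  normal_part f p
    ('D_X (fun x => 'D_Y (f \o chart_inv (chart_at p)) x)
       (chart_map (chart_at p) p)).

(* The matrix of A_xi in the coordinate basis, acting on row vectors on the   *)
(* right; see shape_operatorE.                                                *)
Definition shape_operator (R : realType) (M : manifold R) (n : nat)
    (f : M -> 'rV[R]_n) (p : M) (xi : 'rV[R]_n) : 'M[R]_(mdim M) :=
  (\matrix_(i, j) dot (second_form f p (delta_mx 0 i) (delta_mx 0 j)) xi) *m
  invmx (\matrix_(i, j) induced_metric f p (delta_mx 0 i) (delta_mx 0 j)).

Definition normal_derivative (R : realType) (M : manifold R) (n : nat)
    (f : M -> 'rV[R]_n) (xi : M -> 'rV[R]_n) (p : M) (X : 'rV[R]_(mdim M))
    : 'rV[R]_n := normal_part f p (ediff xi p X).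

(* The fibre of the subbundle E at x is the row space of E x.                 *)

Definition subbundle (R : realType) (L : manifold R) (n s : nat)
    (E : L -> 'M[R]_n) : Prop :=
  forall x0 : L, exists (U : set L) (F : L -> 'M[R]_(s, n)),
    [/\ open_nbhs x0 U, smooth_map_on U F &
        forall x, U x -> row_free (F x) /\ (F x == E x)%MS].

Definition section_on (R : realType) (L : manifold R) (n : nat)
    (E : L -> 'M[R]_n) (U : set L) (xi : L -> 'rV[R]_n) : Prop :=
  smooth_map_on U xi /\ forall x, U x -> (xi x <= E x)%MS.

Definition parallel_subbundle (R : realType) (L : manifold R) (n : nat)
    (h : L -> 'rV[R]_n) (E : L -> 'M[R]_n) : Prop :=
  forall U xi, open U -> section_on E U xi ->
  forall x X, U x -> (normal_derivative h xi x X <= E x)%MS.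

(* Vanishing of the curvature of the normal connection on sections of E; the  *)
(* coordinate fields v and w commute, so there is no bracket term.            *)
Definition flat_subbundle (R : realType) (L : manifold R) (n : nat)
    (h : L -> 'rV[R]_n) (E : L -> 'M[R]_n) : Prop :=
  forall U xi, open U -> section_on E U xi ->
  forall (q : L) (v w : 'rV[R]_(mdim L)) x,
    U x -> chart_dom (chart_at q) x ->
    let nabla u eta y := normal_derivative h eta y (coord_field q u y) in
    nabla v (nabla w xi) x = nabla w (nabla v xi) x.

Definition flat_parallel_subbundle (R : realType) (L : manifold R) (n s : nat)
    (h : L -> 'rV[R]_n) (E : L -> 'M[R]_n) : Prop :=
  [/\ subbundle s E, forall x, (E x <= normal_mx h x)%MS,
      parallel_subbundle h E & flat_subbundle h E].

(* [phi x] is the restriction to the fibre over x; the first clause is        *)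
(* smoothness of phi on the total space L x R^s.                              *)
Definition parallel_isometry (R : realType) (L : manifold R) (n s : nat)
    (h : L -> 'rV[R]_n) (E : L -> 'M[R]_n) (phi : L -> 'rV[R]_s -> 'rV[R]_n)
    : Prop :=
  [/\ forall q : L,
        @smooth_on R 'rV[R]_(mdim L + s) 'rV[R]_n
          [set z | chart_rng (chart_at q) (lsubmx z)]
          (fun z => phi (chart_inv (chart_at q) (lsubmx z)) (rsubmx z)),
      forall x, linear (phi x),
      forall x y z, dot (phi x y) (phi x z) = dot y z,
      forall x v, (v <= E x)%MS <-> exists y, phi x y = v &
      forall y x X, normal_derivative h (phi ^~ y) x X = 0].

Definition Omega (R : realType) (L : manifold R) (n s : nat)
    (h : L -> 'rV[R]_n) (phi : L -> 'rV[R]_s -> 'rV[R]_n) : set 'rV[R]_s :=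
  [set y | forall x, 1%:M - shape_operator h x (phi x y) \in unitmx].

(* The factor M_0 is M ord0, and the factors M_1, ..., M_r are tail M.        *)

Definition tail (R : realType) (r : nat) (M : 'I_r.+1 -> manifold R)
    : 'I_r -> manifold R := fun a => M (lift ord0 a).

Definition tail_pt (R : realType) (r : nat) (M : 'I_r.+1 -> manifold R)
    (p : prodM M) : prodM (tail M) := fun a => p (lift ord0 a).

Definition proj_diff (R : realType) (k : nat) (M : 'I_k -> manifold R)
    (i : 'I_k) (p : prodM M) (X : 'rV[R]_(mdim (prodM M)))
    : 'rV[R]_(mdim (M i)) := @mdiff R (prodM M) (M i) (fun q => q i) p X.

Definition product_net (R : realType) (k : nat) (M : 'I_k -> manifold R)
    (i : 'I_k) (p : prodM M) : set 'rV[R]_(mdim (prodM M)) :=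
  [set X | forall j, j != i -> proj_diff j p X = 0].

Definition adapted (R : realType) (k : nat) (M : 'I_k -> manifold R) (n : nat)
    (f : prodM M -> 'rV[R]_n) : Prop :=
  forall (p : prodM M) (i j : 'I_k) X Y, i != j ->
    product_net i p X -> product_net j p Y -> second_form f p X Y = 0.

Definition polar (R : realType) (r : nat) (M : 'I_r.+1 -> manifold R)
    (g : metric (prodM M)) : Prop :=
  exists (g0 : metric (M ord0)) (ga : forall a, M ord0 -> metric (tail M a)),
    [/\ riemannian_metric g0, forall a, smooth_metric_family (ga a) &
        forall (p : prodM M) X Y,
          g p X Y = g0 (p ord0) (proj_diff ord0 p X) (proj_diff ord0 p Y) +
            \sum_a ga a (p ord0) (tail_pt p a)
                (proj_diff (lift ord0 a) p X) (proj_diff (lift ord0 a) p Y)].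

Definition prod_immersion (R : realType) (r : nat) (M : 'I_r -> manifold R)
    (n : 'I_r -> nat) (f : forall a, M a -> 'rV[R]_(n a))
    : prodM M -> 'rV[R]_(\sum_a n a) := fun p => \mxrow_a f a (p a).

Definition partial_tube (R : realType) (r : nat) (M : 'I_r.+1 -> manifold R)
    (N s : nat) (f0 : M ord0 -> 'rV[R]_s) (h : prodM (tail M) -> 'rV[R]_N)
    (phi : prodM (tail M) -> 'rV[R]_s -> 'rV[R]_N) : prodM M -> 'rV[R]_N :=
  fun p => h (tail_pt p) + phi (tail_pt p) (f0 (p ord0)).

Lemma proj_diffE (R : realType) (k : nat) (M : 'I_k -> manifold R) (i : 'I_k)
  (p : prodM M) X : proj_diff i p X = submxrow X i.
Proof.
rewrite /proj_diff /mdiff /ediff.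
set c := chart_at (p i); set J := submxrow (1%:M : 'M[R]_(mdim (prodM M))) i.
have J1 : differentiable (mulmxr J : 'rV[R]_(mdim (prodM M)) -> 'rV[R]_(mdim (M i)))
    (chart_map (chart_at p) p).
  exact: (@mulmxr_differentiable R 1 _ _ J).
rewrite (@near_eq_derive R _ _ _ (mulmxr J)); last first.
  near=> x.
  have rx : chart_rng (chart_at p) x.
    near: x; apply: open_nbhs_nbhs; split; first exact: chart_rng_open.
    exact/chart_map_rng/chart_at_dom.
  by rewrite /= chart_invK; [rewrite /J mul_submxrow mulmx1|exact: rx].
rewrite deriveE // diff_lin; first by rewrite /= /J mul_submxrow mulmx1.
exact: mulmxr_continuous.
Unshelve. all: by end_near. Qed.

Section Euclidean.
Variables (R : realType) (M : manifold R) (n : nat) (f : M -> 'rV[R]_n) (p : M).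

Lemma dot_ge0 k (u : 'rV[R]_k) : 0 <= dot u u.
Proof. by rewrite /dot mxE sumr_ge0 // => i _; rewrite mxE -expr2 sqr_ge0. Qed.

Lemma dot_eq0 k (u : 'rV[R]_k) : dot u u = 0 -> u = 0.
Proof.
rewrite /dot mxE => /eqP; rewrite psumr_eq0 => [|i _]; last first.
  by rewrite mxE -expr2 sqr_ge0.
move=> /allP u0; apply/rowP => i; rewrite mxE; apply/eqP.
have := u0 i (mem_index_enum i); rewrite mxE -expr2 sqrf_eq0.
by rewrite implyTb.
Qed.

Lemma dotZl k a (u v : 'rV[R]_k) : dot (a *: u) v = a * dot u v.
Proof. by rewrite /dot -scalemxAl mxE. Qed.

Lemma dot_suml k m (u : 'I_m -> 'rV[R]_k) v :
  dot (\sum_i u i) v = \sum_i dot (u i) v.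
Proof. by rewrite /dot mulmx_suml summxE. Qed.

Lemma normal_cap_tangent : (normal_mx f p :&: <<jac f p>> = 0)%MS.
Proof.
apply/eqP; rewrite -submx0; apply/rV_subP => v; rewrite sub_capmx genmxE.
move=> /andP[/sub_kermxP vJ /submxP[w vE]]; rewrite submx0; apply/eqP.
by apply: dot_eq0; rewrite /dot {2}vE trmx_mul mulmxA vJ mul0mx mxE.
Qed.

Lemma normal_add_tangent : (1%:M <= normal_mx f p + <<jac f p>>)%MS.
Proof.
rewrite sub1mx /row_full; have := mxrank_sum_cap (normal_mx f p) <<jac f p>>%MS.
rewrite normal_cap_tangent mxrank0 addn0 => ->.
by rewrite mxrank_ker mxrank_tr genmxE subnK // rank_leq_col.
Qed.

Lemma normal_partP (v : 'rV[R]_n) :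
  (normal_part f p v <= normal_mx f p)%MS /\
  (v - normal_part f p v <= jac f p)%MS.
Proof.
split; first exact: proj_mx_sub.
suff : (v - normal_part f p v <= <<jac f p>>)%MS by rewrite genmxE.
apply: proj_mx_compl_sub.
exact: submx_trans (submx1 _) normal_add_tangent.
Qed.

Lemma ediffE X : smooth_map f -> ediff f p X = X *m jac f p.
Proof.
move=> /(_ p 1%N) [df _].
have {}df := df (chart_map (chart_at p) p).
have d : differentiable (f \o chart_inv (chart_at p)) (chart_map (chart_at p) p).
  by apply: df; split=> //; exact/chart_map_rng/chart_at_dom.
rewrite /jac /ediff (_ : (fun X => 'D_X _ _) = 'd (f \o chart_inv (chart_at p)) (chart_map (chart_at p) p)).
  by rewrite mul_rV_lin1 deriveE.
by apply/funext => Y; rewrite deriveE.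
Qed.

Let F := f \o chart_inv (chart_at p).
Let a := chart_map (chart_at p) p.

Lemma derive_row_sum (W : normedModType R) (G : 'rV[R]_(mdim M) -> W) x X :
  differentiable G x ->
  'D_X G x = \sum_i X 0 i *: 'D_(delta_mx 0 i) G x.
Proof.
move=> dG; rewrite deriveE // {1}[X]row_sum_delta linear_sum.
by apply: eq_bigr => i _; rewrite linearZ deriveE.
Qed.

Lemma second_formE X Y : smooth_map f ->
  second_form f p X Y = \sum_i \sum_j (X 0 i * Y 0 j) *:
    second_form f p (delta_mx 0 i) (delta_mx 0 j).
Proof.
move=> /(_ p 2%N) [dF dDF].
have dF' x : chart_rng (chart_at p) x -> differentiable F x.
  by move=> rx; apply: dF.
have aU : chart_rng (chart_at p) a by exact/chart_map_rng/chart_at_dom.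
have dD v : differentiable (fun x => 'D_v F x) a.
  by have [h _] := dDF v; apply: h.
rewrite /second_form -/F -/a.
have -> : 'D_X (fun x => 'D_Y F x) a = \sum_i \sum_j (X 0 i * Y 0 j) *:
    'D_(delta_mx 0 i) (fun x => 'D_(delta_mx 0 j) F x) a.
  rewrite derive_row_sum //; apply: eq_bigr => i _.
  rewrite (@near_eq_derive R _ _ _ (\sum_j (fun x => Y 0 j *: 'D_(delta_mx 0 j) F x))); last first.
    near=> x; rewrite fct_sumE; apply: derive_row_sum; apply: dF'.
    near: x; apply: open_nbhs_nbhs; split=> //; exact: chart_rng_open.
  rewrite derive_sum => [|j]; last first.
    by apply: diff_derivable; exact: differentiableZ.
  rewrite scaler_sumr; apply: eq_bigr => j _.
  by rewrite deriveZ ?scalerA //; exact: diff_derivable.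
rewrite /normal_part mulmx_suml; apply: eq_bigr => i _.
by rewrite mulmx_suml; apply: eq_bigr => j _; rewrite scalemxAl.
Unshelve. all: by end_near. Qed.

Lemma shape_operatorE xi X Y : immersion f ->
  induced_metric f p (X *m shape_operator f p xi) Y =
  dot (second_form f p X Y) xi.
Proof.
move=> [sf injf]; set J := jac f p.
pose B := \matrix_(i, j)
  dot (second_form f p (delta_mx 0 i) (delta_mx 0 j)) xi : 'M[R]_(mdim M).
have GE : \matrix_(i, j) induced_metric f p (delta_mx 0 i) (delta_mx 0 j) =
    J *m J^T.
  apply/matrixP => i j; rewrite mxE /induced_metric /dot !ediffE //.
  by rewrite -!rowE !mxE; apply: eq_bigr => l _; rewrite !mxE.
have Gu : J *m J^T \in unitmx.
  rewrite -row_free_unit -kermx_eq0 -submx0; apply/rV_subP => v.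
  move=> /sub_kermxP; rewrite mulmxA => vJ; rewrite submx0; apply/eqP.
  apply: (injf p); rewrite !ediffE // mul0mx; apply: dot_eq0.
  by rewrite /dot trmx_mul mulmxA vJ mul0mx mxE.
rewrite /induced_metric /shape_operator GE !ediffE // {1}/dot trmx_mul -/J -/B.
have -> : X *m (B *m invmx (J *m J^T)) *m J *m (J^T *m Y^T) = X *m B *m Y^T.
  by rewrite mulmxA -(mulmxA _ J) (mulmxA X) mulmxKV.
rewrite second_formE // dot_suml mxE.
under eq_bigr do rewrite !mxE mulr_suml.
rewrite exchange_big; apply: eq_bigr => i _ /=.
rewrite dot_suml; apply: eq_bigr => j _.
by rewrite dotZl !mxE mulrAC.
Qed.
End Euclidean.

(* Main.v *)
Require Import Defs.
From HB Require Import structures.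
From mathcomp Require Import all_boot all_order all_algebra.
From mathcomp Require Import all_classical all_reals all_analysis.
From mathcomp Require Import perm ring lra.
Import numFieldNormedType.Exports.

Set Implicit Arguments.
Unset Strict Implicit.
Unset Printing Implicit Defensive.

Import Order.TTheory GRing.Theory Num.Theory.
Local Open Scope classical_set_scope.
Local Open Scope ring_scope.

(** Both directions rest on first order computations with the partial
    differentials [d_i f] along the factors.

    Direct part: a parallel normal field [xi] of a product immersion [h] satisfies
    [d xi = - h_* A_xi]. As mixed partials of [h] vanish, the b-th partial of [xi] only
    has a component in the b-th Euclidean factor, so the a-th component of [f] depends
    only on [(p_0, p_a)]. Moreover [f_* X = phi (f_0* X_0) + h_* (I - A) X'] is an
    orthogonal splitting, which gives the polar metric; the mixed partial [d_0 d_a f]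
    is tangent to [h], hence to [f] because [I - A] is invertible.

    Converse: differentiating the relations that define a polar metric, adaptedness
    forces [d_j d_i f] to lie in the span of [d_i f] whenever [i <> j] and [i <> 0].
    Hence the orthogonal projection onto [f_* E_i] has zero derivative in the other
    directions and depends only on [p_i]; these spans are mutually orthogonal for
    [i >= 1] and split R^N, which makes [h = f (p_0, -)] a product of immersions.
    The fields [f (q, -) - f (p_0, -)] are normal to [h] and have tangent derivatives;
    so they are parallel, their scalar products are constant, and an orthonormal basis
    of their span at one point extends to a global parallel frame. *)

(** * Calculus of smooth functions *)

(** The map [ediff f p] reads tangent vectors in the chart attached to [p], so differentials at
    neighbouring points live in different coordinates. Charts of a product are products of charts:
    two points with the same i-th coordinate use the same i-th chart, so d_i f at such points can be
    compared, and differentiated along another factor, with no correction term. The index 0 is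
    excluded in the converse because g_a may vary with p_0: differentiating d_0 f along M_a can
    leave a component in f_* E_a. So nothing is split off along M_0, and f_0 carries its
    information. A global parallel frame usually calls for simple connectedness; here the
    displacement fields are global from the start, and E is only their span, not a whole complement
    in the normal bundle. A kernel vector of I - A at f_0(q) would be killed by the differential of
    f(q, -), which is how the immersion property puts f_0 into Omega. The splitting of R^N is an
    orthogonal matrix [T], which avoids identifying N with the sum of the n_a in the types. *)

Section Calculus.
Context {R : realType}.

Lemma mx_linear_continuous m n (W : normedModType R)
  (L : {linear 'M[R]_(m, n) -> W}) : continuous L.
Proof.
pose c i j (M : 'M[R]_(m, n)) : W := M i j *: L (delta_mx i j).
have -> : L = \sum_i \sum_j c i j :> ('M[R]_(m, n) -> W).
  apply/funext => M; rewrite fct_sumE {1}(matrix_sum_delta M) linear_sum.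
  apply: eq_bigr => i _; rewrite fct_sumE linear_sum.
  by apply: eq_bigr => j _; rewrite linearZ.
move=> M; apply: differentiable_continuous.
apply: differentiable_sum => i; apply: differentiable_sum => j.
by apply: differentiableZl; exact: differentiable_coord.
Qed.

Lemma mx_linear_differentiable m n (W : normedModType R)
  (L : {linear 'M[R]_(m, n) -> W}) M : differentiable L M.
Proof. exact/linear_differentiable/mx_linear_continuous. Qed.

Context {V : normedModType R}.

Lemma differentiable_lin m n (W : normedModType R)
    (L : {linear 'M[R]_(m, n) -> W}) (f : V -> 'M[R]_(m, n)) x :
  differentiable f x -> differentiable (fun y => L (f y)) x.
Proof.
move=> df; apply: (@differentiable_comp _ _ _ _ f L) => //.
exact: mx_linear_differentiable.
Qed.

Lemma derive_lin m n (W : normedModType R)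
    (L : {linear 'M[R]_(m, n) -> W}) (f : V -> 'M[R]_(m, n)) x v :
  differentiable f x -> 'D_v (fun y => L (f y)) x = L ('D_v f x).
Proof.
move=> df.
rewrite (deriveE _ df) (deriveE _ (differentiable_lin L df)).
rewrite (@diff_comp _ _ _ _ f L x df (mx_linear_differentiable L (f x))) /=.
by rewrite diff_lin //; exact: mx_linear_continuous.
Qed.

Lemma differentiable_mxP m n (f : V -> 'M[R]_(m, n)) x :
  differentiable f x <-> forall i j, differentiable (fun y => f y i j : R) x.
Proof.
split=> [df i j|df].
  apply: (@differentiable_comp _ _ _ _ f (fun M => M i j : R)) => //.
  exact: differentiable_coord.
have -> : f = \sum_i \sum_j (fun y => f y i j *: delta_mx i j).
  apply/funext => y; rewrite fct_sumE {1}[f y]matrix_sum_delta.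
  by apply: eq_bigr => i _; rewrite fct_sumE.
apply: differentiable_sum => i; apply: differentiable_sum => j.
exact/differentiableZl/df.
Qed.

Lemma derive_mxE m n (f : V -> 'M[R]_(m, n)) x v i j :
  differentiable f x -> 'D_v f x i j = 'D_v (fun y => f y i j : R) x.
Proof. by move=> df; rewrite derive_mx ?mxE //; exact: diff_derivable. Qed.

Lemma differentiable_mulmx m n p (a : V -> 'M[R]_(m, n)) (b : V -> 'M[R]_(n, p)) x :
  differentiable a x -> differentiable b x ->
  differentiable (fun y => a y *m b y) x.
Proof.
move=> /differentiable_mxP da /differentiable_mxP db.
apply/differentiable_mxP => i j.
have -> : (fun y => (a y *m b y) i j) = \sum_k ((fun y => a y i k : R) * (fun y =>
  b y k j)).
  by apply/funext => y; rewrite mxE fct_sumE.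
by apply: differentiable_sum => k; apply: differentiableM.
Qed.

Lemma derive_mulmx m n p (a : V -> 'M[R]_(m, n)) (b : V -> 'M[R]_(n, p)) x v :
  differentiable a x -> differentiable b x ->
  'D_v (fun y => a y *m b y) x = 'D_v a x *m b x + a x *m 'D_v b x.
Proof.
move=> da db; apply/matrixP => i j.
rewrite derive_mxE; last exact: differentiable_mulmx.
have -> : (fun y => (a y *m b y) i j : R) = \sum_k ((fun y => a y i k : R) * (fun y
  => b y k j)).
  by apply/funext => y; rewrite mxE fct_sumE.
have /differentiable_mxP da' := da; have /differentiable_mxP db' := db.
rewrite derive_sum; last by move=> k; apply: derivableM; exact: diff_derivable.
rewrite !mxE -big_split; apply: eq_bigr => k _ /=.
rewrite deriveM; [|exact: diff_derivable..].
by rewrite !derive_mxE // addrC; congr (_ + _); rewrite mulrC.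
Qed.

Lemma differentiable_trmx m n (a : V -> 'M[R]_(m, n)) x :
  differentiable a x -> differentiable (fun y => (a y)^T) x.
Proof. exact: (@differentiable_lin _ _ _ (@trmx R m n)). Qed.

Lemma derive_trmx m n (a : V -> 'M[R]_(m, n)) x v :
  differentiable a x -> 'D_v (fun y => (a y)^T) x = ('D_v a x)^T.
Proof. exact: (@derive_lin _ _ _ (@trmx R m n)). Qed.

Lemma derive_dot n (a b : V -> 'rV[R]_n) x v :
  differentiable a x -> differentiable b x ->
  'D_v (fun y => dot (a y) (b y)) x = dot ('D_v a x) (b x) + dot (a x) ('D_v b x).
Proof.
move=> da db; have dbT := differentiable_trmx db.
rewrite -(@derive_mxE _ _ (fun y => a y *m (b y)^T));
  last exact: differentiable_mulmx.
by rewrite derive_mulmx // mxE derive_trmx.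
Qed.

Lemma CkW k (W : normedModType R) (U : set V) (f : V -> W) :
  Ck k.+1 U f -> Ck k U f.
Proof.
elim: k f => [|k IH] f; first by move=> [df _] x /df /differentiable_continuous.
by move=> [df cf]; split=> // v; exact/IH/cf.
Qed.

Lemma Ck_lin k m n (W : normedModType R) (L : {linear 'M[R]_(m, n) -> W})
    (U : set V) (f : V -> 'M[R]_(m, n)) : open U ->
  Ck k U f -> Ck k U (fun x => L (f x)).
Proof.
move=> oU; elim: k f => [|k IH] f.
  move=> cf x Ux; apply: (@continuous_comp _ _ _ f L); first exact: cf.
  exact: mx_linear_continuous.
move=> [df cf]; split=> [x Ux|v]; first by apply: differentiable_lin; exact: df.
by apply: eq_Ck (IH _ (cf v)) => // x Ux; rewrite derive_lin //; exact: df.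
Qed.

Lemma Ck_cst k (W : normedModType R) (U : set V) (c : W) : Ck k U (cst c).
Proof.
case: k => [|k]; first by move=> x _; exact: cst_continuous.
split=> [x _|v]; first exact: differentiable_cst.
have -> : (fun x : V => 'D_v (cst c) x) = 0 by apply/funext => x; exact: derive_cst.
exact: Ck_cst0.
Qed.

(* One order is given up so that continuity at order 0 comes from
   differentiability. *)
Lemma Ck_mulmx k m n p (U : set V) (a : V -> 'M[R]_(m, n)) (b : V -> 'M[R]_(n, p)) :
  open U -> Ck k.+1 U a -> Ck k.+1 U b -> Ck k U (fun x => a x *m b x).
Proof.
move=> oU; elim: k a b => [|k IH] a b.
  move=> [da _] [db _] x Ux; apply: differentiable_continuous.
  by apply: differentiable_mulmx; [exact: da|exact: db].
move=> ca cb; have [da ca'] := ca; have [db cb'] := cb.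
split=> [x Ux|v].
  by apply: differentiable_mulmx; [exact: da|exact: db].
have cD := CkD oU (IH _ _ (ca' v) (CkW cb)) (IH _ _ (CkW ca) (cb' v)).
apply: eq_Ck cD => // x Ux; rewrite derive_mulmx //; [exact: da|exact: db].
Qed.

Section Smooth.
Variable (U : set V).
Hypothesis oU : open U.
Implicit Types W : normedModType R.

Lemma smooth_on_differentiable W (f : V -> W) x : smooth_on U f -> U x ->
  differentiable f x.
Proof. by move=> /(_ 1%N) [df _]; exact: df. Qed.

Lemma smooth_on_derive W (f : V -> W) v : smooth_on U f -> smooth_on U (fun x =>
  'D_v f x).
Proof. by move=> sf k; have [_] := sf k.+1; apply. Qed.

Lemma smooth_on_cst W (c : W) : smooth_on U (fun=> c).
Proof. by move=> k; exact: Ck_cst. Qed.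

Lemma smooth_onD W (f g : V -> W) :
  smooth_on U f -> smooth_on U g -> smooth_on U (fun x => f x + g x).
Proof. by move=> sf sg k; apply: CkD. Qed.

Lemma smooth_on_eq W (f g : V -> W) :
  (forall x, U x -> f x = g x) -> smooth_on U f -> smooth_on U g.
Proof. by move=> fg sf k; exact: (eq_Ck oU fg (sf k)). Qed.

Lemma smooth_on_lin m n W (L : {linear 'M[R]_(m, n) -> W}) (f : V -> 'M[R]_(m, n)) :
  smooth_on U f -> smooth_on U (fun x => L (f x)).
Proof. by move=> sf k; exact: Ck_lin. Qed.

Lemma smooth_on_mulmx m n p (a : V -> 'M[R]_(m, n)) (b : V -> 'M[R]_(n, p)) :
  smooth_on U a -> smooth_on U b -> smooth_on U (fun x => a x *m b x).
Proof. by move=> sa sb k; exact: Ck_mulmx. Qed.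

Lemma smooth_on_trmx m n (a : V -> 'M[R]_(m, n)) :
  smooth_on U a -> smooth_on U (fun x => (a x)^T).
Proof. exact: (@smooth_on_lin _ _ _ (@trmx R m n)). Qed.

Lemma smooth_on_coord m n (a : V -> 'M[R]_(m, n)) i j :
  smooth_on U a -> smooth_on U (fun x => a x i j : R^o).
Proof.
have @f : {linear 'M[R]_(m, n) -> R^o}.
  by exists (fun N : 'M[R]_(_, _) => N i j); do 2![eexists]; do ?[constructor];
     rewrite ?mxE// => ? *; rewrite ?mxE//; move=> ?; rewrite !mxE.
exact: (@smooth_on_lin _ _ _ f).
Qed.

Lemma smooth_on_dot n (a b : V -> 'rV[R]_n) :
  smooth_on U a -> smooth_on U b -> smooth_on U (fun x => dot (a x) (b x) : R^o).
Proof. by move=> sa sb; apply: smooth_on_coord; apply: smooth_on_mulmx => //;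
  exact: smooth_on_trmx. Qed.

Lemma smooth_on_sum W k (f : 'I_k -> V -> W) :
  (forall i, smooth_on U (f i)) -> smooth_on U (fun x => \sum_i f i x).
Proof.
move=> sf; have -> : (fun x => \sum_i f i x) = \sum_i f i by apply/funext => x;
  rewrite fct_sumE.
elim/big_ind: _ => [|g h|i _]; [|exact: smooth_onD|exact: sf].
exact: smooth_on_cst.
Qed.

End Smooth.

Lemma derive_affine m n (W : normedModType R) (f : 'rV[R]_n -> W) (A : 'M[R]_(m,
  n)) c x v :
  'D_v (fun y => f (c + y *m A)) x = 'D_(v *m A) f (c + x *m A).
Proof.
rewrite /derive.
have -> // : (fun h : R => h^-1 *: (((fun y => f (c + y *m A)) \o shift x) (h *: v) -
                 f (c + x *m A))) =
      (fun h => h^-1 *: ((f \o shift (c + x *m A)) (h *: (v *m A)) - f (c + x *m A))).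
by apply/funext => h; rewrite /= mulmxDl -scalemxAl addrCA.
Qed.

Lemma differentiable_affine m n (W : normedModType R) (f : 'rV[R]_n -> W) (A :
  'M[R]_(m, n)) c x :
  differentiable f (c + x *m A) -> differentiable (fun y => f (c + y *m A)) x.
Proof.
apply: (@differentiable_comp _ _ _ _ (fun y : 'rV_m => c + y *m A) f).
apply: differentiableD; first exact: differentiable_cst.
exact: mulmxr_differentiable.
Qed.

Lemma Ck_affine m n k (W : normedModType R) (U : set 'rV[R]_n) (f : 'rV[R]_n -> W)
    (A : 'M[R]_(m, n)) c :
  Ck k U f -> Ck k [set x | U (c + x *m A)] (fun y => f (c + y *m A)).
Proof.
elim: k f => [|k IH] f.
  move=> cf x Ux; have cA : {for x, continuous (fun y : 'rV[R]_m => c + y *m A)}.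
    by apply: continuousD; [exact: cst_continuous|exact: mulmxr_continuous].
  by apply: (@continuous_comp _ _ _ (fun y : 'rV[R]_m => c + y *m A) f x) => //;
    exact: cf.
move=> [df cf]; split=> [x Ux|v].
  by apply: differentiable_affine; exact: df.
have -> : (fun x => 'D_v (fun y => f (c + y *m A)) x) =
          (fun x => 'D_(v *m A) f (c + x *m A)) by apply/funext => x;
            exact: derive_affine.
exact: (IH _ (cf (v *m A))).
Qed.

Lemma smooth_on_affine m n (W : normedModType R) (U : set 'rV[R]_n) (f : 'rV[R]_n
  -> W)
    (A : 'M[R]_(m, n)) c :
  smooth_on U f -> smooth_on [set x | U (c + x *m A)] (fun y => f (c + y *m A)).
Proof. by move=> sf k; exact: Ck_affine. Qed.

Lemma smooth_on_sub (W : normedModType R) (U U' : set V) (f : V -> W) :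
  U `<=` U' -> smooth_on U' f -> smooth_on U f.
Proof. by move=> UU sf k; apply: Ck_sub UU _. Qed.

End Calculus.

(** * Mean value theorem and symmetry of second derivatives *)

Section MeanValue.
Context {R : realType} {V : normedModType R}.

Lemma is_derive_line (f : V -> R) x v t : differentiable f (x + t *: v) ->
  is_derive t 1 (fun s => f (x + s *: v)) ('D_v f (x + t *: v)).
Proof.
move=> df; have -> : 'D_v f (x + t *: v) = 'D_1 (fun s : R => f (x + s *: v)) t.
  rewrite /derive.
  have -> // : (fun h : R => h^-1 *: (((fun s : R => f (x + s *: v)) \o shift t) (h
    *: 1) -
                 f (x + t *: v))) =
      (fun h => h^-1 *: ((f \o shift (x + t *: v)) (h *: v) - f (x + t *: v))).
  by apply/funext => h; rewrite /= [h *: 1]mulr1 scalerDl addrCA.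
apply/derivableP/derivable1_diffP.
apply: (@differentiable_comp R R V R (fun s : R => x + s *: v) f t) => //.
Qed.

Lemma MVT_line (f : V -> R) x v h : 0 <= h ->
  (forall t, 0 <= t <= h -> differentiable f (x + t *: v)) ->
  exists2 t, 0 <= t <= h & f (x + h *: v) - f x = 'D_v f (x + t *: v) * h.
Proof.
move=> h0 df.
have [||t] := @MVT_segment R (fun s : R => f (x + s *: v)) (fun s => 'D_v f (x + s
  *: v)) 0 h h0.
- move=> t; rewrite in_itv /= => /andP[t0 th].
  by apply/is_derive_line/df; rewrite !ltW.
- apply: derivable_within_continuous => t; rewrite in_itv /= => th.
  by have /is_derive_line [] := df _ th.
rewrite in_itv /= scale0r addr0 subr0 => th e; by exists t.
Qed.

Lemma ball_line (x v : V) (r t : R) : 0 <= t -> t * `|v| < r -> ball x r (x + t *: v).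
Proof.
move=> t0 tr; rewrite -ball_normE /= opprD addNKr normrN normrZ ger0_norm //.
Qed.

Lemma derive0_ball_cst (f : V -> R) x r :
  (forall y, ball x r y -> differentiable f y) ->
  (forall y v, ball x r y -> 'D_v f y = 0) ->
  forall y, ball x r y -> f y = f x.
Proof.
move=> df f0 y xy.
have b t : 0 <= t <= 1 -> ball x r (x + t *: (y - x)).
  move=> /andP[t0 t1]; apply: ball_line => //.
  move: xy; rewrite -ball_normE /= distrC; apply: le_lt_trans.
  by rewrite ler_piMl.
have [t /b bt] := @MVT_line f x (y - x) 1 ler01 (fun t h => df _ (b t h)).
by rewrite scale1r [x + _]addrC subrK f0 // mul0r => /eqP; rewrite subr_eq0 => /eqP.
Qed.

(** The mean value theorem is applied along [u] to the difference of two opposite sides of the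
    parallelogram, then along [v] to ['D_u f]. Exchanging [u] and [v] preserves the second
    difference but reverses the order of the derivatives. *)
Lemma second_difference (f : V -> R) (U : set V) x u v h : 0 <= h ->
  (forall y, U y -> differentiable f y) ->
  (forall y, U y -> differentiable (fun z => 'D_u f z) y) ->
  (forall s t, 0 <= s <= h -> 0 <= t <= h -> U (x + s *: u + t *: v)) ->
  exists s t, [/\ 0 <= s <= h, 0 <= t <= h &
    f (x + h *: u + h *: v) - f (x + h *: u) - (f (x + h *: v) - f x) =
    'D_v (fun z => 'D_u f z) (x + s *: u + t *: v) * h * h].
Proof.
move=> h0 df ddf Ust.
have zh : 0 <= (0 : R) <= h by rewrite lexx h0.
have hh : 0 <= h <= h by rewrite lexx h0.
pose g1 s := f (x + h *: v + s *: u); pose g2 s := f (x + s *: u).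
have d1 s : 0 <= s <= h -> is_derive s 1 g1 ('D_u f (x + h *: v + s *: u)).
  by move=> sh; apply/is_derive_line/df; rewrite addrAC; exact: Ust.
have d2 s : 0 <= s <= h -> is_derive s 1 g2 ('D_u f (x + s *: u)).
  move=> sh; apply/is_derive_line/df; have := Ust s 0 sh zh.
  by rewrite scale0r addr0.
have [||s] := @MVT_segment R (g1 - g2) (fun s => 'D_u f (x + h *: v + s *: u) -
  'D_u f (x + s *: u)) 0 h h0.
- move=> s; rewrite in_itv /= => /andP[s0 sh].
  by apply: is_deriveB; [apply: d1|apply: d2]; rewrite !ltW.
- apply: derivable_within_continuous => s; rewrite in_itv /= => sh.
  by apply: derivableB; [have [] := d1 _ sh|have [] := d2 _ sh].
rewrite in_itv /= subr0 => sh; rewrite /g1 /g2 !fctE !scale0r !addr0 => e.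
have [t th e2] := @MVT_line (fun z => 'D_u f z) (x + s *: u) v h h0
  (fun t th => ddf _ (Ust _ _ sh th)).
exists s, t; split=> //; rewrite -e2 [x + s *: u + h *: v]addrAC -e.
by rewrite [x + h *: u + h *: v]addrAC; ring.
Qed.

Lemma ler_dist_half (a b c d e : R) :
  `|a - c| < e / 2 -> `|b - d| < e / 2 -> d = c -> `|a - b| <= e.
Proof.
move=> + + dc; rewrite dc !ltr_norml ler_norml => /andP[? ?] /andP[? ?].
by apply/andP; split; lra.
Qed.

(** Each iterated derivative, taken at some point of a small parallelogram, equals the same second
    difference divided by the square of the side parameter; continuity at [x] then brings the two
    values together. *)
Lemma schwarz (f : V -> R) (U : set V) x u v : open U -> U x ->
  Ck 2 U (f : V -> R^o) ->
  'D_u (fun z => 'D_v f z) x = 'D_v (fun z => 'D_u f z) x.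
Proof.
move=> oU Ux [df ddf].
have Dd w y : U y -> differentiable (fun z => 'D_w f z) y by move=> Uy;
  have [dw _] := ddf w; exact: dw.
have Dc w w' : {for x, continuous (fun z => 'D_w' (fun z => 'D_w f z) z)}.
  by have [_ /(_ w') cw] := ddf w; exact: cw.
apply/eqP; rewrite -subr_eq0 -normr_le0; apply/ler_addgt0Pl => e e0; rewrite addr0.
have e2 : 0 < e / 2 by rewrite divr_gt0.
have /cvgrPdist_lt /(_ _ e2) n1 := Dc v u.
have /cvgrPdist_lt /(_ _ e2) n2 := Dc u v.
have nU : nbhs x U by exact: open_nbhs_nbhs.
have [r /= r0 br] := (nbhs_ballP _ _).1 (filterI nU (filterI n1 n2)).
(* The parallelogram with sides h u and h v has to stay in the ball of radius [r]; the added 1 keeps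
   the denominator positive when [u] and [v] vanish. *)
pose h := r / (2 * (`|u| + `|v| + 1)).
have k0 : 0 < `|u| + `|v| + 1 by rewrite ltr_wpDl // addr_ge0.
have h0 : 0 < h by rewrite divr_gt0 // mulr_gt0.
have Ust s t : 0 <= s <= h -> 0 <= t <= h -> ball x r (x + s *: u + t *: v).
  move=> /andP[s0 sh] /andP[t0 th]; rewrite -ball_normE /= -addrA opprD addNKr normrN.
  apply: le_lt_trans (ler_normD _ _) _; rewrite !normrZ !ger0_norm //.
  have : h * (`|u| + `|v|) < r.
    by rewrite /h mulrAC ltr_pdivrMr ?mulr_gt0 // ltr_pM2l //; have := normr_ge0 u;
      have := normr_ge0 v; lra.
  by apply: le_lt_trans; rewrite mulrDr lerD // ler_wpM2r.
have br' y : ball x r y -> U y by move=> /br [].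
have [s [t [sh th e1]]] := @second_difference f _ x u v h (ltW h0)
  (fun y By => df _ (br' _ By)) (fun y By => Dd u _ (br' _ By)) Ust.
have [s' [t' [sh' th' e1']]] := @second_difference f _ x v u h (ltW h0)
  (fun y By => df _ (br' _ By)) (fun y By => Dd v _ (br' _ By))
  (fun s t hs ht => eq_rect _ (ball x r) (Ust t s ht hs) _ (addrAC _ _ _)).
have [_ [_ B]] := br _ (Ust _ _ sh th).
have [_ [A _]] := br _ (Ust _ _ th' sh').
apply: (ler_dist_half A B).
rewrite [x + t' *: u + s' *: v]addrAC.
apply: (mulIf (lt0r_neq0 h0)); apply: (mulIf (lt0r_neq0 h0)).
apply: etrans (esym e1) _; apply: etrans _ e1'.
rewrite [x + h *: u + h *: v]addrAC.
by rewrite !opprD !opprK addrACA.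
Qed.

Lemma schwarz_mx m n (f : V -> 'M[R]_(m, n)) (U : set V) x u v : open U -> U x ->
  smooth_on U f ->
  'D_u (fun z => 'D_v f z) x = 'D_v (fun z => 'D_u f z) x.
Proof.
move=> oU Ux sf; apply/matrixP => i j.
have dD w := smooth_on_differentiable (smooth_on_derive w sf) Ux.
have E w w' : 'D_w' (fun z => 'D_w f z) x i j = 'D_w' (fun z => 'D_w (fun z => f z
  i j : R) z) x.
  apply: etrans (derive_mxE w' i j (dD w)) _.
  apply: near_eq_derive; near=> z; apply: derive_mxE.
  apply: (smooth_on_differentiable sf); near: z; exact: open_nbhs_nbhs.
apply: etrans (E v u) _; apply: etrans _ (esym (E u v)).
exact: (schwarz _ _ oU Ux (smooth_on_coord oU i j sf 2%N)).
Unshelve. all: by end_near. Qed.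

Lemma derive0_ball_cst_mx m n (f : V -> 'M[R]_(m, n)) x r :
  (forall y, ball x r y -> differentiable f y) ->
  (forall y v, ball x r y -> 'D_v f y = 0) ->
  forall y, ball x r y -> f y = f x.
Proof.
move=> df f0 y xy; apply/matrixP => i j.
apply: (@derive0_ball_cst (fun z => f z i j) x r) => // [z xz|z v xz].
  by have /differentiable_mxP := df _ xz.
by rewrite -derive_mxE ?f0 ?mxE //; exact: df.
Qed.

End MeanValue.

(** * Differentials on manifolds *)

Section Manifolds.
Context {R : realType}.
Implicit Types L M : manifold R.

Definition mdifferentiable L (W : normedModType R) (f : L -> W) (p : L) : Prop :=
  differentiable (f \o chart_inv (chart_at p)) (chart_map (chart_at p) p).

Lemma chart_center_rng L (p : L) : chart_rng (chart_at p) (chart_map (chart_at p) p).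
Proof. exact/chart_map_rng/chart_at_dom. Qed.

Lemma chart_centerK L (p : L) : chart_inv (chart_at p) (chart_map (chart_at p) p) = p.
Proof. exact/chart_mapK/chart_at_dom. Qed.

Lemma nbhs_chart_center L (p : L) :
  nbhs (chart_map (chart_at p) p) (chart_rng (chart_at p)).
Proof.
by apply: open_nbhs_nbhs; split; [exact: chart_rng_open|exact: chart_center_rng].
Qed.

Lemma smooth_mapP L (W : normedModType R) (f : L -> W) :
  smooth_map f <->
  forall q, smooth_on (chart_rng (chart_at q)) (f \o chart_inv (chart_at q)).
Proof.
by split=> sf q; have := sf q; rewrite (_ : [set x | _ /\ setT _] = chart_rng
  (chart_at q)) //;
  apply/seteqP; split => x //= [].
Qed.

Lemma smooth_map_mdifferentiable L (W : normedModType R) (f : L -> W) p :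
  smooth_map f -> mdifferentiable f p.
Proof.
by move=> /smooth_mapP /(_ p) sf; apply: (smooth_on_differentiable sf);
  exact: chart_center_rng.
Qed.

Lemma smooth_map_on_mdifferentiable L (W : normedModType R) (U : set L) (f : L ->
  W) p :
  smooth_map_on U f -> U p -> mdifferentiable f p.
Proof.
move=> /(_ p) sf Up; apply: (smooth_on_differentiable sf).
by split; [exact: chart_center_rng|rewrite chart_centerK].
Qed.

(** The derivative on the left is taken in the fixed chart at [q], [ediff] in the chart of the
    moving point, and [coord_field] is the derivative of the transition map between them. This turns
    fixed-chart formulas into intrinsic ones. *)
Lemma chart_chain L (W : normedModType R) (f : L -> W) (q : L) x :
  chart_rng (chart_at q) x ->
  mdifferentiable f (chart_inv (chart_at q) x) ->
  differentiable (f \o chart_inv (chart_at q)) x /\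
  forall v, 'D_v (f \o chart_inv (chart_at q)) x =
    ediff f (chart_inv (chart_at q) x) (coord_field q v (chart_inv (chart_at q) x)).
Proof.
move=> qx; set p := chart_inv _ x => df.
pose tr := chart_map (chart_at p) \o chart_inv (chart_at q).
pose g := f \o chart_inv (chart_at p).
have Ox : chart_rng (chart_at q) x /\ chart_dom (chart_at p) (chart_inv (chart_at
  q) x).
  by split=> //; exact: chart_at_dom.
have dtr : differentiable tr x.
  exact: (smooth_on_differentiable (@chart_at_smooth R L p q)).
have nE : \forall y \near x, (g \o tr) y = (f \o chart_inv (chart_at q)) y.
  near=> y; have [qy py] : chart_rng (chart_at q) y /\ chart_dom (chart_at p)
    (chart_inv (chart_at q) y).
    near: y; apply: open_nbhs_nbhs; split=> //; exact: chart_overlap_open.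
  by rewrite /g /tr /= chart_mapK.
have dg : differentiable g (tr x) by exact: df.
have dgt : differentiable (g \o tr) x by apply: differentiable_comp.
have dfq : differentiable (f \o chart_inv (chart_at q)) x.
  exact: near_eq_differentiable nE dgt.
split=> // v; rewrite -(near_eq_derive v nE) (deriveE _ dgt) (diff_comp dtr dg) /=.
rewrite /ediff /coord_field chart_invK // (deriveE _ dg) (deriveE _ dtr) //.
Unshelve. all: by end_near. Qed.

Lemma ediff_linear L (W : normedModType R) (f : L -> W) p :
  mdifferentiable f p -> linear (ediff f p).
Proof. by move=> df a X Y; rewrite /ediff !deriveE // linearP. Qed.

Lemma ediff_argB L (W : normedModType R) (f : L -> W) p X Y :
  mdifferentiable f p -> ediff f p (X - Y) = ediff f p X - ediff f p Y.
Proof. by move=> df; rewrite /ediff !deriveE // linearB. Qed.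

Lemma ediff_jac L n (f : L -> 'rV[R]_n) p X :
  mdifferentiable f p -> ediff f p X = X *m jac f p.
Proof.
move=> df; rewrite /jac (_ : ediff f p = 'd (f \o chart_inv (chart_at p))
  (chart_map (chart_at p) p)).
  by rewrite mul_rV_lin1.
by apply/funext => Y; rewrite /ediff deriveE.
Qed.

Lemma ediff0 L (W : normedModType R) (f : L -> W) p : ediff f p 0 = 0.
Proof. exact: derive0. Qed.

Lemma ediff_local_cst L m n (f : L -> 'M[R]_(m, n)) :
  (forall p, mdifferentiable f p) -> (forall p X, ediff f p X = 0) ->
  forall p, \forall q \near p, f q = f p.
Proof.
move=> df f0 p.
have /nbhs_ballP [r /= r0 br] := nbhs_chart_center p.
have cb y : ball (chart_map (chart_at p) p) r y ->
    (f \o chart_inv (chart_at p)) y = f p.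
  move=> yb; rewrite -[in RHS](chart_centerK p).
  apply: (@derive0_ball_cst_mx _ _ _ _ (f \o chart_inv (chart_at p)) _ r) => // [z
    zb|z v zb].
    by have [] := chart_chain (br _ zb) (df _).
  by have [_ ->] := chart_chain (br _ zb) (df _); rewrite f0.
have nb : nbhs p (chart_dom (chart_at p)).
  by apply: open_nbhs_nbhs; split; [exact: chart_dom_open|exact: chart_at_dom].
have nc : \forall q \near p, ball (chart_map (chart_at p) p) r (chart_map (chart_at
  p) q).
  by apply: (chart_map_cont (chart_at_dom p)); exact: nbhsx_ballx.
near=> q.
have dq : chart_dom (chart_at p) q by near: q.
by rewrite -[in LHS](chart_mapK dq) -[LHS]/((f \o chart_inv (chart_at p)) _) cb //;
  near: q.
Unshelve. all: by end_near. Qed.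

Lemma ediff0_cst L m n (f : L -> 'M[R]_(m, n)) : connected [set: L] ->
  (forall p, mdifferentiable f p) -> (forall p X, ediff f p X = 0) ->
  forall p q, f p = f q.
Proof.
move=> cL df f0 p q; have loc := ediff_local_cst df f0.
suff e : [set x | f x = f p] = setT by have : [set: L] q by []; rewrite -e.
apply: cL; first by exists p.
- exists [set x | f x = f p]; last by rewrite setTI.
  by rewrite openE => x /= <-; exact: loc.
- exists [set x | f x = f p]; last by rewrite setTI.
  rewrite -openC openE => x /= fx; rewrite /interior /=.
  by apply: filterS (loc x) => y fy /=; rewrite fy.
Qed.

(* Slices, projections and tails of products are affine in the charts attached to
   corresponding points, with a linear part A that does not depend on the point:
   in these coordinates their differential is A everywhere. *)
Definition chart_affine L M (s : L -> M) (A : 'M[R]_(mdim L, mdim M)) : Prop :=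
  forall q, exists c, forall x, chart_rng (chart_at q) x ->
    chart_rng (chart_at (s q)) (c + x *m A) /\
    s (chart_inv (chart_at q) x) = chart_inv (chart_at (s q)) (c + x *m A).

Section ChartAffine.
Variables (L M : manifold R) (s : L -> M) (A : 'M[R]_(mdim L, mdim M)).
Hypothesis sA : chart_affine s A.
Variable W : normedModType R.
Implicit Type f : M -> W.

Lemma chart_affine_loc q : exists c,
  [/\ chart_map (chart_at (s q)) (s q) = c + chart_map (chart_at q) q *m A,
      chart_rng (chart_at q) `<=` [set x | chart_rng (chart_at (s q)) (c + x *m A)] &
      forall x, chart_rng (chart_at q) x ->
        s (chart_inv (chart_at q) x) = chart_inv (chart_at (s q)) (c + x *m A)].
Proof.
have [c cE] := sA q; exists c; split=> [|x /cE[]//|x /cE[]//].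
have [r] := cE _ (chart_center_rng q); rewrite chart_centerK => e.
by rewrite -[RHS](chart_invK r) -e.
Qed.

Lemma smooth_map_affine f : smooth_map f -> smooth_map (f \o s).
Proof.
move=> /smooth_mapP sf; apply/smooth_mapP => q.
have [c [_ cr cE]] := chart_affine_loc q.
have := smooth_on_sub cr (@smooth_on_affine R _ _ W _ _ A c (sf (s q))).
by apply: smooth_on_eq; [exact: chart_rng_open|move=> x qx; rewrite /= cE].
Qed.

Lemma mdifferentiable_affine f q : mdifferentiable f (s q) -> mdifferentiable (f \o
  s) q.
Proof.
have [c [ce cr cE]] := chart_affine_loc q; rewrite /mdifferentiable ce.
move=> /differentiable_affine; apply: near_eq_differentiable.
near=> x; rewrite /= cE //; near: x; exact: nbhs_chart_center.
Unshelve. all: by end_near. Qed.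

Lemma ediff_affine f q X : ediff (f \o s) q X = ediff f (s q) (X *m A).
Proof.
have [c [ce cr cE]] := chart_affine_loc q; rewrite /ediff ce -derive_affine.
apply: near_eq_derive.
near=> x; rewrite /= cE //; near: x; exact: nbhs_chart_center.
Unshelve. all: by end_near. Qed.

End ChartAffine.

Section EdiffAlgebra.
Variables (L : manifold R) (p : L).

Lemma mdifferentiable_cst (W : normedModType R) (c : W) : mdifferentiable (fun _ :
  L => c) p.
Proof. exact: differentiable_cst. Qed.

Lemma ediff_cst (W : normedModType R) (c : W) X : ediff (fun _ : L => c) p X = 0.
Proof. exact: derive_cst. Qed.

Lemma ediffD (W : normedModType R) (f g : L -> W) X :
  mdifferentiable f p -> mdifferentiable g p ->
  ediff (fun x => f x + g x) p X = ediff f p X + ediff g p X.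
Proof. by move=> df dg; apply: deriveD; exact: diff_derivable. Qed.

Lemma mdifferentiableB (W : normedModType R) (f g : L -> W) :
  mdifferentiable f p -> mdifferentiable g p -> mdifferentiable (fun x => f x - g
    x) p.
Proof. exact: differentiableB. Qed.

Lemma ediffB (W : normedModType R) (f g : L -> W) X :
  mdifferentiable f p -> mdifferentiable g p ->
  ediff (fun x => f x - g x) p X = ediff f p X - ediff g p X.
Proof. by move=> df dg; apply: deriveB; exact: diff_derivable. Qed.

Lemma mdifferentiable_mulmx m n k (f : L -> 'M[R]_(m, n)) (g : L -> 'M[R]_(n, k)) :
  mdifferentiable f p -> mdifferentiable g p -> mdifferentiable (fun x => f x *m g
    x) p.
Proof. exact: differentiable_mulmx. Qed.

Lemma ediff_mulmx m n k (f : L -> 'M[R]_(m, n)) (g : L -> 'M[R]_(n, k)) X :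
  mdifferentiable f p -> mdifferentiable g p ->
  ediff (fun x => f x *m g x) p X = ediff f p X *m g p + f p *m ediff g p X.
Proof.
move=> df dg; rewrite -{3 4}(chart_centerK p).
exact: (@derive_mulmx _ _ _ _ _ (f \o chart_inv (chart_at p)) (g \o chart_inv
  (chart_at p))).
Qed.

Lemma mdifferentiable_lin m n (W : normedModType R) (T : {linear 'M[R]_(m, n) ->
  W}) (f : L -> 'M[R]_(m, n)) :
  mdifferentiable f p -> mdifferentiable (fun x => T (f x)) p.
Proof. exact: differentiable_lin. Qed.

Lemma ediff_lin m n (W : normedModType R) (T : {linear 'M[R]_(m, n) -> W}) (f : L
  -> 'M[R]_(m, n)) X :
  mdifferentiable f p -> ediff (fun x => T (f x)) p X = T (ediff f p X).
Proof. exact: (@derive_lin _ _ _ _ _ T (f \o chart_inv (chart_at p))). Qed.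

Lemma ediff_dot n (f g : L -> 'rV[R]_n) X :
  mdifferentiable f p -> mdifferentiable g p ->
  ediff (fun x => dot (f x) (g x)) p X = dot (ediff f p X) (g p) + dot (f p) (ediff
    g p X).
Proof.
move=> df dg; rewrite -{3 4}(chart_centerK p).
exact: (@derive_dot _ _ _ (f \o chart_inv (chart_at p)) (g \o chart_inv (chart_at
  p))).
Qed.

End EdiffAlgebra.

End Manifolds.

(** * Product manifolds *)

Section Blocks.
Context {R : realType} {k : nat} (m : 'I_k -> nat).

(** Vectors are rows: right multiplication by [blk i] extracts the i-th block, and by its transpose
    inserts a vector there. In product charts these are the differential of the projection to a
    factor and the inclusion of its tangent space. *)
Definition blk (i : 'I_k) : 'M[R]_(\sum_j m j, m i) := submxrow 1%:M i.

Lemma mul_blk p (x : 'M[R]_(p, \sum_j m j)) i : x *m blk i = submxrow x i.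
Proof. by rewrite /blk -submxrow_mul. Qed.

Lemma blkTblk i : (blk i)^T *m blk i = 1%:M.
Proof.
rewrite mul_blk /blk tr_submxrow trmx1 -submxblockEv -(mxdiagZ 1).
by rewrite submxblock_diag.
Qed.

Lemma blkTblk0 i j : i != j -> (blk i)^T *m blk j = 0.
Proof.
move=> ij; rewrite mul_blk /blk tr_submxrow trmx1 -submxblockEv -(mxdiagZ 1).
by rewrite mxblockK /conform_mx (negPf ij).
Qed.

Lemma sum_blk p (x : 'M[R]_(p, \sum_j m j)) : x = \sum_i (x *m blk i) *m (blk i)^T.
Proof.
rewrite -[LHS]submxrowK Defs.mxrow_sum; apply: eq_bigr => i _.
by rewrite mul_blk.
Qed.

Lemma blkP p (x y : 'M[R]_(p, \sum_j m j)) : (forall i, x *m blk i = y *m blk i) ->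
  x = y.
Proof. by move=> e; apply/mxrowP => i; rewrite -!mul_blk. Qed.

Lemma mxrow_blk p (B : forall i, 'M[R]_(p, m i)) i : (\mxrow_i B i) *m blk i = B i.
Proof. by rewrite mul_blk mxrowK. Qed.

Lemma mulmx_blkT0 p i j (X : 'M[R]_(p, m i)) : i != j -> X *m (blk i)^T *m blk j = 0.
Proof. by move=> ij; rewrite -mulmxA blkTblk0 // mulmx0. Qed.

Lemma mulmx_blkTK p i (X : 'M[R]_(p, m i)) : X *m (blk i)^T *m blk i = X.
Proof. by rewrite -mulmxA blkTblk mulmx1. Qed.

Lemma dot_blk (x y : 'rV[R]_(\sum_j m j)) :
  dot x y = \sum_i dot (x *m blk i) (y *m blk i).
Proof.
rewrite {1}[x]sum_blk {1}/dot mulmx_suml summxE; apply: eq_bigr => i _.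
by rewrite /dot trmx_mul mulmxA.
Qed.

End Blocks.
Arguments blk {R k m} i.

Section ChartAffineExamples.
Context {R : realType}.
Implicit Types L M K : manifold R.

Lemma chart_affine_id L : chart_affine (id : L -> L) 1%:M.
Proof. by move=> q; exists 0 => x; rewrite add0r mulmx1. Qed.

Lemma chart_affine_cst L M (p : M) : chart_affine (fun _ : L => p) 0.
Proof.
move=> q; exists (chart_map (chart_at p) p) => x _.
by rewrite mulmx0 addr0 chart_centerK; split=> //; exact: chart_center_rng.
Qed.

Lemma prodM_rngP k (M : 'I_k -> manifold R) (p : prodM M) (x : 'rV[R]_(mdim (prodM
  M))) :
  chart_rng (chart_at p) x <-> forall i, chart_rng (chart_at (p i)) (x *m blk i).
Proof.
have -> : chart_rng (chart_at p) x =
    (forall i, chart_rng (chart_at (p i)) (submxrow x i)) by [].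
by split=> px i; have := px i; rewrite mul_blk.
Qed.

Lemma chart_affine_prod L k (M : 'I_k -> manifold R) (s : L -> prodM M)
    (A : forall i, 'M[R]_(mdim L, mdim (M i))) :
  (forall i, chart_affine (fun q => s q i) (A i)) -> chart_affine s (\mxrow_i A i).
Proof.
move=> sA q; have cE i := cid (sA i q).
exists (\mxrow_i sval (cE i)) => x qx.
have sub i : submxrow ((\mxrow_i sval (cE i) : 'rV[R]_(mdim (prodM M))) + x *m
  \mxrow_i A i) i =
    sval (cE i) + x *m A i.
  by rewrite submxrowD -mul_submxrow !mxrowK.
split.
  apply/prodM_rngP => i; rewrite mul_blk sub.
  by have [] := svalP (cE i) x qx.
apply: functional_extensionality_dep => i.
have [_ ->] := svalP (cE i) x qx.
by rewrite /= -sub.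
Qed.

Lemma chart_affine_proj k (M : 'I_k -> manifold R) i :
  chart_affine (fun p : prodM M => p i) (blk i).
Proof.
move=> q; exists 0 => x /prodM_rngP qx; rewrite add0r; split; first exact: qx.
by rewrite /= -mul_blk.
Qed.

Lemma chart_affine_dfwith k (M : 'I_k -> manifold R) (p : prodM M) i :
  chart_affine (dfwith p i : M i -> prodM M) (blk i)^T.
Proof.
rewrite -[(blk i)^T]submxrowK; apply: chart_affine_prod => j.
rewrite -mul_blk; case: (eqVneq i j) => [e|ij].
  subst j; rewrite (_ : (fun q => dfwith p i q i) = id); last first.
    by apply/funext => q; rewrite dfwithin.
  by rewrite blkTblk; exact: chart_affine_id.
rewrite (_ : (fun q => dfwith p i q j) = (fun=> p j)); last first.
  by apply/funext => q; rewrite dfwithout.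
by rewrite blkTblk0 //; exact: chart_affine_cst.
Qed.

Variables (r : nat) (M : 'I_r.+1 -> manifold R).

Definition tail_mx : 'M[R]_(mdim (prodM M), mdim (prodM (tail M))) :=
  \mxrow_a blk (lift ord0 a).

Lemma chart_affine_tail_pt : chart_affine (@tail_pt R r M) tail_mx.
Proof.
apply: chart_affine_prod => a.
exact: chart_affine_proj.
Qed.

(** The type of the value depends on the index, so each branch is transported along the equation
    delivered by [unliftP]; the casts disappear in [pcons0] and [pconsS]. *)
Definition pcons (q : M ord0) (x : prodM (tail M)) : prodM M := fun i =>
  match unliftP ord0 i with
  | UnliftSome j e => eq_rect_r M (x j) e
  | UnliftNone e => eq_rect_r M q e
  end.

Lemma pcons0 q x : pcons q x ord0 = q.
Proof.
rewrite /pcons; case: unliftP => [j e|e]; last by rewrite (eq_axiomK e).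
by exfalso; have := neq_lift ord0 j; rewrite -e eqxx.
Qed.

Lemma pconsS q x a : pcons q x (lift ord0 a) = x a.
Proof.
rewrite /pcons; case: unliftP => [j e|e]; last first.
  by exfalso; have := neq_lift ord0 a; rewrite e eqxx.
have ej := lift_inj e; subst j; by rewrite (eq_axiomK e).
Qed.

Lemma pcons_tail (p : prodM M) : pcons (p ord0) (tail_pt p) = p.
Proof.
apply: functional_extensionality_dep => i.
by case: (unliftP ord0 i) => [j ->|->]; rewrite ?pconsS ?pcons0.
Qed.

Lemma tail_mx_blk a : tail_mx *m blk a = blk (lift ord0 a).
Proof. exact: mxrow_blk. Qed.

Lemma blkT_tail_mx a : (blk (lift ord0 a))^T *m tail_mx = (blk a)^T.
Proof.
apply: blkP => b; rewrite -mulmxA tail_mx_blk.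
have [<-|ab] := eqVneq a b; first by rewrite !blkTblk.
by rewrite !blkTblk0 // (inj_eq lift_inj).
Qed.

Lemma blkT0_tail_mx : (blk ord0)^T *m tail_mx = 0.
Proof.
by apply: blkP => b; rewrite -mulmxA tail_mx_blk blkTblk0 ?neq_lift // mul0mx.
Qed.

Lemma tail_mxT_blk a : tail_mx^T *m blk (lift ord0 a) = blk a.
Proof. by apply: trmx_inj; rewrite trmx_mul trmxK blkT_tail_mx. Qed.

Lemma tail_mxT_blk0 : tail_mx^T *m blk ord0 = 0.
Proof. by apply: trmx_inj; rewrite trmx_mul trmxK blkT0_tail_mx trmx0. Qed.

Lemma tail_mxTK : tail_mx^T *m tail_mx = 1%:M.
Proof. by apply: blkP => a; rewrite -mulmxA tail_mx_blk tail_mxT_blk mul1mx. Qed.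

Lemma dfwith_pcons q q' x : dfwith (pcons q x) ord0 q' = pcons q' x.
Proof.
apply: functional_extensionality_dep => i.
case: (unliftP ord0 i) => [j ->|->]; last by rewrite dfwithin pcons0.
by rewrite dfwithout ?neq_lift // !pconsS.
Qed.

Lemma chart_affine_pcons q : chart_affine (pcons q) tail_mx^T.
Proof.
rewrite -[tail_mx^T]submxrowK; apply: chart_affine_prod => i.
have tE : blk i = (blk i)^T^T :> 'M[R]_(mdim (prodM M), mdim (M i)) by rewrite trmxK.
rewrite -mul_blk [in X in chart_affine _ X]tE -trmx_mul.
case: (unliftP ord0 i) => [j ->|->].
  rewrite blkT_tail_mx trmxK (_ : (fun x => _) = (fun x : prodM (tail M) => x j)).
    exact: chart_affine_proj.
  by apply/funext => x; rewrite pconsS.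
rewrite blkT0_tail_mx trmx0 (_ : (fun x => _) = (fun=> q)).
  exact: chart_affine_cst.
by apply/funext => x; rewrite pcons0.
Qed.

End ChartAffineExamples.

Section SmoothMaps.
Context {R : realType} (L : manifold R).

Lemma smooth_map_cst (W : normedModType R) (c : W) : smooth_map (fun _ : L => c).
Proof. by apply/smooth_mapP => q; exact: smooth_on_cst. Qed.

Lemma smooth_mapD (W : normedModType R) (f g : L -> W) :
  smooth_map f -> smooth_map g -> smooth_map (fun x => f x + g x).
Proof.
move=> /smooth_mapP sf /smooth_mapP sg; apply/smooth_mapP => q.
by apply: smooth_onD; [exact: chart_rng_open|exact: sf|exact: sg].
Qed.

Lemma smooth_map_mulmx m n k (f : L -> 'M[R]_(m, n)) (g : L -> 'M[R]_(n, k)) :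
  smooth_map f -> smooth_map g -> smooth_map (fun x => f x *m g x).
Proof.
move=> /smooth_mapP sf /smooth_mapP sg; apply/smooth_mapP => q.
by apply: smooth_on_mulmx; [exact: chart_rng_open|exact: sf|exact: sg].
Qed.

Lemma smooth_map_lin m n (W : normedModType R) (T : {linear 'M[R]_(m, n) -> W})
  (f : L -> 'M[R]_(m, n)) : smooth_map f -> smooth_map (fun x => T (f x)).
Proof.
move=> /smooth_mapP sf; apply/smooth_mapP => q.
by apply: smooth_on_lin; [exact: chart_rng_open|exact: sf].
Qed.

Lemma smooth_mapB m n (f g : L -> 'M[R]_(m, n)) :
  smooth_map f -> smooth_map g -> smooth_map (fun x => f x - g x).
Proof.
move=> sf sg; apply: smooth_mapD => //.
exact: (@smooth_map_lin _ _ _ (@GRing.opp 'M[R]_(m, n))).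
Qed.

Lemma smooth_map_sum k (W : normedModType R) (f : 'I_k -> L -> W) :
  (forall i, smooth_map (f i)) -> smooth_map (fun x => \sum_i f i x).
Proof.
move=> sf; apply/smooth_mapP => q.
apply: (@smooth_on_sum _ _ _ _ _ _ (fun i => f i \o chart_inv (chart_at q))).
  exact: chart_rng_open.
by move=> i; have /smooth_mapP := sf i; exact.
Qed.

Lemma smooth_map_rows m n (F : L -> 'M[R]_(m, n)) :
  (forall i, smooth_map (fun x => row i (F x))) -> smooth_map F.
Proof.
move=> sF; have -> : F = (fun x => \sum_i delta_mx i 0 *m row i (F x)).
  apply/funext => x; apply/row_matrixP => j;
    rewrite linear_sum (bigD1 j) //= [X in _ + X]big1 ?addr0.
    rewrite row_mul [row j (delta_mx _ _)]rowE mul_delta_mx -rowE.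
    by apply/rowP => l; rewrite !mxE.
  by move=> i ij; rewrite row_mul rowE mul_delta_mx_0 1?eq_sym // mul0mx.
apply: smooth_map_sum => i.
exact: (@smooth_map_lin _ _ _ (mulmx (delta_mx i 0))).
Qed.

End SmoothMaps.

Section CoordField.
Context {R : realType}.

Lemma coord_field_center (L : manifold R) (p : L) v : coord_field p v p = v.
Proof.
rewrite /coord_field (@near_eq_derive R _ _ _ id) ?derive_id //.
near=> x; rewrite /= chart_invK //; near: x; exact: nbhs_chart_center.
Unshelve. all: by end_near. Qed.

Lemma coord_field0 (L : manifold R) (p q : L) : coord_field p 0 q = 0.
Proof. exact: derive0. Qed.

Variables (k : nat) (M : 'I_k -> manifold R).

(** The transition map between two product charts acts block by block, hence so does its
    derivative. *)
Lemma coord_field_blk (p q : prodM M) v j : chart_dom (chart_at p) q ->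
  coord_field p v q *m blk j = coord_field (p j) (v *m blk j) (q j).
Proof.
move=> pq.
pose tr := chart_map (chart_at q) \o chart_inv (chart_at p).
have Ox : chart_rng (chart_at p) (chart_map (chart_at p) q) /\
    chart_dom (chart_at q) (chart_inv (chart_at p) (chart_map (chart_at p) q)).
  by split; [exact: chart_map_rng|rewrite chart_mapK //; exact: chart_at_dom].
have dtr : differentiable tr (chart_map (chart_at p) q).
  exact: (smooth_on_differentiable (@chart_at_smooth R _ q p)).
rewrite /coord_field -/tr -[LHS](derive_lin (mulmxr (blk j)) _ dtr) /=.
pose g := chart_map (chart_at (q j)) \o chart_inv (chart_at (p j)).
have -> : (fun y => tr y *m blk j) = (fun y => g (0 + y *m blk j)).
  by apply/funext => y; rewrite add0r /tr /= mxrow_blk /g /= mul_blk.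
by rewrite derive_affine add0r mxrow_blk.
Qed.

Lemma coord_field_incl (p q : prodM M) i (X : 'rV[R]_(mdim (M i))) : chart_dom
  (chart_at p) q ->
  coord_field p (X *m (blk i)^T) q = coord_field (p i) X (q i) *m (blk i)^T.
Proof.
move=> pq; apply: blkP => j; rewrite coord_field_blk //.
have [<-|ij] := eqVneq i j; first by rewrite !mulmx_blkTK.
by rewrite !mulmx_blkT0 // coord_field0.
Qed.

Lemma dfwith_id (p : prodM M) i : dfwith p i (p i) = p.
Proof.
apply: functional_extensionality_dep => j.
by have [<-|ij] := eqVneq i j; rewrite ?dfwithin // dfwithout.
Qed.

Lemma dfwith_twice (p : prodM M) i (x y : M i) : dfwith (dfwith p i x) i y = dfwith
  p i y.
Proof.
apply: functional_extensionality_dep => l.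
by have [<-|il] := eqVneq i l; rewrite ?dfwithin // !dfwithout.
Qed.

Lemma ediff_dfwith (W : normedModType R) (f : prodM M -> W) (p : prodM M) i (q : M
  i) X :
  ediff (f \o dfwith p i) q X = ediff f (dfwith p i q) (X *m (blk i)^T).
Proof. exact/ediff_affine/chart_affine_dfwith. Qed.

Lemma ediff_sum_blk (W : normedModType R) (f : prodM M -> W) p X :
  mdifferentiable f p -> ediff f p X = \sum_i ediff f p (X *m blk i *m (blk i)^T).
Proof.
move=> df; rewrite {1}[X]sum_blk.
by rewrite /ediff !deriveE // linear_sum; apply: eq_bigr => i _; rewrite deriveE.
Qed.

(* The tangent vectors live in the chart attached to each point; the charts at x and at
   p agree on the i-th factor since both have the same i-th coordinate. *)
Lemma derive_fixed_factor (W : normedModType R) (f : prodM M -> W) (p : prodM M) i x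
    (X : 'rV[R]_(mdim (M i))) : smooth_map f -> chart_rng (chart_at p) x ->
  chart_inv (chart_at p) x i = p i ->
  'D_(X *m (blk i)^T) (f \o chart_inv (chart_at p)) x =
  ediff f (chart_inv (chart_at p) x) (X *m (blk i)^T).
Proof.
move=> sf px e; have [_ ->] := chart_chain px (smooth_map_mdifferentiable _ sf).
rewrite coord_field_incl; last exact/chart_inv_dom.
have -> // : coord_field (p i) X (chart_inv (chart_at p) x i) = X.
by rewrite e coord_field_center.
Qed.

(** The second derivative is taken in the single chart at [p], as in [second_form], while [Psi] uses
    another chart at each point. Since [i != j], all these charts share their i-th block, so the two
    agree without a transition term. *)
Lemma mixed_partial (W : normedModType R) (f : prodM M -> W) (p : prodM M) i j
    (X : 'rV[R]_(mdim (M i))) (Y : 'rV[R]_(mdim (M j))) : smooth_map f -> i != j ->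
  let Psi (q : M j) := ediff f (dfwith p j q) (X *m (blk i)^T) in
  mdifferentiable Psi (p j) /\
  ediff Psi (p j) Y =
    'D_(Y *m (blk j)^T) (fun x => 'D_(X *m (blk i)^T) (f \o chart_inv (chart_at p)) x)
      (chart_map (chart_at p) p).
Proof.
move=> sf ij Psi.
have [c [ce cr cE]] := chart_affine_loc (@chart_affine_dfwith _ _ _ p j) (p j).
move: ce cr cE; rewrite dfwith_id => ce cr cE.
pose D x := 'D_(X *m (blk i)^T) (f \o chart_inv (chart_at p)) x.
have PE : \forall y \near chart_map (chart_at (p j)) (p j),
    D (c + y *m (blk j)^T) = (Psi \o chart_inv (chart_at (p j))) y.
  near=> y.
  have ry : chart_rng (chart_at (p j)) y by near: y; exact: nbhs_chart_center.
  have aux (w : M j) (z : prodM M) : dfwith p j w = z -> z i = p i.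
    by move=> <-; rewrite dfwithout 1?eq_sym.
  rewrite /D (derive_fixed_factor X sf (cr _ ry) (aux _ _ (cE _ ry))).
  by rewrite [RHS]/(Psi (chart_inv _ y)) /Psi (cE _ ry).
have dD : differentiable D (c + chart_map (chart_at (p j)) (p j) *m (blk j)^T).
  rewrite -ce; have /smooth_mapP /(_ p) sfp := sf.
  by apply: (smooth_on_differentiable (smooth_on_derive _ sfp));
    exact: chart_center_rng.
split; first by apply: near_eq_differentiable PE _; exact: differentiable_affine.
by rewrite /ediff -(near_eq_derive _ PE) derive_affine -ce.
Unshelve. all: by end_near. Qed.

(* Coordinates are changed one at a time, from p to p'. *)
Lemma dfwith_invariant (T : Type) (g : prodM M -> T) (S : pred 'I_k) :
  (forall (p : prodM M) j (q : M j), ~~ S j -> g (dfwith p j q) = g p) ->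
  forall p p' : prodM M, (forall j, S j -> p j = p' j) -> g p = g p'.
Proof.
move=> gS p p' pp'.
pose z (t : nat) : prodM M := fun j => if (j < t)%N then p' j else p j.
have zE t : (t <= k)%N -> g (z t) = g p.
  elim: t => [|t IH] tk.
    by congr g; apply: functional_extensionality_dep => j; rewrite /z ltn0.
  rewrite -(IH (ltnW tk)); pose i := Ordinal tk.
  have -> : z t.+1 = dfwith (z t) i (p' i).
    apply: functional_extensionality_dep => j.
    have [<-|ij] := eqVneq i j; first by rewrite dfwithin /z /= ltnSn.
    rewrite dfwithout // /z ltnS leq_eqVlt.
    by case: eqVneq => [e|//]; case/eqP: ij; apply/val_inj.
  have [Si|nSi] := boolP (S i); last exact: gS.
  by rewrite -(pp' _ Si) (_ : p i = z t i) ?dfwith_id // /z /= ltnn.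
rewrite -(zE k (leqnn k)); congr g; apply: functional_extensionality_dep => j.
by rewrite /z ltn_ord.
Qed.

(** Moving one coordinate outside [S] traces a copy of a connected factor on which [g] has zero
    differential. Coordinates are changed one at a time, so connectedness of the factors
    suffices. *)
Lemma partial0_invariant m n (g : prodM M -> 'M[R]_(m, n)) (S : pred 'I_k) :
  (forall i, connected [set: M i]) -> (forall p, mdifferentiable g p) ->
  (forall p j (Y : 'rV[R]_(mdim (M j))), ~~ S j -> ediff g p (Y *m (blk j)^T) = 0) ->
  forall p p' : prodM M, (forall j, S j -> p j = p' j) -> g p = g p'.
Proof.
move=> cM dg g0; apply: dfwith_invariant => p j q nSj.
rewrite -[in RHS](dfwith_id p j).
apply: (@ediff0_cst _ _ _ _ (g \o dfwith p j)) => // [x|x Y].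
  exact: (mdifferentiable_affine (@chart_affine_dfwith _ _ _ p j) (dg _)).
by rewrite ediff_dfwith g0.
Qed.

Lemma connected_factor i : connected_manifold (prodM M) -> connected [set: M i].
Proof.
move=> [[p _] cM].
have -> : [set: M i] = (fun q : prodM M => q i) @` [set: prodM M].
  by apply/seteqP; split => x // _; exists (dfwith p i x) => //; rewrite dfwithin.
apply: connected_continuous_connected => //.
by apply: continuous_subspaceT; exact: prod_continuous_proj.
Qed.

Lemma product_netE i (p : prodM M) X : product_net i p X -> X = X *m blk i *m (blk
  i)^T.
Proof.
move=> pX; apply: blkP => j.
have [<-|ij] := eqVneq i j; first by rewrite mulmx_blkTK.
by rewrite mulmx_blkT0 // mul_blk -(@proj_diffE R k M j p) pX 1?eq_sym.
Qed.

Lemma product_net_incl i (p : prodM M) X : product_net i p (X *m (blk i)^T).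
Proof.
by move=> j ji; rewrite proj_diffE -mul_blk mulmx_blkT0 1?eq_sym.
Qed.

End CoordField.

(** * Normal bundle and induced metric *)

Section Dot.
Context {R : realType} {n : nat}.
Implicit Types u v w : 'rV[R]_n.

Lemma dotC u v : dot u v = dot v u.
Proof. by rewrite /dot -[u *m v^T]trmxK trmx_mul trmxK mxE. Qed.

Lemma dotDl u v w : dot (u + v) w = dot u w + dot v w.
Proof. by rewrite /dot mulmxDl mxE. Qed.

Lemma dotDr u v w : dot w (u + v) = dot w u + dot w v.
Proof. by rewrite dotC dotDl !(dotC _ w). Qed.

Lemma dotNl u v : dot (- u) v = - dot u v.
Proof. by rewrite /dot mulNmx mxE. Qed.

Lemma dotBl u v w : dot (u - v) w = dot u w - dot v w.
Proof. by rewrite dotDl dotNl. Qed.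

Lemma dot0l v : dot 0 v = 0.
Proof. by rewrite /dot mul0mx mxE. Qed.

Lemma dot0r v : dot v 0 = 0.
Proof. by rewrite dotC dot0l. Qed.

End Dot.

Lemma dot_orthogonalD {R : realType} n (u u' v v' : 'rV[R]_n) :
  dot u v' = 0 -> dot u' v = 0 -> dot (u + v) (u' + v') = dot u u' + dot v v'.
Proof. by move=> uv u'v; rewrite dotDl !dotDr uv (dotC v) u'v addr0 add0r. Qed.

Lemma dot_mulr {R : realType} n p (u : 'rV[R]_p) (v : 'rV[R]_n) (A : 'M[R]_(n, p)) :
  dot u (v *m A) = dot (u *m A^T) v.
Proof. by rewrite /dot trmx_mul mulmxA. Qed.

Lemma dot_mx_eq0 {R : realType} n p (u : 'rV[R]_n) (A : 'M[R]_(p, n)) :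
  (forall v, dot u (v *m A) = 0) -> u *m A^T = 0.
Proof. by move=> uA; apply: dot_eq0; rewrite -dot_mulr. Qed.

Section NormalBundle.
Context {R : realType} (L : manifold R) (n : nat) (h : L -> 'rV[R]_n).
Hypothesis sh : smooth_map h.
Implicit Types (x : L) (v : 'rV[R]_n).

Lemma tangent_mxP x v : (v <= jac h x)%MS <-> exists X, v = ediff h x X.
Proof.
have dh := smooth_map_mdifferentiable x sh; split=> [/submxP[X ->]|[X ->]].
  by exists X; rewrite ediff_jac.
by rewrite ediff_jac // submxMl.
Qed.

Lemma normal_mxP x v : (v <= normal_mx h x)%MS <-> forall X, dot v (ediff h x X) = 0.
Proof.
have dh := smooth_map_mdifferentiable x sh; split=> [/sub_kermxP e X|e].
  by rewrite ediff_jac // dot_mulr e dot0l.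
by apply/sub_kermxP/dot_mx_eq0 => X; rewrite -ediff_jac.
Qed.

Lemma normal_part_tangent x v : (v <= jac h x)%MS -> normal_part h x v = 0.
Proof.
by move=> vJ; apply: proj_mx_0; [exact: normal_cap_tangent|rewrite genmxE].
Qed.

Lemma normal_part_normal x v : (v <= normal_mx h x)%MS -> normal_part h x v = v.
Proof. by apply: proj_mx_id; exact: normal_cap_tangent. Qed.

Lemma normal_part_eq0 x v : normal_part h x v = 0 -> (v <= jac h x)%MS.
Proof. by have [_] := normal_partP h x v; move=> + e; rewrite e subr0. Qed.

Lemma dot_normal_part x xi v : (xi <= normal_mx h x)%MS ->
  dot xi (normal_part h x v) = dot xi v.
Proof.
move=> /normal_mxP xiN; have [_ /tangent_mxP [X e]] := normal_partP h x v.
rewrite -[in RHS](subrK (normal_part h x v) v) dotDr e xiN add0r //.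
Qed.

(** Derivative of the relation between [xi] and h_* Y, with [Y] extended by constant coordinates in
    the chart at [x]. The second derivative of [h] keeps its tangential part, to which the normal
    vector [xi x] is blind. *)
Lemma normal_field_derive (xi : L -> 'rV[R]_n) x X Y :
  mdifferentiable xi x -> (\forall y \near x, (xi y <= normal_mx h y)%MS) ->
  dot (ediff xi x X) (ediff h x Y) +
  dot (xi x) ('D_X (fun z => 'D_Y (h \o chart_inv (chart_at x)) z)
       (chart_map (chart_at x) x)) = 0.
Proof.
move=> dxi Nxi; set c := chart_map _ _.
have /smooth_mapP /(_ x) shx := sh.
have dD : differentiable (fun z => 'D_Y (h \o chart_inv (chart_at x)) z) c.
  by apply: (smooth_on_differentiable (smooth_on_derive _ shx));
    exact: chart_center_rng.
rewrite -[in dot (xi x)](chart_centerK x) -/c.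
rewrite -[LHS](@derive_dot _ _ _ (xi \o chart_inv (chart_at x))) //.
rewrite -(derive_cst (0 : R) c X); apply: near_eq_derive.
have ci : {for c, continuous (chart_inv (chart_at x))}.
  by apply: chart_inv_cont; exact: chart_center_rng.
have Nc : \forall z \near c, (xi (chart_inv (chart_at x) z) <= normal_mx h
  (chart_inv (chart_at x) z))%MS.
  have Nxi' : \forall y \near chart_inv (chart_at x) c, (xi y <= normal_mx h y)%MS.
    by rewrite /c chart_centerK.
  exact: (ci _ Nxi').
near=> z.
have rz : chart_rng (chart_at x) z by near: z; exact: nbhs_chart_center.
have [_ ->] := chart_chain rz (smooth_map_mdifferentiable _ sh).
have /normal_mxP /= -> // : (xi (chart_inv (chart_at x) z) <= normal_mx h
  (chart_inv (chart_at x) z))%MS.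
by near: z.
Unshelve. all: by end_near. Qed.

(** Parallelism makes the difference of the two sides tangent; by [normal_field_derive] and
    [shape_operatorE] it is orthogonal to every tangent vector, hence to itself. *)
Lemma weingarten (xi : L -> 'rV[R]_n) x X : immersion h ->
  mdifferentiable xi x -> (forall y, (xi y <= normal_mx h y)%MS) ->
  normal_derivative h xi x X = 0 ->
  ediff xi x X = - ediff h x (X *m shape_operator h x (xi x)).
Proof.
move=> ih dxi Nxi par.
have dh := smooth_map_mdifferentiable x sh.
have /tangent_mxP [V VE] : (ediff xi x X <= jac h x)%MS by exact: normal_part_eq0.
apply/eqP; rewrite -addr_eq0 VE; apply/eqP.
suff dot0 Y : dot (ediff h x V + ediff h x (X *m shape_operator h x (xi x))) (ediff
  h x Y) = 0.
  by apply: dot_eq0; rewrite dotDr !dot0 addr0.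
rewrite dotDl -VE [dot (ediff h x (_ *m _)) _](shape_operatorE x (xi x) X Y ih).
rewrite [X in _ + X]dotC dot_normal_part //.
by apply: normal_field_derive => //; near=> y.
Unshelve. all: by end_near. Qed.

End NormalBundle.

Section InducedMetric.
Context {R : realType} (L : manifold R) (n : nat) (f : L -> 'rV[R]_n).

Lemma immersion_eq0 p X : immersion f -> ediff f p X = 0 -> X = 0.
Proof. by move=> [_ injf] e; apply: (injf p); rewrite e ediff0. Qed.

Lemma injective_ediff p : mdifferentiable f p ->
  (forall X, ediff f p X = 0 -> X = 0) -> injective (ediff f p).
Proof.
move=> df f0 X Y e; apply/eqP; rewrite -subr_eq0; apply/eqP/f0.
rewrite -[X - Y]addrC -scaleN1r ediff_linear // scaleN1r e addNr //.
Qed.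

Lemma induced_metric_riemannian : immersion f -> riemannian_metric (induced_metric f).
Proof.
move=> imf; have [sf injf] := imf; split=> [p|q v w].
  have df := smooth_map_mdifferentiable p sf; split=> [X a Y Z|X Y|X X0].
  - by rewrite /induced_metric ediff_linear // dotDr [dot _ (_ *: _)]dotC dotZl dotC.
  - exact: dotC.
  rewrite lt_neqAle dot_ge0 andbT eq_sym;
    apply/eqP => /dot_eq0 /(immersion_eq0 imf) e.
  by rewrite e eqxx in X0.
have /smooth_mapP /(_ q) sfq := sf.
have := smooth_on_dot (@chart_rng_open _ _ _ _) (smooth_on_derive v sfq)
  (smooth_on_derive w sfq).
apply: smooth_on_eq; first exact: chart_rng_open.
move=> x rx; rewrite /induced_metric.
by have [_ E] := chart_chain rx (smooth_map_mdifferentiable _ sf); rewrite !E.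
Qed.

End InducedMetric.

(** * Orthogonal projections onto moving row spaces *)

Section RowProjection.
Context {R : realType}.

(* Orthogonal projection onto the row space of W, when W is row free. *)
Definition row_proj m n (W : 'M[R]_(m, n)) : 'M[R]_n := W^T *m invmx (W *m W^T) *m W.

Lemma gram_unit m n (W : 'M[R]_(m, n)) : row_free W -> W *m W^T \in unitmx.
Proof.
move=> fW; rewrite -row_free_unit -kermx_eq0 -submx0; apply/rV_subP => v.
move=> /sub_kermxP; rewrite mulmxA => vJ; rewrite submx0; apply/eqP.
apply: (row_free_inj fW); rewrite mul0mx; apply: dot_eq0.
by rewrite /dot trmx_mul mulmxA vJ mul0mx mxE.
Qed.

Section Fixed.
Variables (m n : nat) (W : 'M[R]_(m, n)).
Hypothesis fW : row_free W.

Lemma mul_row_proj : W *m row_proj W = W.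
Proof. by rewrite /row_proj !mulmxA mulmxV ?mul1mx //; exact: gram_unit. Qed.

Lemma row_projP p (v : 'M[R]_(p, n)) : (v <= W)%MS <-> v *m row_proj W = v.
Proof.
split=> [/submxP[D ->]|<-]; first by rewrite -mulmxA mul_row_proj.
by rewrite /row_proj mulmxA submxMl.
Qed.

End Fixed.

Lemma differentiable_det (V : normedModType R) n (A : V -> 'M[R]_n) x :
  differentiable A x -> differentiable (fun y => \det (A y) : R) x.
Proof.
move=> /differentiable_mxP dA.
have -> : (fun y => \det (A y) : R) = \sum_(s : 'S_n)
    (fun y => (-1) ^+ s * \prod_i A y i (s i)).
  by apply/funext => y; rewrite fct_sumE.
elim/big_ind: _ => [|f g|s _]; [exact: differentiable_cst|exact: differentiableD|].
apply: differentiableM; first exact: differentiable_cst.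
have -> : (fun y => \prod_i A y i (s i)) = \prod_i (fun y => A y i (s i)).
  by apply/funext => y; rewrite fct_prodE.
elim/big_ind: _ => [|f g|i _]; [exact: differentiable_cst|exact:
  differentiableM|exact: dA].
Qed.

(** Cramer's rule. Invertibility is assumed at every point because [invmx] returns a singular matrix
    unchanged, where the formula by cofactors would fail. *)
Lemma differentiable_invmx (V : normedModType R) n (A : V -> 'M[R]_n) x :
  (forall y, A y \in unitmx) ->
  differentiable A x -> differentiable (fun y => invmx (A y)) x.
Proof.
move=> uA dA; apply/differentiable_mxP => i j.
have -> : (fun y => invmx (A y) i j) = (fun y => (\det (A y))^-1) * (fun y =>
  cofactor (A y) j i).
  by apply/funext => y; rewrite /invmx uA !mxE.
apply: differentiableM.
  apply: differentiableV; first exact: differentiable_det.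
  by have := uA x; rewrite unitmxE unitfE.
apply: differentiableM; first exact: differentiable_cst.
apply: differentiable_det; apply/differentiable_mxP => a b.
have -> : (fun y => row' j (col' i (A y)) a b) = (fun y => A y (lift j a) (lift i b)).
  by apply/funext => y; rewrite !mxE.
by have /differentiable_mxP := dA; exact.
Qed.

(** Here [G] is the Gram matrix of a frame W with W' = C W, so that G' = C G + G C^T, and the last
    hypothesis is the derivative of K G = 1. *)
Lemma derive_inverse n (G K C dK : 'M[R]_n) : K *m G = 1%:M -> G *m K = 1%:M ->
  dK *m G + K *m (C *m G + G *m C^T) = 0 -> dK = - (K *m C) - C^T *m K.
Proof.
move=> KG GK; rewrite mulmxDr !mulmxA KG mul1mx => /eqP; rewrite addr_eq0 => /eqP e.
have -> : dK = dK *m G *m K by rewrite -mulmxA GK mulmx1.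
by rewrite e opprD mulmxDl !mulNmx -(mulmxA (K *m C)) GK mulmx1.
Qed.

(** The condition on [ediff W p X] says that the row space is stationary to first order, although
    the frame may turn inside it. The terms of the product rule cancel against the derivative of the
    inverse Gram matrix. *)
Lemma row_proj_derivative (L : manifold R) m n (W : L -> 'M[R]_(m, n)) p X C :
  (forall q, row_free (W q)) -> mdifferentiable W p -> ediff W p X = C *m W p ->
  mdifferentiable (fun q => row_proj (W q)) p /\ ediff (fun q => row_proj (W q)) p
    X = 0.
Proof.
move=> fW dW eW.
have dWT : mdifferentiable (fun q => (W q)^T) p := mdifferentiable_lin (@trmx R m
  n) dW.
have eWT : ediff (fun q => (W q)^T) p X = (C *m W p)^T.
  by rewrite (ediff_lin (@trmx R m n)) // eW.
pose G q := W q *m (W q)^T.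
have dG : mdifferentiable G p by exact: mdifferentiable_mulmx.
have uG q : G q \in unitmx by exact: gram_unit.
have dK : mdifferentiable (fun q => invmx (G q)) p.
  by apply: differentiable_invmx => // y; exact: uG.
set K := invmx (G p).
have GK : G p *m K = 1%:M by exact: mulmxV.
have eK : ediff (fun q => invmx (G q)) p X = - (K *m C) - C^T *m K.
  have : ediff (fun q => invmx (G q) *m G q) p X = 0.
    rewrite (_ : (fun q => _) = fun=> 1%:M) ?ediff_cst //.
    by apply/funext => q; rewrite mulVmx.
  rewrite ediff_mulmx // -/K {2}/G ediff_mulmx // eW eWT trmx_mul -!mulmxA (mulmxA
    (W p)).
  exact: (@derive_inverse _ (G p) K C _ (mulVmx (uG p)) GK).
split; first by apply: mdifferentiable_mulmx => //; exact: mdifferentiable_mulmx.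
rewrite ediff_mulmx //; last exact: mdifferentiable_mulmx.
rewrite ediff_mulmx // eK eW eWT -/(G p) -/K trmx_mul.
rewrite mulmxBr mulmxN !mulmxDl !mulNmx !mulmxA.
by rewrite addrCA subrr addr0 addNr.
Qed.

End RowProjection.

(** * Orthogonal decompositions *)

Section LinearAlgebra.
Context {R : realType} {N : nat}.

(** The rows are taken from [S] itself, by maximality of the rank. When [S] consists of values of
    fields at a point, each row therefore extends to a field. *)
Lemma spanning_matrix (S : set 'rV[R]_N) : exists k (B : 'M[R]_(k, N)),
  (forall i, S (row i B)) /\ (forall v, S v -> (v <= B)%MS).
Proof.
pose P d := `[< exists k (B : 'M[R]_(k, N)), (forall i, S (row i B)) /\ \rank B = d
  >].
have P0 : exists d, P d.
  exists 0%N; apply/asboolP; exists 0%N, 0; split; [by case|exact: mxrank0].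
have PN d : P d -> (d <= N)%N.
  by move=> /asboolP[k [B [_ <-]]]; exact: rank_leq_col.
case: (ex_maxnP P0 PN) => d /asboolP[k [B [SB rB]]] dmax.
exists k, B; split=> // v Sv.
have : P (\rank (col_mx B v)).
  apply/asboolP; exists (k + 1)%N, (col_mx B v); split=> // i.
  case: (split_ordP i) => j ->; first by rewrite rowKu.
  by rewrite rowKd ord1 (_ : row 0 v = v) //; apply/rowP => l; rewrite !mxE.
move=> /dmax; rewrite -rB => rle.
have BC : (B <= col_mx B v)%MS by rewrite -addsmxE addsmxSl.
have := (mxrank_leqif_sup BC).2; rewrite eqn_leq rle mxrankS // => /esym vB.
by apply: submx_trans vB; rewrite -addsmxE addsmxSr.
Qed.

(** Gram-Schmidt by induction on the number of rows: the first row is made orthogonal to an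
    orthonormal basis of the others, then normalised. *)
Lemma orthonormal_basis d (B : 'M[R]_(d, N)) : row_free B ->
  exists Q : 'M[R]_(d, N), Q *m Q^T = 1%:M /\ (Q <= B)%MS.
Proof.
elim: d B => [|d IH] B fB.
  by exists B; split=> //; apply/matrixP => -[].
move: B fB; rewrite -[d.+1]/(1 + d)%N => B; rewrite -[B]vsubmxK.
set b := usubmx B; set B' := dsubmx B => fB.
have fB' : row_free B'.
  rewrite -kermx_eq0 -submx0; apply/rV_subP => v /sub_kermxP vB; rewrite submx0.
  have : row_mx 0 v *m col_mx b B' = 0 by rewrite mul_row_col mul0mx vB addr0.
  rewrite -(mul0mx _ (col_mx b B')) => /(row_free_inj fB) /(congr1 rsubmx).
  by rewrite row_mxKr linear0 => ->.
have [Q [QQ QB]] := IH B' fB'.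
pose u := b - b *m Q^T *m Q.
have uO : u *m Q^T = 0 by rewrite mulmxBl -!mulmxA QQ mulmx1 subrr.
have u0 : u != 0.
  apply/eqP => u0; have bB : (b <= B')%MS.
    by rewrite -(subrK (b *m Q^T *m Q) b) -/u u0 add0r; apply: submx_trans QB;
      exact: submxMl.
  have [D bD] := submxP bB.
  have : row_mx 1%:M (- D) *m col_mx b B' = 0.
    by rewrite mul_row_col mul1mx mulNmx -bD subrr.
  rewrite -(mul0mx _ (col_mx b B')) => /(row_free_inj fB) /(congr1 lsubmx).
  rewrite row_mxKl linear0 => /matrixP /(_ 0 0) /eqP.
  by rewrite !mxE oner_eq0.
have uu : 0 < dot u u.
  by rewrite lt_neqAle dot_ge0 andbT eq_sym; apply/eqP => /dot_eq0 e;
    rewrite e eqxx in u0.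
pose l := (Num.sqrt (dot u u))^-1.
exists (col_mx (l *: u) Q); split.
  have Qu : Q *m u^T = 0 by rewrite -[LHS]trmxK trmx_mul trmxK uO trmx0.
  have lu : (l *: u)^T = l *: u^T by apply/matrixP => i j; rewrite !mxE.
  rewrite tr_col_mx lu mul_col_row -!scalemxAl -!scalemxAr.
  rewrite QQ uO Qu !scaler0.
  rewrite scalerA [u *m u^T]mx11_scalar -/(dot u u) scale_scalar_mx.
  have -> : l * l * dot u u = 1.
    by rewrite /l -invfM -expr2 sqr_sqrtr ?mulVf ?gt_eqF // ltW.
  by rewrite -scalar_mx_block.
rewrite -!addsmxE addsmx_sub; apply/andP; split.
  apply: scalemx_sub; apply: addmx_sub; first exact: addsmxSl.
  rewrite eqmx_opp; apply: submx_trans (addsmxSr b B').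
  by apply: submx_trans QB; exact: submxMl.
by apply: submx_trans QB (addsmxSr b B').
Qed.

Lemma orthonormal_row_base k (B : 'M[R]_(k, N)) :
  exists Q : 'M[R]_(\rank B, N), Q *m Q^T = 1%:M /\ (Q :=: B)%MS.
Proof.
have [Q [QQ QB]] := orthonormal_basis (row_base_free B).
exists Q; split=> //; have QB' : (Q <= B)%MS by rewrite -(eq_row_base B).
apply/eqmxP; have <- := (mxrank_leqif_eq QB').2.
have fO : row_free Q by apply/row_freeP; exists Q^T.
by rewrite (eqP fO).
Qed.

(** [T] stacks orthonormal bases of pairwise orthogonal subspaces that fill the space and contain
    the given sets. The two identities force the block sizes to add up to [N]; the last clause says
    that vectors of [S a] live in block [a] only. *)
Lemma orthogonal_decomposition r (r_gt0 : (0 < r)%N) (S : 'I_r -> set 'rV[R]_N) :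
  (forall a b u v, a != b -> S a u -> S b v -> dot u v = 0) ->
  exists (n : 'I_r -> nat) (Q : forall a, 'M[R]_(n a, N)),
    let T := \mxcol_a Q a in
    [/\ T *m T^T = 1%:M, T^T *m T = 1%:M &
        forall a b v, a != b -> S a v -> v *m (Q b)^T = 0].
Proof.
move=> oS; pose a0 := Ordinal r_gt0.
have B a : {B : 'M[R]_N | (forall v, S a v -> (v <= B)%MS) /\
    (forall w, (forall v, S a v -> dot w v = 0) -> w *m B^T = 0)}.
  apply: cid; have [k [B [SB BS]]] := spanning_matrix (S a).
  exists <<B>>%MS; split=> [v /BS|w wS]; first by rewrite genmxE.
  have /submxP[D ->] : (<<B>> <= B)%MS by rewrite genmxE.
  rewrite trmx_mul mulmxA (_ : w *m B^T = 0) ?mul0mx //.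
  apply/rowP => i; rewrite mxE [RHS]mxE -[RHS](wS _ (SB i)) /dot mxE.
  by apply: eq_bigr => l _; rewrite !mxE.
(* The first block receives the complement of all the other spans, so that the blocks
   fill the whole space. *)
pose K := kermx (\sum_(b | b != a0) sval (B b))%MS^T.
pose D a := if a == a0 then K else sval (B a).
have KB b : b != a0 -> K *m (sval (B b))^T = 0.
  move=> b0; have /submxP[E ->] : (sval (B b) <= \sum_(b | b != a0) sval (B b))%MS.
    exact: (sumsmx_sup b).
  by rewrite trmx_mul mulmxA mulmx_ker mul0mx.
have BB a b : a != b -> sval (B a) *m (sval (B b))^T = 0.
  move=> ab; apply/row_matrixP => i; rewrite row_mul row0.
  apply: (svalP (B b)).2 => v Sv.
  have : v *m (sval (B a))^T = 0.
    by apply: (svalP (B a)).2 => w Sw; apply: (oS b a) => //; rewrite eq_sym.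
  move=> /rowP /(_ i); rewrite [RHS]mxE; apply: etrans.
  by rewrite dotC /dot !mxE; apply: eq_bigr => l _; rewrite !mxE.
have DD a b : a != b -> D a *m (D b)^T = 0.
  move=> ab.
  rewrite /D; have [ea|na] := eqVneq a a0; have [eb|nb] := eqVneq b a0.
  - by rewrite ea eb eqxx in ab.
  - exact: KB.
  - by rewrite -[LHS]trmxK trmx_mul trmxK KB ?trmx0.
  - exact: BB.
have SD a v : S a v -> (v <= D a)%MS.
  move=> Sv; rewrite /D; case: eqVneq => [e|_]; last exact: (svalP (B a)).1.
  subst a; apply/sub_kermxP; rewrite -[LHS]trmxK trmx_mul trmxK; apply/eqP.
  rewrite trmx_eq0 -submx0.
  have : (\sum_(b | b != a0) sval (B b) <= kermx v^T)%MS.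
    apply/sumsmx_subP => b b0; apply/sub_kermxP; rewrite -[LHS]trmxK trmx_mul trmxK.
    apply/eqP; rewrite trmx_eq0; apply/eqP/(svalP (B b)).2 => w Sw.
    by apply: (oS a0 b) => //; rewrite eq_sym.
  by move=> /sub_kermxP ->; rewrite submx0.
have Q a := cid (orthonormal_row_base (D a)).
exists (fun a => \rank (D a)), (fun a => sval (Q a)) => T.
have OD a : (sval (Q a) :=: D a)%MS := (svalP (Q a)).2.
have DO0 a b : a != b -> D a *m (sval (Q b))^T = 0.
  move=> ab; have /submxP[E ->] : (sval (Q b) <= D b)%MS by rewrite OD.
  by rewrite trmx_mul mulmxA DD // mul0mx.
have TT : T *m T^T = 1%:M.
  rewrite /T tr_mxcol mul_mxcol_mxrow -(mxdiagZ 1); apply/eq_mxblock => a b.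
  case: eqVneq => [e|ab]; last first.
    have /submxP[E ->] : (sval (Q a) <= D a)%MS by rewrite OD.
    by rewrite -mulmxA DO0 // mulmx0.
  by subst b; rewrite (svalP (Q a)).1 conform_mx_id.
(* A vector orthogonal to every [D a] is in particular orthogonal to the spans other than the one at
   [a0], so it lies in [K], which is [D a0]; being orthogonal to [K] as well, it vanishes. *)
have fT : row_free T^T.
  rewrite -kermx_eq0 -submx0; apply/rV_subP => v /sub_kermxP; rewrite submx0 => vT.
  have vO a : v *m (sval (Q a))^T = 0.
    have := congr1 (fun w => submxrow w a) vT.
    by rewrite -mul_submxrow /T tr_mxcol mxrowK submxrow0.
  have vD a : v *m (D a)^T = 0.
    have /submxP[E ->] : (D a <= sval (Q a))%MS by rewrite OD.
    by rewrite trmx_mul mulmxA vO mul0mx.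
  have vK : (v <= K)%MS.
    apply/sub_kermxP; rewrite -[LHS]trmxK trmx_mul trmxK; apply/eqP;
      rewrite trmx_eq0; apply/eqP.
    apply/sub_kermxP/sumsmx_subP => b b0; apply/sub_kermxP.
    rewrite -[LHS]trmxK trmx_mul trmxK; apply/eqP; rewrite trmx_eq0; apply/eqP.
    by have := vD b; rewrite /D (negPf b0).
  have := vD a0; rewrite /D eqxx => vK0.
  have /submxP[E vE] := vK.
  apply/eqP/dot_eq0; by rewrite /dot {2}vE trmx_mul mulmxA vK0 mul0mx mxE.
split=> //.
  by apply: (row_free_inj fT); rewrite -mulmxA TT mulmx1 mul1mx.
move=> a b v ab /SD /submxP[E ->].
by rewrite -mulmxA DO0 // mulmx0.
Qed.

End LinearAlgebra.

(** * Products of immersions and parallel frames *)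

Section ProductImmersion.
Context {R : realType} (r : nat) (M : 'I_r -> manifold R) (n : 'I_r -> nat).
Variable fa : forall a, M a -> 'rV[R]_(n a).
Let h := prod_immersion fa.

Lemma prod_immersion_blk x a : h x *m blk a = fa (x a).
Proof. exact: mxrow_blk. Qed.

Lemma smooth_prod_immersion : (forall a, smooth_map (@fa a)) -> smooth_map h.
Proof.
move=> sfa.
have -> : h = (fun x => \sum_a fa (x a) *m (blk a)^T).
  by apply/funext => x; rewrite /h /prod_immersion Defs.mxrow_sum.
apply: smooth_map_sum => a.
apply: (@smooth_map_lin _ _ _ _ _ (mulmxr (blk a)^T)).
exact: (smooth_map_affine (@chart_affine_proj _ _ M a) (sfa a)).
Qed.

Hypothesis sfa : forall a, smooth_map (@fa a).

Lemma ediff_prod_immersion x X a :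
  ediff h x X *m blk a = ediff (@fa a) (x a) (X *m blk a).
Proof.
have dh := smooth_map_mdifferentiable x (smooth_prod_immersion sfa).
rewrite -[LHS](ediff_lin (mulmxr (blk a)) X dh).
rewrite -(ediff_affine (@chart_affine_proj _ _ M a)).
have -> // : (fun y => mulmxr (blk a) (h y)) = @fa a \o (fun y => y a).
by apply/funext => y; exact: prod_immersion_blk.
Qed.

(** The partial differential of [h] along M_a depends on the a-th coordinate alone, so it is
    constant along M_b. *)
Lemma prod_immersion_mixed x a b (Y : 'rV[R]_(mdim (M b))) (Z : 'rV[R]_(mdim (M a))) :
  a != b ->
  'D_(Y *m (blk b)^T) (fun z => 'D_(Z *m (blk a)^T) (h \o chart_inv (chart_at x)) z)
    (chart_map (chart_at x) x) = 0.
Proof.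
move=> ab; have sh := smooth_prod_immersion sfa.
have [_ <-] := mixed_partial x Z Y sh ab.
rewrite (_ : (fun q => _) = fun=> ediff (@fa a) (x a) Z *m (blk a)^T) ?ediff_cst //.
apply/funext => q; apply: blkP => c; rewrite ediff_prod_immersion.
have [<-|ac] := eqVneq a c; first by rewrite !mulmx_blkTK dfwithout 1?eq_sym.
by rewrite !mulmx_blkT0 // ediff0.
Qed.

Lemma immersion_prod : (forall a, immersion (@fa a)) -> immersion h.
Proof.
move=> ifa; have sh := smooth_prod_immersion sfa; split; first exact: sh.
move=> x.
apply: injective_ediff; first exact: smooth_map_mdifferentiable.
move=> X e; apply: blkP => a; rewrite mul0mx.
by apply: (@immersion_eq0 _ _ _ _ (x a) _ (ifa a));
  rewrite -ediff_prod_immersion e mul0mx.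
Qed.

End ProductImmersion.

Section ParallelFrame.
Context {R : realType} (L : manifold R) (n s : nat) (h : L -> 'rV[R]_n).
Variables (E : L -> 'M[R]_n) (phi : L -> 'rV[R]_s -> 'rV[R]_n).
Hypothesis Hphi : parallel_isometry h E phi.
Let Phi x : 'M[R]_(s, n) := lin1_mx (phi x).

Lemma isometry_frameE x y : phi x y = y *m Phi x.
Proof.
have [_ lphi _ _ _] := Hphi.
pose g : {linear 'rV[R]_s -> 'rV[R]_n} :=
  HB.pack (phi x) (GRing.isLinear.Build _ _ _ _ (phi x) (lphi x)).
by rewrite /Phi -[phi x]/(g : _ -> _) mul_rV_lin1.
Qed.

Lemma smooth_isometry_section y : smooth_map (phi ^~ y).
Proof.
have [sphi _ _ _ _] := Hphi; apply/smooth_mapP => q.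
have := smooth_on_affine (row_mx 1%:M 0) (row_mx 0 y) (sphi q).
have E1 x : row_mx 0 y + x *m row_mx 1%:M 0 = row_mx x y :> 'rV[R]_(mdim L + s).
  by rewrite mul_mx_row mulmx1 mulmx0 add_row_mx add0r addr0.
rewrite [X in smooth_on X](_ : _ = chart_rng (chart_at q)); last first.
  by apply/seteqP; split => x /=; rewrite E1 row_mxKl.
apply: smooth_on_eq; first exact: chart_rng_open.
by move=> x _; rewrite E1 row_mxKl row_mxKr.
Qed.

Lemma smooth_isometry_frame : smooth_map Phi.
Proof.
apply: smooth_map_rows => i.
rewrite (_ : (fun x => _) = phi ^~ (delta_mx 0 i));
  first exact: smooth_isometry_section.
by apply/funext => x; rewrite isometry_frameE rowE.
Qed.

Lemma isometry_frame_orthonormal x : Phi x *m (Phi x)^T = 1%:M.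
Proof.
have [_ _ iphi _ _] := Hphi; apply/matrixP => i j.
have dij : dot (delta_mx 0 i : 'rV[R]_s) (delta_mx 0 j) = (i == j)%:R.
  by rewrite /dot trmx_delta mul_delta_mx_cond; case: eqP => _;
    rewrite ?mulr1n ?mulr0n mxE.
have := iphi x (delta_mx 0 i) (delta_mx 0 j).
rewrite dij !isometry_frameE -!rowE => e; rewrite [RHS]mxE -e.
by rewrite /dot !mxE; apply: eq_bigr => l _; rewrite !mxE.
Qed.

End ParallelFrame.

(** * Partial tubes *)

Section TwoFactors.
Context {R : realType} (k : nat) (M : 'I_k -> manifold R).

Lemma prodM_invE (p : prodM M) x i :
  chart_inv (chart_at p) x i = chart_inv (chart_at (p i)) (x *m blk i).
Proof. by rewrite mul_blk. Qed.

(** Two coordinates vary at once because the smoothness of a metric family is tested jointly on M_0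
    and M_a. *)
Lemma chart_affine_dfwith2 (p : prodM M) i j (q0 : M i) (q : M j) : i != j ->
  exists c : 'rV[R]_(mdim (prodM M)),
  forall x y, chart_rng (chart_at q0) x -> chart_rng (chart_at q) y ->
    let P : prodM M := dfwith (dfwith p i q0) j q in
    let z := c + (x *m (blk i)^T + y *m (blk j)^T) in
    chart_rng (chart_at P) z /\
    dfwith (dfwith p i (chart_inv (chart_at q0) x)) j (chart_inv (chart_at q) y) =
    chart_inv (chart_at P) z.
Proof.
move=> ij; have ji : j != i by rewrite eq_sym.
pose P : prodM M := dfwith (dfwith p i q0) j q.
pose t : 'rV[R]_(mdim (prodM M)) := chart_map (chart_at P) P.
(* The chart coordinates of [P] with blocks [i] and [j] erased, to be refilled by [x] and [y]. *)
exists (t - t *m blk i *m (blk i)^T - t *m blk j *m (blk j)^T) => x y qx qy P' z.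
have zi : z *m blk i = x.
  rewrite /z !mulmxDl !mulNmx !mulmx_blkTK !(mulmx_blkT0 _ ji).
  by rewrite subrr oppr0 add0r addr0 add0r.
have zj : z *m blk j = y.
  rewrite /z !mulmxDl !mulNmx !mulmx_blkTK !(mulmx_blkT0 _ ij).
  by rewrite oppr0 addr0 subrr !add0r.
have zl l : i != l -> j != l -> z *m blk l = chart_map (chart_at (P l)) (P l).
  move=> il jl; rewrite /z !mulmxDl !mulNmx !(mulmx_blkT0 _ il) !(mulmx_blkT0 _ jl).
  by rewrite oppr0 !addr0 /t mxrow_blk.
split.
  apply/prodM_rngP => l; have [<-|jl] := eqVneq j l; first by rewrite zj /P' dfwithin.
  have [<-|il] := eqVneq i l; first by rewrite zi /P' (dfwithout _ _ ji) dfwithin.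
  by rewrite zl //; exact: chart_center_rng.
apply: functional_extensionality_dep => l; rewrite prodM_invE.
have [<-|jl] := eqVneq j l; first by rewrite zj /P' !dfwithin.
have [<-|il] := eqVneq i l; first by rewrite zi /P' !(dfwithout _ _ ji) !dfwithin.
rewrite (zl _ il jl) chart_centerK.
exact: etrans (etrans (dfwithout _ _ jl) (dfwithout _ _ il)) (esym (etrans
  (dfwithout _ _ jl) (dfwithout _ _ il))).
Qed.

End TwoFactors.

Section Tube.
Context {R : realType} (r : nat) (M : 'I_r.+1 -> manifold R).
Hypothesis cM : connected_manifold (prodM M).
Variables (n : 'I_r -> nat) (fa : forall a, tail M a -> 'rV[R]_(n a)) (s : nat).
Let N := (\sum_a n a)%N.
Let h : prodM (tail M) -> 'rV[R]_N := prod_immersion fa.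
Variables (Phi : prodM (tail M) -> 'M[R]_(s, N)) (f0 : M ord0 -> 'rV[R]_s).
Hypothesis ifa : forall a, immersion (@fa a).
Hypothesis if0 : immersion f0.
Hypothesis sPhi : smooth_map Phi.
Hypothesis PhiN : forall x (y : 'rV[R]_s), (y *m Phi x <= normal_mx h x)%MS.
Hypothesis PhiO : forall x, Phi x *m (Phi x)^T = 1%:M.
Hypothesis PhiP : forall x X (y : 'rV[R]_s), normal_part h x (y *m ediff Phi x X) = 0.
Hypothesis Om : forall p0 x, 1%:M - shape_operator h x (f0 p0 *m Phi x) \in unitmx.
Let f (p : prodM M) := h (tail_pt p) + f0 (p ord0) *m Phi (tail_pt p).

Let sfa a : smooth_map (@fa a). Proof. by have [] := ifa a. Qed.
Let sf0 : smooth_map f0. Proof. by have [] := if0. Qed.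
Let sh : smooth_map h. Proof. exact: smooth_prod_immersion. Qed.
Let ih : immersion h. Proof. exact: immersion_prod. Qed.

Let hE x X a : ediff h x X *m blk a = ediff (@fa a) (x a) (X *m blk a).
Proof. exact: ediff_prod_immersion. Qed.

Lemma smooth_tube : smooth_map f.
Proof.
apply: smooth_mapD.
  exact: (smooth_map_affine (@chart_affine_tail_pt R r M) sh).
apply: smooth_map_mulmx.
  exact: (smooth_map_affine (@chart_affine_proj R _ M ord0) sf0).
exact: (smooth_map_affine (@chart_affine_tail_pt R r M) sPhi).
Qed.

Lemma ediff_tube p X : ediff f p X =
  ediff h (tail_pt p) (X *m tail_mx M) + (ediff f0 (p ord0) (X *m blk ord0) *m Phi
    (tail_pt p) +
    f0 (p ord0) *m ediff Phi (tail_pt p) (X *m tail_mx M)).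
Proof.
have aT := @chart_affine_tail_pt R r M.
have a0 := @chart_affine_proj R _ M ord0.
rewrite -(ediff_affine aT h) -(ediff_affine aT Phi) -(ediff_affine a0 f0).
have dh := mdifferentiable_affine aT (smooth_map_mdifferentiable (tail_pt p) sh).
have dP := mdifferentiable_affine aT (smooth_map_mdifferentiable (tail_pt p) sPhi).
have d0 := mdifferentiable_affine a0 (smooth_map_mdifferentiable (p ord0) sf0).
have dp := mdifferentiable_mulmx d0 dP.
apply: etrans (ediffD X dh dp) _; congr (_ + _).
exact: ediff_mulmx.
Qed.

Lemma ediff_sectionE x X (y : 'rV[R]_s) : ediff (fun z => y *m Phi z) x X = y *m
  ediff Phi x X.
Proof. by apply: (ediff_lin (mulmx y)); exact: smooth_map_mdifferentiable. Qed.

Lemma ediff_frame x X (y : 'rV[R]_s) :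
  y *m ediff Phi x X = - ediff h x (X *m shape_operator h x (y *m Phi x)).
Proof.
rewrite -ediff_sectionE; apply: (@weingarten _ _ _ h sh (fun z => y *m Phi z) x X ih).
- exact: (mdifferentiable_lin (mulmx y)) (smooth_map_mdifferentiable _ sPhi).
- by move=> z; exact: PhiN.
by rewrite /normal_derivative ediff_sectionE PhiP.
Qed.

Lemma ediff_tube_split p X : ediff f p X =
  ediff f0 (p ord0) (X *m blk ord0) *m Phi (tail_pt p) +
  ediff h (tail_pt p) (X *m tail_mx M *m
    (1%:M - shape_operator h (tail_pt p) (f0 (p ord0) *m Phi (tail_pt p)))).
Proof.
have dh := smooth_map_mdifferentiable (tail_pt p) sh.
rewrite ediff_tube ediff_frame; move: (X *m tail_mx M) => Z.
by rewrite mulmxBr mulmx1 (ediff_argB _ _ dh) addrCA.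
Qed.

Lemma dot_normal_tangent x (y : 'rV[R]_s) X : dot (y *m Phi x) (ediff h x X) = 0.
Proof. by have /(normal_mxP sh) e := PhiN x y; exact: e. Qed.

Lemma immersion_tube : immersion f.
Proof.
split; first exact: smooth_tube.
move=> p; apply: injective_ediff; first exact: (smooth_map_mdifferentiable _
  smooth_tube).
move=> X; rewrite ediff_tube_split; set u := ediff f0 _ _; set v := ediff h _ _ => e.
have uv : u *m Phi (tail_pt p) = - v by apply/eqP; rewrite -addr_eq0 e.
have v0 : v = 0.
  by apply: dot_eq0; rewrite -[v in dot v _]opprK dotNl -uv dot_normal_tangent oppr0.
have u0 : u = 0.
  rewrite -[u]mulmx1 -(PhiO (tail_pt p)) mulmxA uv v0 oppr0 mul0mx //.
have X0 := immersion_eq0 if0 u0.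
have := immersion_eq0 ih v0 => /(congr1 (mulmx^~ (invmx (1%:M - shape_operator h
  (tail_pt p) (f0 (p ord0) *m Phi (tail_pt p)))))).
rewrite mul0mx mulmxK // => Xt.
apply: blkP => i; rewrite mul0mx; case: (unliftP ord0 i) => [a ->|->] //.
by rewrite -tail_mx_blk mulmxA Xt mul0mx.
Qed.

(** By [normal_field_derive], the derivative of the field along M_b pairs with h_* Z, for Z tangent
    to M_a, as minus the pairing of the field with a mixed second derivative of [h], which is zero.
    The derivative is - h_* [W]; choosing for Z the a-th block of [W] shows that its a-th component
    has norm zero. *)
Lemma ediff_frame_blk x a b (Y : 'rV[R]_(mdim (tail M b))) (y : 'rV[R]_s) : a != b ->
  y *m ediff Phi x (Y *m (blk b)^T) *m blk a = 0.
Proof.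
move=> ab; rewrite ediff_frame; set W := (X in ediff h x X); rewrite mulNmx;
  apply/eqP; rewrite oppr_eq0.
apply/eqP; rewrite hE; apply: dot_eq0.
have dx : mdifferentiable (fun z => y *m Phi z) x.
  exact: (mdifferentiable_lin (mulmx y)) (smooth_map_mdifferentiable _ sPhi).
have := @normal_field_derive _ _ _ h sh (fun z => y *m Phi z) x (Y *m (blk b)^T) (W
  *m blk a *m (blk a)^T) dx.
rewrite ediff_sectionE ediff_frame -/W prod_immersion_mixed // dot0r addr0 dotNl.
move: W => W /(_ _) e; have /eqP : - dot (ediff h x W) (ediff h x (W *m blk a *m
  (blk a)^T)) = 0.
  by apply: e; near=> z.
rewrite oppr_eq0 => /eqP; rewrite dot_blk (bigD1 a) //= [X in _ + X]big1 ?addr0 =>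
  [|c ca].
  have E2 := hE x (W *m blk a *m (blk a)^T) a; rewrite mulmx_blkTK in E2.
  by move=> e0; apply: etrans _ e0; congr (dot _ _); apply: esym;
    [exact: hE|exact: E2].
have ac : a != c by rewrite eq_sym.
rewrite [X in dot _ X]hE (mulmx_blkT0 _ ac) ediff0; exact: dot0r.
Unshelve. all: by end_near. Qed.

Let ord0_lift (a : 'I_r) : lift ord0 a != ord0 :> 'I_r.+1.
Proof. by rewrite eq_sym neq_lift. Qed.

Lemma ediff_tube_lift (p : prodM M) a (Y : 'rV[R]_(mdim (M (lift ord0 a)))) :
  ediff f p (Y *m (blk (lift ord0 a))^T) =
  ediff h (tail_pt p) ((Y : 'rV[R]_(mdim (tail M a))) *m (blk a)^T) +
  f0 (p ord0) *m ediff Phi (tail_pt p) ((Y : 'rV[R]_(mdim (tail M a))) *m (blk a)^T).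
Proof.
by rewrite ediff_tube -!mulmxA blkT_tail_mx blkTblk0 ?ord0_lift // mulmx0 ediff0
  mul0mx add0r.
Qed.

Lemma ediff_tube_blk0 (p : prodM M) a b (Y : 'rV[R]_(mdim (M (lift ord0 b)))) : a
  != b ->
  ediff f p (Y *m (blk (lift ord0 b))^T) *m blk a = 0.
Proof.
move=> ab; have ba : b != a by rewrite eq_sym.
by rewrite ediff_tube_lift mulmxDl (ediff_frame_blk _ _ _ ab) addr0 hE (mulmx_blkT0
  _ ba) ediff0.
Qed.

Let df p : mdifferentiable f p.
Proof. exact: smooth_map_mdifferentiable smooth_tube. Qed.

Lemma tube_blk_invariant a (p p' : prodM M) :
  p ord0 = p' ord0 -> p (lift ord0 a) = p' (lift ord0 a) ->
  f p *m blk a = f p' *m blk a.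
Proof.
move=> e0 ea.
have dfa q : mdifferentiable (fun p => f p *m blk a) q.
  exact: (mdifferentiable_lin (mulmxr (blk a)) (df q)).
apply: (@partial0_invariant _ _ _ _ _ (fun p => f p *m blk a)
  [pred j | (j == ord0) || (j == lift ord0 a)]) => //.
- by move=> i; exact: connected_factor.
- move=> q j Y; rewrite inE negb_or; case: (unliftP ord0 j) Y => [b ->|->] Y;
  last by rewrite eqxx.
  rewrite (inj_eq lift_inj) => /andP[_ ba].
  rewrite (ediff_lin (mulmxr (blk a)) _ (df q)).
  by apply: ediff_tube_blk0; rewrite eq_sym.
- by move=> j /orP[/eqP ->|/eqP ->].
Qed.

(* The a-th block of f depends only on the coordinates 0 and a, so the remaining
   coordinates can be frozen at those of an arbitrary p. *)
Definition tube_slice (p : prodM M) a (p0 : M ord0) (q : tail M a) : 'rV[R]_(n a) :=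
  f (dfwith (dfwith p ord0 p0) (lift ord0 a) q) *m blk a.

Lemma tube_sliceE p a (p0 : M ord0) (q : tail M a) X :
  ediff (tube_slice p p0) q X =
  ediff f (dfwith (dfwith p ord0 p0) (lift ord0 a) q) (X *m (blk (lift ord0 a))^T)
    *m blk a.
Proof.
apply: etrans (@ediff_dfwith R _ M _ (fun p => f p *m blk a) _ (lift ord0 a) q X) _.
exact: (ediff_lin (mulmxr (blk a)) _ (df _)).
Qed.

(** The base point [pb] is unrelated to [p]: the family of metrics on M_a may depend on p_0 only, so
    its slices are frozen once for all [p]. *)
Lemma ediff_tube_liftE p (pb : prodM M) a (Y : 'rV[R]_(mdim (M (lift ord0 a)))) :
  ediff f p (Y *m (blk (lift ord0 a))^T) =
  ediff (tube_slice pb (p ord0)) (p (lift ord0 a)) Y *m (blk a)^T.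
Proof.
apply: blkP => b; have [<-|ab] := eqVneq a b; last first.
  rewrite (mulmx_blkT0 _ ab); apply: ediff_tube_blk0; by rewrite eq_sym.
rewrite mulmx_blkTK.
have -> : tube_slice pb (p ord0) = (fun q : tail M a => f (dfwith p (lift ord0 a)
  q) *m blk a).
  apply/funext => q; apply: tube_blk_invariant; rewrite ?dfwithin //.
  by rewrite (dfwithout _ _ (ord0_lift a)) dfwithin (dfwithout _ _ (ord0_lift a)).
have dq := df (dfwith p (lift ord0 a) (p (lift ord0 a))).
have := @ediff_dfwith R _ M _ (fun p => f p *m blk a) p (lift ord0 a) (p (lift ord0
  a)) Y.
rewrite (ediff_lin (mulmxr (blk a)) _ dq) dfwith_id => e; exact: esym e.
Qed.

Lemma smooth_tube_slice p a (p0 : M ord0) : smooth_map (@tube_slice p a p0).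
Proof.
apply: (@smooth_map_lin _ (tail M a) _ _ _ (mulmxr (blk a))
  (f \o (dfwith (dfwith p ord0 p0) (lift ord0 a) : tail M a -> prodM M))).
exact: (smooth_map_affine (@chart_affine_dfwith _ _ _ _ _) smooth_tube).
Qed.

(** For X tangent to M_a, the vector f_* X has no component outside block [a], so it vanishes as
    soon as its a-th block does. *)
Lemma immersion_tube_slice p a (p0 : M ord0) : immersion (@tube_slice p a p0).
Proof.
split; first exact: smooth_tube_slice.
move=> q; apply: injective_ediff; first exact: (smooth_map_mdifferentiable _
  (@smooth_tube_slice p a p0)).
move=> X; rewrite tube_sliceE; set z := dfwith _ _ _ => e.
have e0 : ediff f z (X *m (blk (lift ord0 a))^T) = 0.
  apply: blkP => b; rewrite mul0mx; have [<-|ab] := eqVneq a b; first exact: e.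
  by apply: ediff_tube_blk0; rewrite eq_sym.
have := immersion_eq0 immersion_tube e0 => /(congr1 (mulmx^~ (blk (lift ord0 a)))).
by rewrite mulmx_blkTK mul0mx.
Qed.

Lemma smooth_tube_metric_family (pb : prodM M) a :
  smooth_metric_family (fun p0 => induced_metric (@tube_slice pb a p0)).
Proof.
split=> [p0|q0 q v w]; first exact/induced_metric_riemannian/immersion_tube_slice.
set U := [set z | _].
have oU : open U.
  have o1 : open ((lsubmx : 'rV[R]_(mdim (M ord0) + mdim (tail M a)) -> _) @^-1`
    chart_rng (chart_at q0)).
    by apply: open_comp => [z _|]; [exact: continuous_lsubmx|exact: chart_rng_open].
  have o2 : open ((rsubmx : 'rV[R]_(mdim (M ord0) + mdim (tail M a)) -> _) @^-1`
    chart_rng (chart_at q)).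
    by apply: open_comp => [z _|]; [exact: continuous_rsubmx|exact: chart_rng_open].
  exact: openI o1 o2.
have l0 : ord0 != lift ord0 a :> 'I_r.+1 by rewrite neq_lift.
have [c cE] := @chart_affine_dfwith2 R _ M pb ord0 (lift ord0 a) q0 q l0.
set P : prodM M := dfwith (dfwith pb ord0 q0) (lift ord0 a) q in cE.
pose A : 'M[R]_(mdim (M ord0) + mdim (tail M a), mdim (prodM M)) :=
  col_mx (blk ord0)^T (blk (lift ord0 a))^T.
pose K (z : 'rV[R]_(mdim (M ord0) + mdim (tail M a))) : 'rV[R]_(n a) :=
  f (chart_inv (chart_at P) (c + z *m A)) *m blk a.
have zA z : z *m A = lsubmx z *m (blk ord0)^T + rsubmx z *m (blk (lift ord0 a))^T.
  by rewrite -{1}[z]hsubmxK mul_row_col.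
have UE z : U z -> chart_rng (chart_at P) (c + z *m A) /\
    tube_slice pb (chart_inv (chart_at q0) (lsubmx z)) (chart_inv (chart_at q)
      (rsubmx z)) = K z.
  move=> [z0 z1]; have [r1 e1] := cE _ _ z0 z1; rewrite zA; split; first exact: r1.
  by rewrite /K zA -e1.
have sK : smooth_on U K.
  apply: (smooth_on_lin oU (mulmxr (blk a))).
  have /smooth_mapP sf := smooth_tube.
  have := @smooth_on_affine _ _ _ _ _ _ A c (sf P).
  by apply: smooth_on_sub => z /UE [].
(* With the M_0 coordinates held fixed, differentiating [K] in the M_a directions gives the
   differential of the slice on coordinate fields. The metric coefficients become inner products of
   derivatives of one jointly smooth map. *)
have KE u z : U z -> 'D_(row_mx 0 u) K z =
   ediff (@tube_slice pb a (chart_inv (chart_at q0) (lsubmx z))) (chart_inv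
     (chart_at q) (rsubmx z))
     (coord_field q u (chart_inv (chart_at q) (rsubmx z))).
  move=> Uz; have [z0 z1] := Uz.
  have sl := @smooth_tube_slice pb a (chart_inv (chart_at q0) (lsubmx z)).
  have [_ <-] := chart_chain z1 (smooth_map_mdifferentiable _ sl).
  have zE y : row_mx (lsubmx z) 0 + y *m row_mx 0 1%:M = row_mx (lsubmx z) y.
    by rewrite mul_mx_row mulmx0 mulmx1 add_row_mx addr0 add0r.
  have := derive_affine K (row_mx 0 1%:M) (row_mx (lsubmx z) 0) (rsubmx z) u.
  rewrite zE hsubmxK mul_mx_row mulmx0 mulmx1 => <-.
  apply: near_eq_derive; near=> y.
  have Uy : U (row_mx (lsubmx z) y).
    split; rewrite ?row_mxKl ?row_mxKr //.
    near: y; apply: open_nbhs_nbhs; split; [exact: chart_rng_open|exact: z1].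
  by have [_] := UE _ Uy; rewrite zE row_mxKl row_mxKr => <-.
have := smooth_on_dot oU (smooth_on_derive (row_mx 0 v) sK) (smooth_on_derive
  (row_mx 0 w) sK).
apply: (smooth_on_eq oU) => z Uz.
by rewrite /induced_metric !KE.
Unshelve. all: by end_near. Qed.

Lemma polar_tube : polar (induced_metric f).
Proof.
have [[pb _] _] := cM.
exists (induced_metric f0), (fun a p0 => induced_metric (@tube_slice pb a p0)); split.
- exact: induced_metric_riemannian.
- by move=> a; exact: smooth_tube_metric_family.
move=> p X Y; rewrite /induced_metric.
(* The part of f_* X tangent to [h]. What remains of f_* X is normal to [h] and contributes the
   metric of M_0. *)
pose t X := ediff h (tail_pt p) (X *m tail_mx M) + f0 (p ord0) *m ediff Phi
  (tail_pt p) (X *m tail_mx M).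
have tT Z : exists W, t Z = ediff h (tail_pt p) W.
  have dh := smooth_map_mdifferentiable (tail_pt p) sh.
  by rewrite /t ediff_frame -(ediff_argB _ _ dh); eexists.
have eE Z : ediff f p Z = ediff f0 (p ord0) (Z *m blk ord0) *m Phi (tail_pt p) + t Z.
  by rewrite ediff_tube addrCA.
have dnt u Z : dot (u *m Phi (tail_pt p)) (t Z) = 0.
  by have [W ->] := tT Z; exact: dot_normal_tangent.
have tblk a Z : t Z *m blk a =
    ediff (@tube_slice pb a (p ord0)) (p (lift ord0 a)) (Z *m blk (lift ord0 a)).
  (* Removing the M_0 component of [Z] kills the normal part, so the blocks of [t Z] are those of
     partial differentials of [f], which the slices compute. *)
  have e : t Z = ediff f p (Z - Z *m blk ord0 *m (blk ord0)^T).
    rewrite eE mulmxBl mulmx_blkTK subrr ediff0 mul0mx add0r /t.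
    by rewrite mulmxBl -(mulmxA _ _ (tail_mx M)) blkT0_tail_mx mulmx0 subr0.
  rewrite e {1}[Z]sum_blk big_ord_recl addrAC subrr add0r.
  have -> : ediff f p (\sum_(i < r) Z *m blk (lift ord0 i) *m (blk (lift ord0 i))^T) =
    \sum_(i < r) ediff f p (Z *m blk (lift ord0 i) *m (blk (lift ord0 i))^T).
    rewrite (ediff_jac _ (df p)) mulmx_suml; apply: eq_bigr => i _.
    by rewrite (ediff_jac _ (df p)).
  rewrite mulmx_suml (bigD1 a) //= [X in _ + X]big1 => [|b ba].
    by rewrite addr0 (ediff_tube_liftE p pb) mulmx_blkTK.
  by apply: ediff_tube_blk0; rewrite eq_sym.
clearbody t; rewrite !eE (dot_orthogonalD (dnt _ _) (dnt _ _)); congr (_ + _).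
  by rewrite dot_mulr -(mulmxA _ (Phi _)) PhiO mulmx1 !proj_diffE -!mul_blk.
rewrite dot_blk; apply: eq_bigr => a _.
by rewrite !tblk !proj_diffE -!mul_blk.
Qed.

Lemma adapted_tube : adapted f.
Proof.
have sf := smooth_tube.
(* Vanishing of [second_form] amounts to tangency of the second derivative, so no component has to
   be computed. *)
have key a (p : prodM M) i X (Y : 'rV[R]_(mdim (M (lift ord0 a)))) : i != lift ord0
  a ->
    (('D_(X *m (blk i)^T) (fun x => 'D_(Y *m (blk (lift ord0 a))^T) (f \o chart_inv
      (chart_at p)) x)
      (chart_map (chart_at p) p)) <= jac f p)%MS.
  move=> ia; have ai : lift ord0 a != i by rewrite eq_sym.
  have [_ <-] := mixed_partial p Y X sf ai.
  case: (unliftP ord0 i) X ia ai => [b ->|->] X ia ai.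
    (* The partial of [f] along M_a depends on p_0 and p_a only, so it is constant along M_b. *)
    rewrite (_ : (fun q => _) = fun=> ediff (tube_slice p (p ord0)) (p (lift ord0
      a)) Y *m (blk a)^T).
      by rewrite ediff_cst sub0mx.
    apply/funext => q; rewrite (ediff_tube_liftE _ p).
    by rewrite (dfwithout _ _ (ord0_lift b)) (dfwithout _ _ ia).
  pose W : 'rV[R]_(mdim (prodM (tail M))) := (Y : 'rV[R]_(mdim (tail M a))) *m (blk
    a)^T.
  pose C := ediff Phi (tail_pt p) W.
  rewrite (_ : (fun q => _) = fun q => ediff h (tail_pt p) W + f0 q *m C); last first.
    apply/funext => q; rewrite ediff_tube_lift dfwithin.
    have -> // : tail_pt (dfwith p ord0 q) = tail_pt p.
    by apply: functional_extensionality_dep => b;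
      rewrite /tail_pt dfwithout ?neq_lift.
  have d0 := smooth_map_mdifferentiable (p ord0) sf0.
  have dC : mdifferentiable (fun q => f0 q *m C) (p ord0).
    exact: (mdifferentiable_lin (mulmxr C) d0).
  rewrite (ediffD _ (mdifferentiable_cst _ _) dC) ediff_cst add0r.
  have -> : ediff (fun q => f0 q *m C) (p ord0) X = ediff f0 (p ord0) X *m C.
    exact: (ediff_lin (mulmxr C) X d0).
  rewrite ediff_frame.
  set V := (X in ediff h _ X); rewrite eqmx_opp.
  pose B := 1%:M - shape_operator h (tail_pt p) (f0 (p ord0) *m Phi (tail_pt p)).
  (* The derivative is h_* of a tangent vector of the tail up to sign. Since [f] acts on tail
     vectors as h_* after [B], its preimage is that vector multiplied by the inverse of [B], with
     zero M_0 block. *)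
  apply/(tangent_mxP sf); exists (V *m invmx B *m (tail_mx M)^T).
  rewrite ediff_tube_split -!(mulmxA (V *m invmx B)).
  by rewrite tail_mxT_blk0 tail_mxTK mulmx0 ediff0 mul0mx add0r mul1mx mulmxKV ?Om.
move=> p i j X Y ij /product_netE -> /product_netE ->.
rewrite /second_form; apply: normal_part_tangent.
case: (unliftP ord0 j) Y ij => [b ->|->] Y ij; first exact: key.
case: (unliftP ord0 i) X ij => [b ->|->] X ij; last by rewrite eqxx in ij.
have /smooth_mapP /(_ p) sfp := sf.
(* The inner derivative is along M_0 here; exchanging the two derivatives reduces to [key]. *)
rewrite (schwarz_mx _ _ (@chart_rng_open _ _ _ _) (chart_center_rng p) sfp).
by apply: key; rewrite eq_sym.
Qed.

End Tube.

(** * Parallel orthonormal normal frames *)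

Lemma smooth_on_id {R : realType} (V : normedModType R) (U : set V) :
  smooth_on U (fun x : V => x).
Proof.
case=> [|k]; first by move=> x _; exact: cvg_id.
split=> [x _|v].
  have cid : continuous (idfun : V -> V) by move=> y; exact: cvg_id.
  exact: (@linear_differentiable _ _ _ idfun x cid).
rewrite (_ : (fun x => _) = cst v); first exact: Ck_cst.
by apply/funext => x; rewrite derive_id.
Qed.

Section LocalCalculus.
Context {R : realType} (L : manifold R).

Lemma near_chart_inv (p : L) (P : L -> Prop) : (\forall q \near p, P q) ->
  \forall z \near chart_map (chart_at p) p, P (chart_inv (chart_at p) z).
Proof.
move=> nP; have ci := chart_inv_cont (chart_center_rng p).
have nP' : \forall q \near chart_inv (chart_at p) (chart_map (chart_at p) p), P q.
  by rewrite chart_centerK.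
exact: (ci _ nP').
Qed.

Lemma near_eq_ediff (W : normedModType R) (f g : L -> W) p X :
  (\near p, f p = g p) -> ediff f p X = ediff g p X.
Proof. by move=> /near_chart_inv; exact: near_eq_derive. Qed.

(** Counterpart of [chart_chain] for functions given in the coordinates of a fixed chart. A
    covariant derivative along a coordinate field arises in this form and has to be differentiated
    again. *)
Lemma chart_map_mdifferentiable (q : L) (W : normedModType R) (g : 'rV[R]_(mdim L)
  -> W) y v :
  chart_dom (chart_at q) y -> differentiable g (chart_map (chart_at q) y) ->
  mdifferentiable (g \o chart_map (chart_at q)) y /\
  ediff (g \o chart_map (chart_at q)) y (coord_field q v y) = 'D_v g (chart_map
    (chart_at q) y).
Proof.
move=> qy dg.
have dm : mdifferentiable (g \o chart_map (chart_at q)) y.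
  pose tr := chart_map (chart_at q) \o chart_inv (chart_at y).
  have dtr : differentiable tr (chart_map (chart_at y) y).
    apply: (smooth_on_differentiable (@chart_at_smooth R L q y)).
    by split; [exact: chart_center_rng|rewrite chart_centerK].
  have dg' : differentiable g (tr (chart_map (chart_at y) y)) by rewrite /tr /=
    chart_centerK.
  exact: (@differentiable_comp _ _ _ _ tr g _ dtr dg').
split; first exact: dm.
have ry := chart_map_rng qy.
rewrite -{1}(chart_mapK qy) in dm.
have [_ E] := chart_chain ry dm.
rewrite -{1 2}(chart_mapK qy) -E; apply: near_eq_derive; near=> z.
rewrite /= chart_invK //; near: z; apply: open_nbhs_nbhs; split=> //;
  exact: chart_rng_open.
Unshelve. all: by end_near. Qed.

Lemma chart_preimage_open (q : L) (U : set L) : open U ->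
  open [set x | chart_rng (chart_at q) x /\ U (chart_inv (chart_at q) x)].
Proof.
move=> oU; rewrite openE => x [qx Ux]; apply: filterI.
  by apply: open_nbhs_nbhs; split=> //; exact: chart_rng_open.
by apply: (chart_inv_cont qx); apply: open_nbhs_nbhs; split.
Qed.

End LocalCalculus.

Section NormalParallel.
Context {R : realType} (L : manifold R) (n : nat) (h : L -> 'rV[R]_n).

Lemma tangent_normal_mul0 x k l (u : 'M[R]_(k, n)) (v : 'M[R]_(l, n)) :
  (u <= jac h x)%MS -> (v <= normal_mx h x)%MS -> u *m v^T = 0.
Proof.
move=> /submxP[D ->] /sub_kermxP vJ.
by rewrite -mulmxA -[jac h x *m v^T]trmxK trmx_mul trmxK vJ trmx0 mulmx0.
Qed.

(** Both terms of the product rule pair a tangent derivative with a normal field. *)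
Lemma normal_parallel_gram k l (u : L -> 'M[R]_(k, n)) (v : L -> 'M[R]_(l, n)) x X :
  mdifferentiable u x -> mdifferentiable v x ->
  (u x <= normal_mx h x)%MS -> (v x <= normal_mx h x)%MS ->
  (ediff u x X <= jac h x)%MS -> (ediff v x X <= jac h x)%MS ->
  ediff (fun y => u y *m (v y)^T) x X = 0.
Proof.
move=> du dv nu nv tu tv.
have dvT : mdifferentiable (fun y => (v y)^T) x := mdifferentiable_lin (@trmx R l
  n) dv.
rewrite (ediff_mulmx X du dvT) (ediff_lin (@trmx R l n) X dv).
rewrite (tangent_normal_mul0 tu nv) add0r.
by rewrite -[LHS]trmxK trmx_mul trmxK (tangent_normal_mul0 tv nu) trmx0.
Qed.

End NormalParallel.

Section OrthonormalFrame.
Context {R : realType} (L : manifold R) (n s : nat) (h : L -> 'rV[R]_n).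
Variable Phi : L -> 'M[R]_(s, n).
Hypothesis sh : smooth_map h.
Hypothesis sPhi : smooth_map Phi.
Hypothesis PhiN : forall x, (Phi x <= normal_mx h x)%MS.
Hypothesis PhiO : forall x, Phi x *m (Phi x)^T = 1%:M.
Hypothesis PhiP : forall x X, (ediff Phi x X <= jac h x)%MS.
(** Since the rows of [Phi x] are orthonormal, this is the orthogonal projector onto their span; its
    row space is the fibre. *)
Let E x := (Phi x)^T *m Phi x.
Let phi x (y : 'rV[R]_s) := y *m Phi x.

Let dPhi x : mdifferentiable Phi x. Proof. exact: smooth_map_mdifferentiable. Qed.

Lemma frame_bundleE x k (v : 'M[R]_(k, n)) : (v <= E x)%MS <-> v *m E x = v.
Proof.
split=> [/submxP[D ->]|<-]; last exact: submxMl.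
by rewrite /E -!mulmxA (mulmxA (Phi x)) PhiO mul1mx.
Qed.

Lemma frame_sub_bundle x k (y : 'M[R]_(k, s)) : (y *m Phi x <= E x)%MS.
Proof. by apply/frame_bundleE; rewrite /E !mulmxA -(mulmxA y) PhiO mulmx1. Qed.

(** The frame is parallel, so the normal connection acts as plain differentiation on the
    coefficients. *)
Lemma ediff_frame_section (c : L -> 'rV[R]_s) x X : mdifferentiable c x ->
  normal_derivative h (fun y => c y *m Phi y) x X = ediff c x X *m Phi x.
Proof.
move=> dc; rewrite /normal_derivative (ediff_mulmx _ dc (dPhi x)).
have -> : normal_part h x (ediff c x X *m Phi x + c x *m ediff Phi x X) =
    normal_part h x (ediff c x X *m Phi x) + normal_part h x (c x *m ediff Phi x X).
  exact: mulmxDl.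
rewrite normal_part_normal; last by apply: submx_trans (PhiN x); exact: submxMl.
rewrite normal_part_tangent ?addr0 //.
by apply: submx_trans (PhiP x X); exact: submxMl.
Qed.

Section BundleSection.
Variables (U : set L) (xi : L -> 'rV[R]_n).
Hypotheses (oU : open U) (Exi : section_on E U xi).
Let c x := xi x *m (Phi x)^T.

Lemma frame_coordK x : U x -> xi x = c x *m Phi x.
Proof. by move=> /(proj2 Exi) /frame_bundleE; rewrite /E mulmxA. Qed.

Lemma frame_coord_mdifferentiable x : U x -> mdifferentiable c x.
Proof.
move=> Ux; apply: mdifferentiable_mulmx.
  exact: (smooth_map_on_mdifferentiable (proj1 Exi) Ux).
exact: (mdifferentiable_lin (@trmx R s n)).
Qed.

Lemma section_normal_derivative x X : U x ->
  normal_derivative h xi x X = ediff c x X *m Phi x.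
Proof.
move=> Ux; rewrite -(ediff_frame_section X (frame_coord_mdifferentiable Ux)).
rewrite /normal_derivative; congr normal_part; apply: near_eq_ediff.
near=> y; apply: frame_coordK; near: y; exact: open_nbhs_nbhs.
Unshelve. all: by end_near. Qed.

Lemma frame_coord_smooth (q : L) : smooth_on
  [set x | chart_rng (chart_at q) x /\ U (chart_inv (chart_at q) x)]
  (c \o chart_inv (chart_at q)).
Proof.
have oV := @chart_preimage_open _ _ q U oU.
apply: (smooth_on_mulmx oV); first exact: (proj1 Exi).
apply: (smooth_on_trmx oV); have /smooth_mapP /(_ q) := sPhi.
by apply: smooth_on_sub => z [].
Qed.

Lemma section_nabla2 (q : L) (v w : 'rV[R]_(mdim L)) x : U x -> chart_dom (chart_at
  q) x ->
  normal_derivative h (fun y => normal_derivative h xi y (coord_field q w y)) x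
    (coord_field q v x) =
  'D_v (fun z => 'D_w (c \o chart_inv (chart_at q)) z) (chart_map (chart_at q) x)
    *m Phi x.
Proof.
move=> Ux qx; pose e z := 'D_w (c \o chart_inv (chart_at q)) z.
have Vx : chart_rng (chart_at q) (chart_map (chart_at q) x) /\
    U (chart_inv (chart_at q) (chart_map (chart_at q) x)).
  by split; [exact: chart_map_rng|rewrite chart_mapK].
have de : differentiable e (chart_map (chart_at q) x).
  exact: (smooth_on_differentiable (smooth_on_derive w (frame_coord_smooth q)) Vx).
have [dm E1] := chart_map_mdifferentiable v qx de.
rewrite -/e -E1 -(ediff_frame_section _ dm).
rewrite [LHS]/normal_derivative [RHS]/normal_derivative; congr normal_part;
  apply: near_eq_ediff.
have nU : nbhs x U := open_nbhs_nbhs (conj oU Ux).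
have nq : nbhs x (chart_dom (chart_at q)).
  exact: (open_nbhs_nbhs (conj (@chart_dom_open _ _ _ _) qx)).
apply: filterS2 nU nq => y Uy qy.
apply: etrans (section_normal_derivative _ Uy) _; apply: (congr1 (mulmx^~ (Phi y))).
have dc := frame_coord_mdifferentiable Uy; rewrite -(chart_mapK qy) in dc.
have [_ E2] := chart_chain (chart_map_rng qy) dc.
by rewrite [RHS]/= /e E2 chart_mapK.
Qed.

End BundleSection.

(** In the parallel frame, second covariant derivatives along coordinate fields are second partial
    derivatives of the coefficients, so flatness becomes the symmetry of second derivatives. *)
Lemma frame_flat_parallel : flat_parallel_subbundle s h E.
Proof.
split.
- move=> x0; exists setT, Phi; split; [by split=> //; exact: openT|exact: sPhi|].
  move=> x _; split; first by apply/row_freeP; exists (Phi x)^T; exact: PhiO.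
  by apply/andP; split; [rewrite -{1}(mul1mx (Phi x));
    exact: frame_sub_bundle|exact: submxMl].
- by move=> x; apply: submx_trans (PhiN x); exact: submxMl.
- move=> U xi oU Exi x X Ux; rewrite (section_normal_derivative oU Exi X Ux).
  exact: frame_sub_bundle.
move=> U xi oU Exi q v w x Ux qx nabla.
apply: etrans (section_nabla2 oU Exi v w Ux qx) _.
apply: etrans _ (esym (section_nabla2 oU Exi w v Ux qx)).
have Vx : chart_rng (chart_at q) (chart_map (chart_at q) x) /\
    U (chart_inv (chart_at q) (chart_map (chart_at q) x)).
  by split; [exact: chart_map_rng|rewrite chart_mapK].
apply: (congr1 (mulmx^~ (Phi x))).
exact: (schwarz_mx v w (@chart_preimage_open _ _ q U oU) Vx (frame_coord_smooth oU
  Exi q)).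
Qed.

Lemma frame_parallel_isometry : parallel_isometry h E phi.
Proof.
split.
- move=> q.
  have oV : open [set z : 'rV[R]_(mdim L + s) | chart_rng (chart_at q) (lsubmx z)].
    by apply: (@open_comp _ _ (lsubmx : 'rV[R]_(mdim L + s) -> _)) => [z _|];
      [exact: continuous_lsubmx|exact: chart_rng_open].
  have lE (z : 'rV[R]_(mdim L + s)) : 0 + z *m col_mx 1%:M 0 = lsubmx z.
    by rewrite -{1}[z]hsubmxK mul_row_col mulmx1 mulmx0 addr0 add0r.
  apply: (smooth_on_mulmx oV).
    exact: (smooth_on_lin oV (@rsubmx R 1 (mdim L) s) (@smooth_on_id _ _ _)).
  have /smooth_mapP /(_ q) sq := sPhi.
  have := smooth_on_affine (col_mx 1%:M 0 : 'M[R]_(mdim L + s, mdim L)) 0 sq.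
  rewrite (_ : [set x | _] = [set z : 'rV[R]_(mdim L + s) | chart_rng (chart_at q)
    (lsubmx z)]).
    by apply: (smooth_on_eq oV) => z _; rewrite lE.
  by apply/seteqP; split => z /=; rewrite lE.
- by move=> x a u v; rewrite /phi mulmxDl scalemxAl.
- by move=> x y z; rewrite /phi dot_mulr -mulmxA PhiO mulmx1.
- move=> x v; split=> [/frame_bundleE e|[y <-]]; last exact: frame_sub_bundle.
  by exists (v *m (Phi x)^T); rewrite /phi -mulmxA.
move=> y x X; rewrite /phi (ediff_frame_section X (mdifferentiable_cst x y)).
by rewrite ediff_cst mul0mx.
Qed.

End OrthonormalFrame.

(** * Adapted immersions with polar metric *)

Lemma cyclic_eq0 {R : realType} (a b c : R) : a + b = 0 -> c + a = 0 -> b + c = 0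
  -> a = 0.
Proof. by move=> *; lra. Qed.

Lemma symmetric_eq0 {R : realType} (a b c : R) : a + b = 0 -> b + c = 0 -> a + c =
  0 -> a = 0.
Proof. by move=> *; lra. Qed.

Lemma dot_sumlP {R : realType} k m (P : pred 'I_m) (u : 'I_m -> 'rV[R]_k) v :
  dot (\sum_(i | P i) u i) v = \sum_(i | P i) dot (u i) v.
Proof. by rewrite /dot mulmx_suml summxE. Qed.

Section AdaptedPolar.
Context {R : realType} (r : nat) (M : 'I_r.+1 -> manifold R) (N : nat).
Variable f : prodM M -> 'rV[R]_N.
Hypothesis cM : connected_manifold (prodM M).
Hypothesis imf : immersion f.
Hypothesis polf : polar (induced_metric f).
Hypothesis adf : adapted f.

Let sf : smooth_map f. Proof. by have [] := imf. Qed.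
Let df p : mdifferentiable f p. Proof. exact: smooth_map_mdifferentiable. Qed.
Let cMi i : connected [set: M i]. Proof. exact: connected_factor. Qed.

Definition partial (p : prodM M) i (X : 'rV[R]_(mdim (M i))) : 'rV[R]_N :=
  ediff f p (X *m (blk i)^T).

(** The full second derivative in the chart at [p]: its tangential part is what the polar metric
    controls, its normal part what adaptedness controls. *)
Definition partial2 (p : prodM M) i (X : 'rV[R]_(mdim (M i))) j (Y : 'rV[R]_(mdim
  (M j)))
    : 'rV[R]_N :=
  'D_(X *m (blk i)^T) (fun x => 'D_(Y *m (blk j)^T) (f \o chart_inv (chart_at p)) x)
    (chart_map (chart_at p) p).

Let ord0_lift (a : 'I_r) : lift ord0 a != ord0 :> 'I_r.+1.
Proof. by rewrite eq_sym neq_lift. Qed.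

Lemma pointwise_metric0 (L : manifold R) (g : metric L) p X :
  pointwise_metric g -> g p X 0 = 0 /\ g p 0 X = 0.
Proof.
move=> /(_ p) [lg sg _]; have g0 : g p X 0 = 0.
  have := lg X 1 0 0; rewrite scaler0 addr0 scale1r => /esym/eqP.
  by rewrite -subr_eq0 addrK => /eqP.
by split=> //; rewrite sg.
Qed.

Lemma partial_orthogonal p i j (X : 'rV[R]_(mdim (M i))) (Y : 'rV[R]_(mdim (M j))) :
  i != j -> dot (partial p X) (partial p Y) = 0.
Proof.
have [g0 [ga [rg0 rga gE]]] := polf; move=> ij; apply: etrans (gE p _ _) _.
have z0 (l : 'I_r.+1) : ((X *m (blk i)^T : 'rV[R]_(mdim (prodM M))) *m blk l == 0) ||
    ((Y *m (blk j)^T : 'rV[R]_(mdim (prodM M))) *m blk l == 0).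
  have [<-|il] := eqVneq i l; last by rewrite mulmx_blkT0 ?eqxx.
  by apply/orP; right; rewrite mulmx_blkT0 ?eqxx // eq_sym.
rewrite -[RHS](addr0 0); apply: (f_equal2 (fun x y : R => x + y)).
  rewrite !proj_diffE -!mul_blk; have pg0 := proj1 rg0.
  have /orP[/eqP ->|/eqP ->] := z0 ord0.
    exact: (pointwise_metric0 _ _ pg0).2.
  exact: (pointwise_metric0 _ _ pg0).1.
apply: big1 => a _; rewrite !proj_diffE -!mul_blk.
have pga : pointwise_metric (ga a (p ord0)) := proj1 (proj1 (rga a) (p ord0)).
have /orP[/eqP ->|/eqP ->] := z0 (lift ord0 a).
  exact: (pointwise_metric0 _ _ pga).2.
exact: (pointwise_metric0 _ _ pga).1.
Qed.

(** g_0 depends on p_0 only and g_a on p_0 and p_a only. The second hypothesis excludes exactly the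
    move of p_0 when [i] is not 0. *)
Lemma partial_gram_invariant p i j (q : M j) (X Y : 'rV[R]_(mdim (M i))) :
  i != j -> (i == ord0) || (j != ord0) ->
  dot (partial (dfwith p j q) X) (partial (dfwith p j q) Y) =
  dot (partial p X) (partial p Y).
Proof.
have [g0 [ga [rg0 rga gE]]] := polf; move=> ij ij0.
apply: etrans (gE _ _ _) _; apply: etrans _ (esym (gE _ _ _)).
apply: (f_equal2 (fun x y : R => x + y)).
  rewrite !proj_diffE -!mul_blk; have [j0|j0] := eqVneq j ord0;
    last by rewrite dfwithout.
  by exfalso; move: ij0 ij; rewrite j0 eqxx orbF => /eqP ->; rewrite eqxx.
apply: eq_bigr => a _; rewrite !proj_diffE -!mul_blk.
have [ia|ia] := eqVneq i (lift ord0 a); last first.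
  rewrite !(mulmx_blkT0 _ ia).
  have g00 p0 x : ga a p0 x 0 0 = 0.
    exact: (pointwise_metric0 _ _ (proj1 (proj1 (rga a) p0))).1.
  by rewrite !g00.
have j0 : j != ord0 by move: ij0; rewrite ia (negPf (ord0_lift a)).
have ja : j != lift ord0 a by rewrite -ia eq_sym.
have -> : tail_pt (dfwith p j q) a = tail_pt p a by rewrite /tail_pt dfwithout.
by rewrite dfwithout.
Qed.

Lemma partial2C p i j (X : 'rV[R]_(mdim (M i))) (Y : 'rV[R]_(mdim (M j))) :
  partial2 p X Y = partial2 p Y X.
Proof.
have /smooth_mapP /(_ p) sfp := sf.
exact: (schwarz_mx _ _ (@chart_rng_open _ _ _ _) (chart_center_rng p) sfp).
Qed.

Lemma partial2E p i j (X : 'rV[R]_(mdim (M i))) (Y : 'rV[R]_(mdim (M j))) : j != i ->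
  mdifferentiable (fun q : M i => partial (dfwith p i q) Y) (p i) /\
  ediff (fun q : M i => partial (dfwith p i q) Y) (p i) X = partial2 p X Y.
Proof. by move=> ji; exact: mixed_partial. Qed.

(** Orthogonality of f_* E_i and f_* E_j differentiated along [Z], where [l] may equal [i] or [j].
    It holds at all nearby points because coordinate fields of a product chart keep their block. *)
Lemma partial_orthogonal_derive p l i j (Z : 'rV[R]_(mdim (M l)))
    (X : 'rV[R]_(mdim (M i))) (Y : 'rV[R]_(mdim (M j))) : i != j ->
  dot (partial2 p Z X) (partial p Y) + dot (partial2 p Z Y) (partial p X) = 0.
Proof.
move=> ij; have /smooth_mapP /(_ p) sfp := sf.
pose c := chart_map (chart_at p) p.
have dD k (W : 'rV[R]_(mdim (M k))) :
    differentiable (fun z => 'D_(W *m (blk k)^T) (f \o chart_inv (chart_at p)) z) c.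
  exact: (smooth_on_differentiable (smooth_on_derive _ sfp) (chart_center_rng p)).
apply: etrans (f_equal2 (fun x y : R => x + y) erefl (dotC _ _)) _.
apply: etrans (esym (derive_dot (Z *m (blk l)^T) (dD _ X) (dD _ Y))) _.
apply: etrans (derive_cst (0 : R) c (Z *m (blk l)^T)); apply: near_eq_derive.
apply: filterS (nbhs_chart_center p) => z rz.
have [_ E] := chart_chain rz (df _); rewrite !E.
have dz := chart_inv_dom rz.
by rewrite !coord_field_incl //; exact: partial_orthogonal.
Qed.

Lemma partial_gram_derive p i j (Z : 'rV[R]_(mdim (M j))) (X Y : 'rV[R]_(mdim (M
  i))) :
  i != j -> (i == ord0) || (j != ord0) ->
  dot (partial2 p Z X) (partial p Y) + dot (partial2 p Z Y) (partial p X) = 0.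
Proof.
move=> ij ij0.
have [dX eX] := partial2E p Z X ij; have [dY eY] := partial2E p Z Y ij.
have pj : dfwith p j (p j) = p := dfwith_id p j.
have e0 : ediff (fun q => dot (partial (dfwith p j q) X) (partial (dfwith p j q)
  Y)) (p j) Z = 0.
  rewrite (_ : (fun q => _) = fun=> dot (partial p X) (partial p Y));
    first exact: ediff_cst.
  by apply/funext => q; exact: partial_gram_invariant.
apply: etrans e0; apply: esym; apply: etrans (ediff_dot Z dX dY) _.
apply: (f_equal2 (fun x y : R => x + y)).
  exact: (f_equal2 (@dot R N) eX (congr1 (fun z => partial z Y) pj)).
apply: etrans (dotC _ _) _.
exact: (f_equal2 (@dot R N) eY (congr1 (fun z => partial z X) pj)).
Qed.

(* Koszul's argument: the inner products of a mixed partial with a third partial are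
   symmetric in the first two slots and antisymmetric in the last two. *)
Lemma partial2_dot_distinct p i j l (X : 'rV[R]_(mdim (M i)))
    (Y : 'rV[R]_(mdim (M j))) (Z : 'rV[R]_(mdim (M l))) :
  i != j -> j != l -> l != i -> dot (partial2 p X Y) (partial p Z) = 0.
Proof.
move=> ij jl li.
have e1 := partial_orthogonal_derive p X Y Z jl.
have e2 := partial_orthogonal_derive p Y Z X li.
have e3 := partial_orthogonal_derive p Z X Y ij.
rewrite (partial2C p Y X) in e2; rewrite (partial2C p Z X) (partial2C p Z Y) in e3.
exact: (cyclic_eq0 e1 e2 e3).
Qed.

(** The metric on M_i does not vary along M_j, so the expression is antisymmetric in [Y] and [Z];
    differentiating the orthogonality of the two factors along [Y] and along [Z] makes it symmetric
    too. *)
Lemma partial2_dot_same p i j (X : 'rV[R]_(mdim (M j))) (Y Z : 'rV[R]_(mdim (M i))) :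
  i != j -> (i == ord0) || (j != ord0) -> dot (partial2 p X Y) (partial p Z) = 0.
Proof.
move=> ij ij0; have ji : j != i by rewrite eq_sym.
have e1 := partial_gram_derive p X Y Z ij ij0.
have e2 := partial_orthogonal_derive p Z X Y ji.
have e3 := partial_orthogonal_derive p Y X Z ji.
rewrite (partial2C p Z X) (partial2C p Z Y) in e2; rewrite (partial2C p Y X) in e3.
exact: (symmetric_eq0 e1 e2 e3).
Qed.

Lemma partial_sum p (W : 'rV[R]_(mdim (prodM M))) :
  ediff f p W = \sum_l partial p (W *m blk l).
Proof. exact: (ediff_sum_blk W (df p)). Qed.

(** Adaptedness makes the mixed partial tangent. It is orthogonal to f_* E_l for every l other than
    [i]: by [partial2_dot_distinct] when l differs from [j], and by [partial2_dot_same] with the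
    factors exchanged when l is [j], which is where [i != ord0] enters. *)
Lemma partial2_span p i j (X : 'rV[R]_(mdim (M j))) (Y : 'rV[R]_(mdim (M i))) :
  i != j -> i != ord0 ->
  exists W : 'rV[R]_(mdim (M i)), partial2 p X Y = partial p W.
Proof.
move=> ij i0; have ji : j != i by rewrite eq_sym.
have sJ : (partial2 p X Y <= jac f p)%MS.
  apply: normal_part_eq0; apply: (adf ji); exact: product_net_incl.
have /(tangent_mxP sf) [W WE] := sJ.
have d0 l (Z : 'rV[R]_(mdim (M l))) : l != i -> dot (partial2 p X Y) (partial p Z)
  = 0.
  move=> li; have [jl|jl] := eqVneq j l; last first.
    by apply: partial2_dot_distinct => //; rewrite eq_sym.
  subst l; rewrite partial2C.
  by apply: partial2_dot_same; rewrite ?i0 ?orbT.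
exists (W *m blk i); apply/eqP; rewrite -subr_eq0; apply/eqP.
have E : partial2 p X Y - partial p (W *m blk i) = \sum_(l | l != i) partial p (W
  *m blk l).
  by rewrite {1}WE partial_sum (bigD1 i) //= addrAC subrr add0r.
have o l (Z : 'rV[R]_(mdim (M l))) : l != i -> dot (partial2 p X Y - partial p (W
  *m blk i)) (partial p Z) = 0.
  move=> li; have il : i != l by rewrite eq_sym.
  by rewrite dotBl (d0 _ _ li) (partial_orthogonal _ _ _ il) subr0.
(* The difference is a sum of partials along factors other than [i] and is orthogonal to each of
   them, hence to itself. *)
apply: dot_eq0; rewrite {2}E dotC dot_sumlP; apply: big1 => l li; rewrite dotC.
exact: o.
Qed.

Lemma partial_eq0 p i (X : 'rV[R]_(mdim (M i))) : partial p X = 0 -> X = 0.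
Proof.
by move=> /(immersion_eq0 imf) /(congr1 (mulmx^~ (blk i)));
  rewrite mulmx_blkTK mul0mx.
Qed.

Definition frame_mx (p : prodM M) i : 'M[R]_(mdim (M i), N) :=
  ((blk i)^T : 'M[R]_(mdim (M i), mdim (prodM M))) *m jac f p.

Lemma mul_frame_mx p i (X : 'rV[R]_(mdim (M i))) : X *m frame_mx p i = partial p X.
Proof. by rewrite /partial (ediff_jac _ (df p)) mulmxA. Qed.

Lemma frame_mx_free p i : row_free (frame_mx p i).
Proof.
rewrite -kermx_eq0 -submx0; apply/rV_subP => v /sub_kermxP.
by rewrite mul_frame_mx => /partial_eq0 ->; rewrite submx0.
Qed.

Lemma partial_frame_mx0 p i j (X : 'rV[R]_(mdim (M i))) : i != j ->
  partial p X *m (frame_mx p j)^T = 0.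
Proof.
by move=> ij; apply: dot_mx_eq0 => Y; rewrite mul_frame_mx partial_orthogonal.
Qed.

(** The hypotheses test the derivative only at the j-th coordinate of [p] itself; replacing [p] by
    [dfwith p j x] yields it along the whole slice. *)
Lemma constant_along j m k (G : prodM M -> 'M[R]_(m, k)) :
  (forall p : prodM M, mdifferentiable (fun q : M j => G (dfwith p j q)) (p j)) ->
  (forall (p : prodM M) Y, ediff (fun q : M j => G (dfwith p j q)) (p j) Y = 0) ->
  forall (p : prodM M) (q : M j), G (dfwith p j q) = G p.
Proof.
move=> dG G0 p q; rewrite -[in RHS](dfwith_id p j).
have E x : (fun q : M j => G (dfwith p j q)) = (fun q => G (dfwith (dfwith p j x) j
  q)).
  by apply/funext => y; rewrite dfwith_twice.
have dF x : mdifferentiable (fun q : M j => G (dfwith p j q)) x.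
  by rewrite (E x) -{2}(dfwithin p x); exact: dG.
have eF x Y : ediff (fun q : M j => G (dfwith p j q)) x Y = 0.
  by rewrite (E x) -{2}(dfwithin p x); exact: G0.
exact: (ediff0_cst (@cMi j) dF eF).
Qed.

Lemma mdifferentiable_rows (L : manifold R) m k (F : L -> 'M[R]_(m, k)) p :
  (forall i, mdifferentiable (fun q => row i (F q)) p) -> mdifferentiable F p.
Proof.
move=> dF; apply/differentiable_mxP => i l.
have /differentiable_mxP /(_ 0 l) := dF i.
have -> : (fun y => ((fun q => row i (F q)) \o chart_inv (chart_at p)) y 0 l) =
  (fun y => (F \o chart_inv (chart_at p)) y i l) by apply/funext => y; rewrite /= mxE.
exact.
Qed.

(* By partial2_span, moving p_j changes the i-th partials only inside their own span. *)
Lemma row_proj_frame_invariant i (p p' : prodM M) : i != ord0 -> p i = p' i ->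
  row_proj (frame_mx p i) = row_proj (frame_mx p' i).
Proof.
move=> i0 pi; apply: (@dfwith_invariant _ _ _ _ (fun p => row_proj (frame_mx p i))
  (pred1 i)).
  move=> p1 j q ji; have ij : i != j by rewrite eq_sym.
  have frameE z k : row k (frame_mx z i) = partial z (delta_mx 0 k) by rewrite rowE
    mul_frame_mx.
  have dF z : mdifferentiable (fun q : M j => frame_mx (dfwith z j q) i) (z j).
    apply: mdifferentiable_rows => k.
    rewrite (_ : (fun q => _) = (fun q : M j => partial (dfwith z j q) (delta_mx 0
      k))).
      by have [] := partial2E z 0 (delta_mx 0 k) ij.
    by apply/funext => x; rewrite frameE.
  have eF z Y : exists C, ediff (fun q : M j => frame_mx (dfwith z j q) i) (z j) Y =
      C *m frame_mx (dfwith z j (z j)) i.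
    have W k := cid (partial2_span z Y (delta_mx 0 k) ij i0).
    exists (\matrix_k sval (W k)); apply/row_matrixP => k.
    rewrite row_mul rowK mul_frame_mx dfwith_id -(svalP (W k)).
    have [_ <-] := partial2E z Y (delta_mx 0 k) ij.
    have -> : (fun q : M j => partial (dfwith z j q) (delta_mx 0 k)) =
        (fun q => row k (frame_mx (dfwith z j q) i)) by apply/funext => x;
          rewrite frameE.
    exact: esym (ediff_lin (row k) Y (dF z)).
  apply: (@constant_along j _ _ (fun p => row_proj (frame_mx p i))) => [z|z Y].
    have [C CE] := eF z 0.
    by have [] := row_proj_derivative (fun q => frame_mx_free _ _) (dF z) CE.
  have [C CE] := eF z Y.
  by have [] := row_proj_derivative (fun q => frame_mx_free _ _) (dF z) CE.
by move=> j /eqP ->.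
Qed.

Lemma frame_mx_sub i (p p' : prodM M) : i != ord0 -> p i = p' i ->
  (frame_mx p i <= frame_mx p' i)%MS.
Proof.
move=> i0 pi; apply/(row_projP (frame_mx_free p' i)).
rewrite -(row_proj_frame_invariant i0 pi); exact: (mul_row_proj (frame_mx_free p i)).
Qed.

(** The points are unrelated, but the spans depend only on [p i] and [p' j]; both can be moved to
    the common point [z], where polarity gives orthogonality. *)
Lemma frame_mx_orthogonal i j (p p' : prodM M) (u v : 'rV[R]_N) :
  i != j -> i != ord0 -> j != ord0 ->
  (u <= frame_mx p i)%MS -> (v <= frame_mx p' j)%MS -> dot u v = 0.
Proof.
move=> ij i0 j0 up vp; pose z : prodM M := dfwith p j (p' j).
have ji : j != i by rewrite eq_sym.
have zi : p i = z i by rewrite /z (dfwithout _ _ ji).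
have zj : p' j = z j by rewrite /z dfwithin.
have /submxP[X ->] := submx_trans up (frame_mx_sub i0 zi).
have /submxP[Y ->] := submx_trans vp (frame_mx_sub j0 zj).
by rewrite !mul_frame_mx; exact: partial_orthogonal.
Qed.

(** Along M_0 the derivative of [f] is orthogonal to f_* E_i at the moved point. That span depends
    on [p i] alone, which stays put, so the component of [f] in it is constant. *)
Lemma displacement_normal p (q : M ord0) i : i != ord0 ->
  (f (dfwith p ord0 q) - f p) *m (frame_mx p i)^T = 0.
Proof.
move=> i0; have zi : ord0 != i by rewrite eq_sym.
pose g (x : M ord0) := f (dfwith p ord0 x) *m (frame_mx p i)^T.
have dx x : mdifferentiable (f \o dfwith p ord0) x.
  exact: (mdifferentiable_affine (@chart_affine_dfwith _ _ _ p ord0) (df _)).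
have e : g q = g (p ord0).
  apply: (@ediff0_cst _ _ _ _ g (@cMi ord0)) => [x|x Y].
    exact: (mdifferentiable_lin (mulmxr (frame_mx p i)^T) (dx x)).
  apply: etrans (ediff_lin (mulmxr (frame_mx p i)^T) Y (dx x)) _.
  have pe : ediff (f \o dfwith p ord0) x Y = partial (dfwith p ord0 x) Y by exact:
    ediff_dfwith.
  apply: etrans (congr1 (mulmx^~ (frame_mx p i)^T) pe) _.
  have px : p i = dfwith p ord0 x i by rewrite (dfwithout _ _ zi).
  have /submxP[D ->] := frame_mx_sub i0 px.
  by rewrite /= trmx_mul mulmxA partial_frame_mx0 // mul0mx.
by rewrite mulmxBl -/(g q) e /g dfwith_id subrr.
Qed.

(** * Normal displacement fields along a slice with fixed M_0 coordinate *)

Section TailFields.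
Variable q0 : M ord0.
Let L := prodM (tail M).
Let h : L -> 'rV[R]_N := f \o pcons q0.

Lemma smooth_pcons q : smooth_map (f \o pcons q : L -> 'rV[R]_N).
Proof. exact: (smooth_map_affine (chart_affine_pcons q) sf). Qed.

Lemma ediff_pcons q (x : L) X : ediff (f \o pcons q : L -> 'rV[R]_N) x X =
  ediff f (pcons q x) (X *m (tail_mx M)^T).
Proof. exact: (ediff_affine (chart_affine_pcons q)). Qed.

Lemma jac_pcons x : jac h x = (tail_mx M)^T *m jac f (pcons q0 x).
Proof.
apply/row_matrixP => i; rewrite !rowE mulmxA -(ediff_jac _ (df _)).
rewrite -(ediff_jac _ (smooth_map_mdifferentiable x (smooth_pcons q0))).
exact: ediff_pcons.
Qed.

Lemma immersion_pcons : immersion h.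
Proof.
split; first exact: smooth_pcons.
move=> x; apply: injective_ediff; first exact: (smooth_map_mdifferentiable _
  (smooth_pcons q0)).
move=> X; rewrite ediff_pcons => /(immersion_eq0 imf) /(congr1 (mulmx^~ (tail_mx M))).
by rewrite -mulmxA tail_mxTK mulmx1 mul0mx.
Qed.

Lemma frame_mx_jac q (x : L) a :
  (frame_mx (pcons q x) (lift ord0 a) <= jac h x)%MS.
Proof.
have e : pcons q x (lift ord0 a) = pcons q0 x (lift ord0 a) by rewrite !pconsS.
apply: submx_trans (frame_mx_sub (ord0_lift a) e) _.
have -> : frame_mx (pcons q0 x) (lift ord0 a) = (blk a)^T *m jac h x.
  by rewrite jac_pcons mulmxA -trmx_mul tail_mx_blk.
exact: submxMl.
Qed.

Lemma ediff_pcons_tangent q (x : L) X :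
  (ediff (f \o pcons q : L -> 'rV[R]_N) x X <= jac h x)%MS.
Proof.
rewrite ediff_pcons partial_sum big_ord_recl -mulmxA tail_mxT_blk0 mulmx0.
rewrite [partial _ 0](_ : _ = 0) ?add0r; last by rewrite /partial mul0mx ediff0.
apply: summx_sub => a _; rewrite -mul_frame_mx.
by apply: submx_trans (frame_mx_jac q x a); exact: submxMl.
Qed.

Definition displacement (q : M ord0) (x : L) : 'rV[R]_N := f (pcons q x) - h x.

Lemma smooth_displacement q : smooth_map (displacement q).
Proof. exact: (smooth_mapB (smooth_pcons q) (smooth_pcons q0)). Qed.

Lemma displacement_tangent q x X : (ediff (displacement q) x X <= jac h x)%MS.
Proof.
have d1 := smooth_map_mdifferentiable x (smooth_pcons q).
have d2 := smooth_map_mdifferentiable x (smooth_pcons q0).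
rewrite [ediff _ _ _](ediffB X d1 d2); apply: addmx_sub;
  first exact: ediff_pcons_tangent.
rewrite eqmx_opp; exact: ediff_pcons_tangent.
Qed.

Lemma displacement_sub_normal q x : (displacement q x <= normal_mx h x)%MS.
Proof.
apply/(normal_mxP (smooth_pcons q0)) => X.
rewrite ediff_pcons partial_sum big_ord_recl -mulmxA tail_mxT_blk0 mulmx0.
rewrite [partial _ 0](_ : _ = 0) ?add0r; last by rewrite /partial mul0mx ediff0.
rewrite dotC dot_sumlP; apply: big1 => a _; rewrite dotC -mul_frame_mx dot_mulr.
have := displacement_normal (pcons q0 x) q (ord0_lift a).
by rewrite dfwith_pcons => ->; rewrite dot0l.
Qed.

(** No coordinate is held fixed in [partial0_invariant]; connectedness of the factors replaces that
    of the tail product. *)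
Lemma tail_constant m k (u : L -> 'M[R]_(m, k)) :
  (forall x, mdifferentiable u x) -> (forall x X, ediff u x X = 0) ->
  forall x y, u x = u y.
Proof.
move=> du u0 x y; apply: (@partial0_invariant _ _ _ _ _ u pred0) => // a.
exact: cMi.
Qed.

(** The last clause separates variables: the coefficients of the displacement depend on [q] only,
    the frame on [x] only. These coefficients become f_0. *)
Lemma displacement_frame (x0 : L) : exists s (Phi : L -> 'M[R]_(s, N)),
  [/\ smooth_map Phi,
      forall x, (Phi x <= normal_mx h x)%MS,
      forall x X, (ediff Phi x X <= jac h x)%MS,
      forall x, Phi x *m (Phi x)^T = 1%:M &
      forall q x, displacement q x = displacement q x0 *m (Phi x0)^T *m Phi x].
Proof.
have [k [B [SB BS]]] := spanning_matrix [set v | exists q, v = displacement q x0].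
have q_ i := cid (SB i).
pose Xi x : 'M[R]_(k, N) := \matrix_i displacement (sval (q_ i)) x.
have XiB : Xi x0 = B by apply/row_matrixP => i; rewrite rowK -(svalP (q_ i)).
have rowXi i : (fun x => row i (Xi x)) = displacement (sval (q_ i)).
  by apply/funext => x; rewrite rowK.
have sXi : smooth_map Xi by apply: smooth_map_rows => i; rewrite rowXi;
  exact: smooth_displacement.
have dXi x := smooth_map_mdifferentiable x sXi.
have tXi x X : (ediff Xi x X <= jac h x)%MS.
  apply/row_subP => i; rewrite -(ediff_lin (row i) X (dXi x)) rowXi.
  exact: displacement_tangent.
have nXi x : (Xi x <= normal_mx h x)%MS.
  by apply/row_subP => i; rewrite rowK; exact: displacement_sub_normal.
have [Q [QQ QB]] := orthonormal_row_base B.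
have /submxP[A QE] : (Q <= B)%MS by rewrite QB.
(* [A] expresses an orthonormal basis at [x0] through finitely many displacements; the same constant
   combination is used at every point. *)
pose Phi x := A *m Xi x.
have sPhi : smooth_map Phi := smooth_map_lin (mulmx A) sXi.
have dPhi x := smooth_map_mdifferentiable x sPhi.
have nPhi x : (Phi x <= normal_mx h x)%MS by apply: submx_trans (nXi x);
  exact: submxMl.
have tPhi x X : (ediff Phi x X <= jac h x)%MS.
  by rewrite [ediff _ _ _](ediff_lin (mulmx A) X (dXi x));
    apply: submx_trans (tXi x X); exact: submxMl.
have Phi0 : Phi x0 = Q by rewrite /Phi XiB QE.
exists (\rank B), Phi; split=> //.
  move=> x; rewrite -QQ -Phi0.
  apply: (tail_constant (u := fun x => Phi x *m (Phi x)^T)) => [y|y X].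
    exact: mdifferentiable_mulmx (dPhi y) (mdifferentiable_lin (@trmx R _ _) (dPhi
      y)).
  exact: normal_parallel_gram.
move=> q x; rewrite Phi0; set c := displacement q x0 *m Q^T.
(* The error of the expansion. It is again normal with tangent derivative, so its squared length is
   constant, and it vanishes at [x0]. *)
pose D y := displacement q y - c *m Phi y.
have dd y := smooth_map_mdifferentiable y (smooth_displacement q).
have dc y : mdifferentiable (fun y => c *m Phi y) y := mdifferentiable_lin (mulmx
  c) (dPhi y).
have dD y : mdifferentiable D y := mdifferentiableB (dd y) (dc y).
have nD y : (D y <= normal_mx h y)%MS.
  apply: addmx_sub; first exact: displacement_sub_normal.
  by rewrite eqmx_opp; apply: submx_trans (nPhi y); exact: submxMl.
have tD y X : (ediff D y X <= jac h y)%MS.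
  rewrite [ediff _ _ _](ediffB X (dd y) (dc y)); apply: addmx_sub;
    first exact: displacement_tangent.
  rewrite eqmx_opp [ediff _ _ _](ediff_lin (mulmx c) X (dPhi y)).
  by apply: submx_trans (tPhi y X); exact: submxMl.
have D0 : D x0 = 0.
  have /submxP[E DE] : (displacement q x0 <= Q)%MS by rewrite QB; apply: BS; exists q.
  by rewrite /D /c Phi0 DE -!mulmxA (mulmxA Q) QQ mul1mx subrr.
have : D x *m (D x)^T = D x0 *m (D x0)^T.
  apply: (tail_constant (u := fun x => D x *m (D x)^T)) => [y|y X].
    exact: mdifferentiable_mulmx (dD y) (mdifferentiable_lin (@trmx R _ _) (dD y)).
  exact: normal_parallel_gram.
rewrite D0 mul0mx => DD.
have : D x = 0 by apply: dot_eq0; rewrite /dot DD mxE.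
by move=> /eqP; rewrite subr_eq0 => /eqP.
Qed.

End TailFields.

(** * Splitting the slice into immersions of the factors *)

Section Factors.
Variables (n : 'I_r -> nat) (Q : forall a, 'M[R]_(n a, N)) (pb : prodM M).
Let T := \mxcol_a Q a.
Hypothesis TT : T^T *m T = 1%:M.
Hypothesis QS : forall (a b : 'I_r) (p : prodM M) (v : 'rV[R]_N), a != b ->
  (v <= frame_mx p (lift ord0 a))%MS -> v *m (Q b)^T = 0.

(** For b other than [a], the derivative along M_b lies in f_* E_b, which has no component in block
    [a]. *)
Lemma factor_invariant a (p p' : prodM M) :
  p ord0 = p' ord0 -> p (lift ord0 a) = p' (lift ord0 a) ->
  f p *m (Q a)^T = f p' *m (Q a)^T.
Proof.
move=> e0 ea.
apply: (@partial0_invariant _ _ _ _ _ (fun p => f p *m (Q a)^T)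
  [pred j | (j == ord0) || (j == lift ord0 a)] cMi) => [q|q j Y|j /orP[/eqP ->|/eqP
    ->]] //.
  exact: (mdifferentiable_lin (mulmxr (Q a)^T) (df q)).
rewrite inE negb_or; case: (unliftP ord0 j) Y => [b ->|->] Y; last by rewrite eqxx.
rewrite (inj_eq lift_inj) => /andP[_ ba].
apply: etrans (ediff_lin (mulmxr (Q a)^T) _ (df q)) _.
apply: (QS ba (p := q)); rewrite -[ediff _ _ _]/(partial q Y) -mul_frame_mx.
exact: submxMl.
Qed.

Definition factor a (q : tail M a) : 'rV[R]_(n a) :=
  f (dfwith pb (lift ord0 a) q) *m (Q a)^T.

Lemma factorE x : prod_immersion factor x *m T = f (pcons (pb ord0) x).
Proof.
rewrite -[RHS]mulmx1 -TT mulmxA; congr (_ *m T).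
rewrite /T tr_mxcol mul_mxrow; apply: eq_mxrow => a.
apply: factor_invariant; last by rewrite dfwithin pconsS.
by rewrite (dfwithout _ _ (ord0_lift a)) pcons0.
Qed.

Lemma immersion_factor a : immersion (@factor a).
Proof.
pose g : tail M a -> 'rV[R]_N := f \o dfwith pb (lift ord0 a).
have sg : smooth_map g := smooth_map_affine (@chart_affine_dfwith _ _ _ pb (lift
  ord0 a)) sf.
have sF : smooth_map (@factor a) := smooth_map_lin (mulmxr (Q a)^T) sg.
split; first exact: sF.
move=> q; apply: injective_ediff; first exact: (smooth_map_mdifferentiable _ sF).
move=> X; set p := dfwith pb (lift ord0 a) q.
have -> : ediff (@factor a) q X = partial p X *m (Q a)^T.
  apply: etrans (ediff_lin (mulmxr (Q a)^T) X (smooth_map_mdifferentiable q sg)) _.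
  have gE : ediff g q X = partial p X := @ediff_dfwith R _ M _ f pb (lift ord0 a) q X.
  exact: (congr1 (mulmx^~ (Q a)^T) gE).
(* A vector is recovered from its blocks through [TT]; the a-th block is zero by assumption and the
   others because the vector lies in f_* E_a. *)
move=> e; apply: (@partial_eq0 p); rewrite -[LHS]mulmx1 -TT mulmxA.
rewrite (_ : _ *m T^T = 0) ?mul0mx // /T tr_mxcol mul_mxrow.
rewrite -[RHS]mxrow0; apply: eq_mxrow => b.
have [<-|ab] := eqVneq a b; first exact: e.
by apply: (QS ab (p := p)); rewrite -mul_frame_mx; exact: submxMl.
Qed.

End Factors.

Lemma adapted_polar_partial_tube (r_gt0 : (0 < r)%N) :
  exists (n : 'I_r -> nat) (T : 'M[R]_(\sum_a n a, N))
        (fa : forall a, tail M a -> 'rV[R]_(n a)) (s : nat)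
        (E : prodM (tail M) -> 'M[R]_N)
        (phi : prodM (tail M) -> 'rV[R]_s -> 'rV[R]_N)
        (f0 : M ord0 -> 'rV[R]_s),
      let h := fun x => prod_immersion fa x *m T in
      [/\ T *m T^T = 1%:M /\ T^T *m T = 1%:M,
          forall a, immersion (fa a),
          flat_parallel_subbundle s h E /\ parallel_isometry h E phi,
          immersion f0 /\ (forall p0, Omega h phi (f0 p0)) &
          forall p, f p = partial_tube f0 h phi p].
Proof.
have [[pb _] _] := cM.
(* The spans at all points together, so that one fixed decomposition of the space serves the whole
   manifold. *)
pose S (a : 'I_r) := [set v : 'rV[R]_N | exists p, (v <= frame_mx p (lift ord0
  a))%MS].
have [a b u v ab [p up] [p' vp]|n [Q [TTr TTl QS]]] := orthogonal_decomposition
  r_gt0 (S := S).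
  by apply: frame_mx_orthogonal up vp; rewrite ?ord0_lift // (inj_eq lift_inj).
have QS' (a b : 'I_r) (p : prodM M) (v : 'rV[R]_N) : a != b ->
    (v <= frame_mx p (lift ord0 a))%MS -> v *m (Q b)^T = 0.
  by move=> ab vp; apply: (QS a b v ab); exists p.
pose q0 := pb ord0; pose x0 := tail_pt pb.
pose h : prodM (tail M) -> 'rV[R]_N := f \o pcons q0.
have ih : immersion h := immersion_pcons q0.
have sh : smooth_map h := ih.1.
have [s [Phi [sPhi nPhi tPhi PhiO PhiE]]] := displacement_frame q0 x0.
(* The coordinates of the displacement at [x0] in the orthonormal frame. *)
pose f0 (q : M ord0) := displacement q0 q x0 *m (Phi x0)^T.
have dPhi x := smooth_map_mdifferentiable x sPhi.
have fE q x : f (pcons q x) = h x + f0 q *m Phi x.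
  by rewrite -PhiE addrC subrK.
have if0 : immersion f0.
  have sg : smooth_map (f \o dfwith (pcons q0 x0) ord0 : M ord0 -> _).
    exact: (smooth_map_affine (@chart_affine_dfwith _ _ _ (pcons q0 x0) ord0) sf).
  have gE : (f \o dfwith (pcons q0 x0) ord0) = (fun q => h x0 + f0 q *m Phi x0).
    by apply/funext => q; rewrite /= dfwith_pcons fE.
  have sf0 : smooth_map f0.
    have -> : f0 = (fun q => ((f \o dfwith (pcons q0 x0) ord0) q - h x0) *m (Phi
      x0)^T).
      by apply/funext => q; rewrite /= dfwith_pcons.
    have sgh := smooth_mapB sg (@smooth_map_cst _ (M ord0) _ (h x0)).
    exact: (smooth_map_lin (mulmxr (Phi x0)^T) sgh).
  have d0 q := smooth_map_mdifferentiable q sf0.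
  split; first exact: sf0.
  move=> q; apply: injective_ediff; first exact: d0.
  move=> X e; apply: (@partial_eq0 (dfwith (pcons q0 x0) ord0 q)).
  rewrite /partial -ediff_dfwith gE.
  have dp : mdifferentiable (fun q => f0 q *m Phi x0) q.
    exact: (mdifferentiable_lin (mulmxr (Phi x0)) (d0 q)).
  apply: etrans (ediffD X (mdifferentiable_cst q (h x0)) dp) _.
  rewrite ediff_cst add0r; apply: etrans (ediff_lin (mulmxr (Phi x0)) X (d0 q)) _.
  by rewrite /= e mul0mx.
exists n, (\mxcol_a Q a), (@factor n Q pb), s, (fun x => (Phi x)^T *m Phi x).
exists (fun x y => y *m Phi x), f0 => h'.
have hE : h' = h by apply/funext => x; exact: factorE.
rewrite hE; split.
- by split.
- by move=> a; exact: immersion_factor.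
- by split; [exact: frame_flat_parallel|exact: frame_parallel_isometry].
(* By the Weingarten formula, the differential of f(q, -) on v is h_* of v (I - A); a kernel vector
   [v] of I - A is therefore killed by an immersion. *)
- split=> // q x; rewrite -row_free_unit -kermx_eq0 -submx0;
  apply/rV_subP => v /sub_kermxP.
  rewrite mulmxBr mulmx1 submx0 => vA; apply/eqP.
  have dx : mdifferentiable (fun x => f0 q *m Phi x) x.
    exact: (mdifferentiable_lin (mulmx (f0 q)) (dPhi x)).
  have nx y : (f0 q *m Phi y <= normal_mx h y)%MS.
    by apply: submx_trans (nPhi y); exact: submxMl.
  have eP : ediff (fun x => f0 q *m Phi x) x v = f0 q *m ediff Phi x v.
    exact: (ediff_lin (mulmx (f0 q)) v (dPhi x)).
  have par : normal_derivative h (fun x => f0 q *m Phi x) x v = 0.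
    apply: normal_part_tangent; rewrite eP.
    by apply: submx_trans (tPhi x v); exact: submxMl.
  have dh := smooth_map_mdifferentiable x sh.
  have e0 : ediff (f \o pcons q : prodM (tail M) -> 'rV[R]_N) x v = 0.
    have -> : (f \o pcons q) = (fun x => h x + f0 q *m Phi x).
      by apply/funext => y; exact: fE.
    apply: etrans (ediffD v dh dx) _.
    rewrite (weingarten sh ih dx nx par) -(ediff_argB _ _ dh) vA.
    exact: ediff0.
  exact: (immersion_eq0 (immersion_pcons q) e0).
by move=> p; rewrite -{1}(pcons_tail p); exact: fE.
Qed.

End AdaptedPolar.

Theorem theorem21 (R : realType) (r : nat) (M : 'I_r.+1 -> manifold R)
    (r_gt0 : (0 < r)%N) (connM : connected_manifold (prodM M)) :
  (forall (n : 'I_r -> nat) (fa : forall a, tail M a -> 'rV[R]_(n a)) (s : nat)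
      (E : prodM (tail M) -> 'M[R]_(\sum_a n a))
      (phi : prodM (tail M) -> 'rV[R]_s -> 'rV[R]_(\sum_a n a))
      (f0 : M ord0 -> 'rV[R]_s),
    let h := prod_immersion fa in
    let f := partial_tube f0 h phi in
    (forall a, immersion (fa a)) ->
    flat_parallel_subbundle s h E ->
    parallel_isometry h E phi ->
    immersion f0 ->
    (forall p0, Omega h phi (f0 p0)) ->
    [/\ immersion f, polar (induced_metric f) & adapted f])
  /\
  (forall (N : nat) (f : prodM M -> 'rV[R]_N),
    immersion f -> polar (induced_metric f) -> adapted f ->
    exists (n : 'I_r -> nat) (T : 'M[R]_(\sum_a n a, N))
        (fa : forall a, tail M a -> 'rV[R]_(n a)) (s : nat)
        (E : prodM (tail M) -> 'M[R]_N)
        (phi : prodM (tail M) -> 'rV[R]_s -> 'rV[R]_N)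
        (f0 : M ord0 -> 'rV[R]_s),
      let h := fun x => prod_immersion fa x *m T in
      [/\ T *m T^T = 1%:M /\ T^T *m T = 1%:M,
          forall a, immersion (fa a),
          flat_parallel_subbundle s h E /\ parallel_isometry h E phi,
          immersion f0 /\ (forall p0, Omega h phi (f0 p0)) &
          forall p, f p = partial_tube f0 h phi p]).
Proof.
split=> [n fa s E phi f0 h f ifa [_ EN _ _] Hphi if0 Om|N f imf polf adf]; last first.
  exact: adapted_polar_partial_tube.
(* Fibrewise linearity lets the bundle isometry be replaced by a smooth matrix field with
   orthonormal rows, to which the product rule for matrices applies. *)
pose Phi x : 'M[R]_(s, \sum_a n a) := lin1_mx (phi x).
have phiE x y : phi x y = y *m Phi x := isometry_frameE Hphi x y.
have sPhi : smooth_map Phi := smooth_isometry_frame Hphi.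
have [_ _ _ imphi parphi] := Hphi.
have PhiN x (y : 'rV[R]_s) : (y *m Phi x <= normal_mx h x)%MS.
  by apply: submx_trans (EN x); apply/(imphi x); exists y.
have PhiO x : Phi x *m (Phi x)^T = 1%:M := isometry_frame_orthonormal Hphi x.
have PhiP x X (y : 'rV[R]_s) : normal_part h x (y *m ediff Phi x X) = 0.
  rewrite -(parphi y x X) /normal_derivative.
  have -> : phi ^~ y = (fun x => y *m Phi x) by apply/funext => z; exact: phiE.
  by rewrite (ediff_lin (mulmx y) X (smooth_map_mdifferentiable x sPhi)).
have Om' p0 x : 1%:M - shape_operator h x (f0 p0 *m Phi x) \in unitmx.
  by rewrite -phiE; exact: Om.
have fE : f = (fun p => h (tail_pt p) + f0 (p ord0) *m Phi (tail_pt p)).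
  by apply/funext => p; rewrite /f /partial_tube phiE.
rewrite fE; split.
- exact: immersion_tube.
- exact: polar_tube.
- exact: adapted_tube.
Qed.
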